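(* Let $X$ be a ball Banach function space on $\mathbb R^n$, and let $X'$ be its Köthe associate space. For $0<q<\infty$ and $C>0$ consider the inequality $$\left\|\Big(\sum_{j=1}^N(\mathcal M f_j)^q\Big)^{1/q}\right\|_X\le C\left\|\Big(\sum_{j=1}^N|f_j|^q\Big)^{1/q}\right\|_X .\qquad(\ast)$$ (i) The following statements are equivalent. (a) $\mathcal M:X\to X$ and $\mathcal M:X'\to X'$ are bounded. (b) There exist $q\in(1,\infty)$ and a constant $C>0$ such that $(\ast)$ holds for every $N\in\mathbb N$ and every finite family $\{f_j\}_{j=1}^N$ of measurable functions for which the right-hand side is finite ($C$ being independent of $N$ and of the family). (c) For every $q\in(1,\infty)$ there is a constant $C>0$ such that $(\ast)$ holds for every $N\in\mathbb N$ and every finite family $\{f_j\}_{j=1}^N$ of measurable functions for which the right-hand side is finite ($C$ being independent of $N$ and of the family). (ii) If $q\in(0,\infty)$ and there is a finite constant $C$ such that $(\ast)$ holds for every $N\in\mathbb N$ and every finite family $\{f_j\}_{j=1}^N$ of measurable functions, then $q>1$. More precisely, for $0<q\le 1$ and every ball quasi-Banach function space $Y$ on $\mathbb R^n$, there is no finite constant $C$ such that $(\ast)$ with $X$ replaced by $Y$ holds for every $N\in\mathbb N$ and every finite family of measurable functions for which the right-hand side is finite. (iii) Fix $1<q<\infty$ and $C>0$. Suppose that $(\ast)$, with this $q$ and $C$, holds for every $N\in\mathbb N$ and every finite family of measurable functions for which the right-hand side is finite. Then, for every sequence $\{f_j\}_{j=1}^\infty$ of measurable functions with $\big(\sum_{j=1}^\infty|f_j|^q\big)^{1/q}\in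 X$, $$\left\|\Big(\sum_{j=1}^\infty(\mathcal M f_j)^q\Big)^{1/q}\right\|_X\le C\left\|\Big(\sum_{j=1}^\infty|f_j|^q\Big)^{1/q}\right\|_X .$$ Conversely, this estimate for all such sequences implies $(\ast)$ for all finite families, with the same constant $C$. (iv) The following statements are equivalent, and the constant $C$ may be chosen to be the same in (a)--(c). (a) There is $C>0$ such that $\|\mathcal M f\|_X\le C\|f\|_X$ for all $f\in X$. (b) There is $C>0$ such that, for every $N\in\mathbb N$ and every finite family $\{f_j\}_{j=1}^N$ with $\max_{1\le j\le N}|f_j|\in X$, $\ \big\|\max_{1\le j\le N}\mathcal M f_j\big\|_X\le C\big\|\max_{1\le j\le N}|f_j|\big\|_X$. (c) There is $C>0$ such that, for every sequence $\{f_j\}_{j=1}^\infty$ with $\sup_{j\ge1}|f_j|\in X$, $\ \big\|\sup_{j}\mathcal M f_j\big\|_X\le C\big\|\sup_{j}|f_j|\big\|_X$. These equivalent conditions need not imply that $\mathcal M$ is bounded on $X'$ (i.e. there is a ball Banach function space on $\mathbb R^n$ for which they hold while $\mathcal M$ is not bounded on its Köthe associate space).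
   Context: Functions on $\mathbb R^n$ are identified when equal a.e. (Lebesgue measure). Ball Banach function space $X$: a complete normed linear space of measurable functions on $\mathbb R^n$ such that (1) if $f\in X$ and $|g|\le|f|$ a.e. with $g$ measurable, then $g\in X$ and $\|g\|_X\le\|f\|_X$; (2) (Fatou) if $f_k\in X$, $0\le f_k\uparrow f$ a.e. and $\sup_k\|f_k\|_X<\infty$, then $f\in X$ and $\|f\|_X=\sup_k\|f_k\|_X$; (3) $\mathbf 1_B\in X$ for every ball $B$; (4) for every ball $B$ there is $C_B$ with $\int_B|f|\,dx\le C_B\|f\|_X$ for all $f\in X$. Ball quasi-Banach function space: a quasi-Banach space of measurable functions on $\mathbb R^n$ satisfying (1)--(3) (condition (4) is not required). If a (possibly extended-valued) measurable function $F$ is not in the space, its (quasi-)norm is taken to be $+\infty$. Köthe associate space: $X'=\{g \text{ measurable}:\ \|g\|_{X'}:=\sup_{\|f\|_X\le1}\int_{\mathbb R^n}|fg|\,dx<\infty\}$. Maximal operator: for measurable $f$, $\mathcal M f(x)=\sup_{Q}\mathbf 1_Q(x)\,\frac1{|Q|}\int_Q|f|\in[0,\infty]$, the supremum being over all axis-parallel cubes $Q\subset\mathbb R^n$; integrals may equal $+\infty$, and $0\cdot\infty=0$. An operator $T$ is bounded on $Z$ (written $T:Z\to Z$ bounded) if there is $C<\infty$ with $\|Tf\|_Z\le C\|f\|_Z$ for all $f\in Z$. *)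

(* Defs.v *)
From HB Require Import structures.
From mathcomp Require Import all_boot all_order all_algebra.
From mathcomp Require Import all_classical all_reals all_analysis.

Set Implicit Arguments.
Unset Strict Implicit.
Unset Printing Implicit Defensive.

Import Order.TTheory GRing.Theory Num.Theory.
Import numFieldNormedType.Exports.

Local Open Scope classical_set_scope.
Local Open Scope ring_scope.

Notation Rn R n := (n.-tuple (measurableTypeR R)).

Definition tuple_consp (R : realType) (n : nat)
    (p : measurableTypeR R * Rn R n) : Rn R n.+1 := [tuple of p.1 :: p.2].

Lemma measurable_tuple_consp (R : realType) (n : nat) :
  measurable_fun [set: measurableTypeR R * Rn R n] (@tuple_consp R n).
Proof. exact: measurable_cons measurable_fst measurable_snd. Qed.

Definition lebesgue_product (R : realType) (n : nat)
    (mu : {measure set (Rn R n) -> \bar R}) : set (Rn R n.+1) -> \bar R :=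
  pushforward (product_measure2 (@lebesgue_measure R) mu) (@tuple_consp R n).

HB.instance Definition _ (R : realType) (n : nat)
    (mu : {measure set (Rn R n) -> \bar R}) :=
  Measure.copy (lebesgue_product mu)
    (measure_function_pushforward__canonical__measure_function_Measure
       (product_measure2 (@lebesgue_measure R) mu)
       (@measurable_tuple_consp R n)).

(* Lebesgue measure on the Borel sets of R^n, as the n-fold product of the
   one-dimensional Lebesgue measure. Since functions only matter up to a.e.
   equality and a Lebesgue measurable function is a.e. equal to a Borel one,
   measurability means Borel measurability throughout. *)
Fixpoint lebesgue_Rn (R : realType) (n : nat) :
    {measure set (Rn R n) -> \bar R} :=
  match n with
  | 0 => dirac ([tuple] : Rn R 0)
  | m.+1 => lebesgue_product (lebesgue_Rn R m)
  end.

Section lebesgue_box.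
Local Open Scope ereal_scope.

Lemma lebesgue_Rn_box (R : realType) (n : nat) (A : 'I_n -> set R) :
  (forall i, measurable (A i)) ->
  lebesgue_Rn R n [set x | forall i, A i (tnth x i)] =
  \prod_(i < n) lebesgue_measure (A i).
Proof.
elim: n A => [|n IH] A mA.
  by rewrite big_ord0 /= diracE mem_set// => -[].
rewrite big_ord_recl -(IH (A \o lift ord0)); last by move=> i; exact: mA.
rewrite -product_measure2E; last 2 first.
- exact: mA.
- rewrite [X in measurable X](_ : _ =
    \bigcap_(i in [set: 'I_n]) ((fun x => tnth x i) @^-1` A (lift ord0 i))).
    apply: fin_bigcap_measurable => // i _.
    by rewrite -[X in measurable X]setTI; apply: measurable_tnth => //; exact: mA.
  by apply/seteqP; split => x /= Ax i => [_|]; exact: Ax.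
rewrite /= /lebesgue_product /pushforward; congr (_ _).
apply/seteqP; split => -[x y] /=.
  move=> Axy; split=> [|i]; first exact: (Axy ord0).
  by have := Axy (lift ord0 i); rewrite tnthS.
case=> Ax Ay i; case: (unliftP ord0 i) => [j ->|->//].
by rewrite tnthS; exact: Ay.
Qed.

End lebesgue_box.

Definition euclidean_ball (R : realType) (n : nat) (c : Rn R n) (r : R) :
    set (Rn R n) :=
  [set x | Num.sqrt (\sum_(i < n) ((tnth x i : R) - tnth c i) ^+ 2) < r].

(* Open cubes; closed ones give the same maximal function everywhere. *)
Definition cube (R : realType) (n : nat) (c : Rn R n) (l : R) : set (Rn R n) :=
  [set x | forall i, (tnth c i : R) < tnth x i < (tnth c i : R) + l].

Definition cubes (R : realType) (n : nat) : set (set (Rn R n)) :=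
  [set Q | exists c l, 0 < l /\ Q = cube c l].

(* A space of functions is a set of Borel functions R^n -> R together with a
   norm, only meaningful on that set; a.e. equality is not quotiented out, the
   axioms below make the set and the norm invariant under it. *)
Record fspace (R : realType) (n : nat) := FSpace {
  carrier :> (Rn R n -> R) -> Prop ;
  fnorm : (Rn R n -> R) -> R }.

(* The axioms common to ball Banach and ball quasi-Banach function spaces;
   K is the constant of the (quasi-)triangle inequality. *)
Record ball_function_space (R : realType) (n : nat) (K : R) (X : fspace R n) :
    Prop := {
  bfs_measurable : forall f, X f -> measurable_fun setT f ;
  bfs_zero : X (cst 0) ;
  bfs_add : forall f g, X f -> X g -> X (f \+ g) ;
  bfs_scale : forall (a : R) f, X f -> X (a \*o f) ;
  bfs_norm_ge0 : forall f, X f -> 0 <= fnorm X f ;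
  bfs_norm_eq0 : forall f, X f -> fnorm X f = 0 ->
    {ae lebesgue_Rn R n, forall x, f x = 0} ;
  bfs_norm_scale : forall (a : R) f, X f ->
    fnorm X (a \*o f) = `|a| * fnorm X f ;
  bfs_norm_add : forall f g, X f -> X g ->
    fnorm X (f \+ g) <= K * (fnorm X f + fnorm X g) ;
  bfs_complete : forall u : nat -> Rn R n -> R, (forall k, X (u k)) ->
    (forall e : R, 0 < e -> exists k0, forall i j,
      (k0 <= i)%N -> (k0 <= j)%N -> fnorm X (u i \- u j) < e) ->
    exists2 f, X f & fnorm X (u k \- f) @[k --> \oo] --> (0 : R) ;
  bfs_ideal : forall f g : Rn R n -> R, X f -> measurable_fun setT g ->
    {ae lebesgue_Rn R n, forall x, `|g x| <= `|f x|} ->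
    X g /\ fnorm X g <= fnorm X f ;
  bfs_fatou : forall (u : nat -> Rn R n -> R) (f : Rn R n -> R),
    (forall k, X (u k)) -> measurable_fun setT f ->
    {ae lebesgue_Rn R n, forall x,
      (forall k, 0 <= u k x <= u k.+1 x) /\ u k x @[k --> \oo] --> f x} ->
    has_ubound (range (fun k => fnorm X (u k))) ->
    X f /\ fnorm X f = sup (range (fun k => fnorm X (u k))) ;
  bfs_ball : forall (c : Rn R n) (r : R), 0 < r ->
    X (\1_(euclidean_ball c r)) }.

Definition ball_quasi_banach (R : realType) (n : nat) (X : fspace R n) : Prop :=
  exists2 K : R, 1 <= K & ball_function_space K X.

Definition ball_banach (R : realType) (n : nat) (X : fspace R n) : Prop :=
  ball_function_space 1 X /\
  forall (c : Rn R n) (r : R), 0 < r -> exists C : R, forall f : Rn R n -> R, X f ->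
    (\int[lebesgue_Rn R n]_(x in euclidean_ball c r) `|f x|%:E <=
     (C * fnorm X f)%:E)%E.

Definition fspace_mem (R : realType) (n : nat) (X : fspace R n)
    (F : Rn R n -> \bar R) : Prop :=
  exists2 f, X f & {ae lebesgue_Rn R n, forall x, F x = (f x)%:E}.

(* The extension of the norm by +oo outside X: the set below is empty if F is
   not in X, and otherwise reduces to the norm of F since a.e. equal functions
   of X have the same norm. *)
Definition enorm (R : realType) (n : nat) (X : fspace R n)
    (F : Rn R n -> \bar R) : \bar R :=
  ereal_inf [set (fnorm X f)%:E |
    f in [set f | X f /\ {ae lebesgue_Rn R n, forall x, F x = (f x)%:E}]].

Definition associate_norm (R : realType) (n : nat) (X : fspace R n)
    (g : Rn R n -> R) : \bar R :=
  ereal_sup [set (\int[lebesgue_Rn R n]_x `|f x * g x|%:E)%E |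
    f in [set f | X f /\ fnorm X f <= 1]].

Definition associate (R : realType) (n : nat) (X : fspace R n) : fspace R n :=
  FSpace (fun g => measurable_fun setT g /\ (associate_norm X g < +oo)%E)
    (fun g => fine (associate_norm X g)).

Definition maximal (R : realType) (n : nat) (f : Rn R n -> R) (x : Rn R n) :
    \bar R :=
  ereal_sup [set ((\1_Q x)%:E * ((lebesgue_Rn R n Q)^-1 *
      \int[lebesgue_Rn R n]_(y in Q) `|f y|%:E))%E | Q in @cubes R n].

Definition maximal_bound (R : realType) (n : nat) (Z : fspace R n) (C : R) :
    Prop :=
  forall f, Z f -> (enorm Z (maximal f) <= (C * fnorm Z f)%:E)%E.

Definition maximal_bounded (R : realType) (n : nat) (Z : fspace R n) : Prop :=
  exists C : R, maximal_bound Z C.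

Definition abs_e (R : realType) (n : nat) (f : Rn R n -> R) (x : Rn R n) :
    \bar R := `|f x|%:E.

Definition lq_sum (R : realType) (n N : nat) (q : R)
    (F : 'I_N -> Rn R n -> \bar R) (x : Rn R n) : \bar R :=
  ((\sum_(j < N) F j x `^ q) `^ q^-1)%E.

Definition lq_series (R : realType) (n : nat) (q : R)
    (F : nat -> Rn R n -> \bar R) (x : Rn R n) : \bar R :=
  ((\sum_(0 <= j <oo) F j x `^ q) `^ q^-1)%E.

(* Only used for nonnegative families of positive size, for which starting the
   maximum at 0 is harmless. *)
Definition max_family (R : realType) (n N : nat)
    (F : 'I_N -> Rn R n -> \bar R) (x : Rn R n) : \bar R :=
  (\big[maxe/0]_(j < N) F j x)%E.

Definition sup_family (R : realType) (n : nat)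
    (F : nat -> Rn R n -> \bar R) (x : Rn R n) : \bar R :=
  ereal_sup (range (fun j => F j x)).

Definition fs_inequality (R : realType) (n : nat) (X : fspace R n) (q C : R)
    (N : nat) (f : 'I_N -> Rn R n -> R) : Prop :=
  (enorm X (lq_sum q (fun j => maximal (f j))) <=
   C%:E * enorm X (lq_sum q (fun j => abs_e (f j))))%E.

Definition fs_all (R : realType) (n : nat) (X : fspace R n) (q C : R) : Prop :=
  forall (N : nat) (f : 'I_N -> Rn R n -> R), (0 < N)%N ->
    (forall j, measurable_fun setT (f j)) -> fs_inequality X q C f.

Definition fs_finite_rhs (R : realType) (n : nat) (X : fspace R n) (q C : R) :
    Prop :=
  forall (N : nat) (f : 'I_N -> Rn R n -> R), (0 < N)%N ->
    (forall j, measurable_fun setT (f j)) ->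
    (enorm X (lq_sum q (fun j => abs_e (f j))) < +oo)%E ->
    fs_inequality X q C f.

Definition fs_sequence (R : realType) (n : nat) (X : fspace R n) (q C : R) :
    Prop :=
  forall f : nat -> Rn R n -> R, (forall j, measurable_fun setT (f j)) ->
    fspace_mem X (lq_series q (fun j => abs_e (f j))) ->
    (enorm X (lq_series q (fun j => maximal (f j))) <=
     C%:E * enorm X (lq_series q (fun j => abs_e (f j))))%E.

Definition max_inequality (R : realType) (n : nat) (X : fspace R n) (C : R) :
    Prop :=
  forall (N : nat) (f : 'I_N -> Rn R n -> R), (0 < N)%N ->
    (forall j, measurable_fun setT (f j)) ->
    fspace_mem X (max_family (fun j => abs_e (f j))) ->
    (enorm X (max_family (fun j => maximal (f j))) <=
     C%:E * enorm X (max_family (fun j => abs_e (f j))))%E.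

Definition sup_inequality (R : realType) (n : nat) (X : fspace R n) (C : R) :
    Prop :=
  forall f : nat -> Rn R n -> R, (forall j, measurable_fun setT (f j)) ->
    fspace_mem X (sup_family (fun j => abs_e (f j))) ->
    (enorm X (sup_family (fun j => maximal (f j))) <=
     C%:E * enorm X (sup_family (fun j => abs_e (f j))))%E.

(* Main.v *)
(* For (a) => (c), Rubio de Francia's algorithm produces A_1 majorants G of
   F = (sum |f_j|^q)^(1/q) in X and H of a test function h in X', so that
   H G^(1-q) is an A_q weight. A weighted inequality for the maximal operator
   along a laminar family of cubes, Fatou's lemma in L^q and Young's inequality
   V H <= V^q G^(1-q) H + G H bound the pairing of V = (sum (M f_j)^q)^(1/q) with
   h, and the Lorentz-Luxemburg theorem X'' = X turns this into a norm bound.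
   For (b) => (a), M g is dominated by sum a_P 1_(E_P) over a sparse family of
   cubes, so the bound on X' reduces by duality to
   ||sum c_P 1_P|| <= K ||sum c_P 1_(E_P)|| in X. The hypothesis applied to the
   functions c_P 1_(E_P) controls tau(c) = (sum c_P^m 1_P)^(1/m), m >= q. With
   s_P the sum of the c_R over the R containing P, sigma = sum c_P 1_P satisfies
   sigma^(m+1) <= (m+1) tau(c) tau(s)^m, hence sigma <= e tau(s) + C(e) tau(c),
   and the first term is absorbed since sum s_P 1_(E_P) <= sigma.
   For (ii), thin slabs make the left-hand side diverge harmonically; in (iv) the
   example is L^infinity, whose associate space is L^1. *)

From mathcomp Require Import all_boot all_order all_algebra.
From mathcomp Require Import all_classical all_reals all_analysis.
From mathcomp Require Import measurable_realfun.
From mathcomp Require Import ring lra zify.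
Require Import Defs.

Set Implicit Arguments.
Unset Strict Implicit.
Unset Printing Implicit Defensive.

Import Order.TTheory GRing.Theory Num.Theory.
Import numFieldNormedType.Exports.

Local Open Scope classical_set_scope.
Local Open Scope ring_scope.

(** * Laminar families of sets *)

(** No constant may depend on the family of cubes, so the estimates are proved for finite laminar
    families with constants that do not see the family; finiteness also supplies the a priori finite
    quantities which the absorption arguments require. Cubes with rational data recover the maximal
    function as an increasing limit of maxima over finitely many cubes, the one-third trick puts
    those into $2^n$ laminar grids at the price of a factor $6^n$, and the Fatou property removes
    the truncation. The norm of $X$ need not be order continuous, so $X''=X$ is obtained without the
    Banach dual of $X$: projecting in $L^2$ onto a ball of $X$ yields the separating functional as
    an explicit bounded function. For the converse, only one exponent $q$ is given; an integer $m\ge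
    q$ is used because the bound on $\sigma^{m+1}$ comes from summing differences of $(m+1)$-st
    powers along a chain of cubes. The hypothesis enters there twice: for the family $c_P1_{E_P}$,
    and with a single function to control the averages that duality produces. *)

Section lacunary.
Variable R : realType.

Lemma seq_max_real (I : eqType) (s : seq I) (b : I -> R) : s != [::] ->
  exists2 i, i \in s & forall j, j \in s -> b j <= b i.
Proof.
elim: s => // i [|k s] IH _; first by exists i; rewrite ?mem_head // => j; rewrite inE => /eqP ->.
have [//|j js jmax] := IH.
have [bij|bji] := leP (b i) (b j).
  exists j; first by rewrite inE js orbT.
  by move=> l; rewrite inE => /orP[/eqP ->//|/jmax].
exists i; first by rewrite mem_head.
move=> l; rewrite inE => /orP[/eqP ->//|/jmax lj]; exact: le_trans lj (ltW bji).
Qed.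

(** Geometric series: once the largest value is removed, all others are at most a [k]-th of it, and
    the bound [k / (k - 1) * B] reproduces itself. The sum is comparable with its largest term
    however long [s] is. *)
Lemma lacunary_sum (I : eqType) (k : R) (s : seq I) (b : I -> R) (B : R) :
  1 < k -> uniq s -> (forall i, i \in s -> 0 <= b i) ->
  {in s &, forall i j, i != j -> k * b i <= b j \/ k * b j <= b i} ->
  0 <= B -> (forall i, i \in s -> b i <= B) ->
  \sum_(i <- s) b i <= k / (k - 1) * B.
Proof.
move=> k1 + + + B0; have k0 : 0 < k by lra.
have k10 : 0 < k - 1 by lra.
have kk0 : 0 <= k / (k - 1) by apply: divr_ge0; lra.
move: {2}(size s) (leqnn (size s)) => m.
elim: m s B B0 => [|m IH] s B B0 sm us b0 bb bB.
  by move: sm; rewrite leqn0 size_eq0 => /eqP ->; rewrite big_nil mulr_ge0.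
have [->|s0] := eqVneq s [::]; first by rewrite big_nil mulr_ge0.
have [i is_ imax] := seq_max_real b s0.
rewrite (perm_big _ (perm_to_rem is_)) big_cons /=.
have bi0 := b0 _ is_.
have IHi : \sum_(j <- rem i s) b j <= k / (k - 1) * (b i / k).
  apply: IH.
  - by rewrite divr_ge0 // ltW.
  - by rewrite size_rem //; case: (size s) sm.
  - exact: rem_uniq.
  - by move=> j /mem_rem /b0.
  - by move=> j l /mem_rem js /mem_rem ls; exact: bb.
  - move=> j; rewrite mem_rem_uniq // inE => /andP[ji js].
    rewrite ler_pdivlMr // mulrC.
    have [//|h] := bb _ _ js is_ ji.
    (* Here [k * b i <= b j <= b i], which is possible only if both values vanish. *)
    have := imax _ js; have := b0 _ js => bj0 bji.
    have : b i <= 0 by nra.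
    move=> bi; have bj : b j = 0 by lra.
    by rewrite bj mulr0.
apply: (le_trans (lerD (bB _ is_) IHi)).
have -> : k / (k - 1) * (b i / k) = b i / (k - 1) by field; lra.
have -> : k / (k - 1) * B = B + B / (k - 1) by field; lra.
by rewrite lerD2l ler_pM2r ?invr_gt0 //; exact: bB.
Qed.

(** Convexity of the power: the difference of powers is [x - y] times [m.+1] products, each at most
    [x ^+ m]. It is the difference form of $d(s^{m+1})=(m+1)s^m\,ds$. *)
Lemma powrS_chord (m : nat) (x y : R) : 0 <= y -> y <= x ->
  x ^+ m.+1 <= y ^+ m.+1 + m.+1%:R * (x ^+ m * (x - y)).
Proof.
move=> y0 yx; have x0 : 0 <= x by lra.
rewrite -lerBlDl subrXX mulrC mulrA ler_pM // ?subr_ge0 //.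
  by apply: sumr_ge0 => i _; rewrite mulr_ge0 // exprn_ge0.
rewrite mulr_natl -[X in _ *+ X]card_ord -sumr_const.
apply: ler_sum => i _ /=; have im : (i <= m)%N by rewrite -ltnS.
rewrite -[in leRHS](subnK im) exprD.
apply: ler_wpM2l; first exact: exprn_ge0.
by apply: lerXn2r.
Qed.

End lacunary.

Section set_families.
Context {T : Type}.
Implicit Types (s : seq (set T)) (P Q : set T).

Definition laminar s := forall P Q, P \in s -> Q \in s ->
  [\/ P `<=` Q, Q `<=` P | P `&` Q = set0].

Lemma laminar_sub s t : {subset t <= s} -> laminar s -> laminar t.
Proof. by move=> ts ls P Q /ts Ps /ts Qs; exact: ls. Qed.

Lemma minimal_set s : s != [::] ->
  exists2 P, P \in s & forall Q, Q \in s -> Q `<=` P -> Q = P.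
Proof.
elim: s => // Q [|Q' s] IH _.
  by exists Q; rewrite ?mem_head // => P; rewrite inE => /eqP.
have [//|P Ps Pmin] := IH.
have [[QP QnP]|nQP] := pselect (Q `<=` P /\ Q <> P).
  exists Q; first by rewrite mem_head.
  move=> P'; rewrite inE => /orP[/eqP//|P's P'Q].
  have P'P := Pmin _ P's (subset_trans P'Q QP).
  by apply/seteqP; split=> //; rewrite P'P.
exists P; first by rewrite inE Ps orbT.
move=> P'; rewrite inE => /orP[/eqP ->|/Pmin//] QP.
by apply: contrapT => QnP; apply: nQP.
Qed.

Lemma maximal_set s : s != [::] ->
  exists2 P, P \in s & forall Q, Q \in s -> P `<=` Q -> Q = P.
Proof.
elim: s => // Q [|Q' s] IH _.
  by exists Q; rewrite ?mem_head // => P; rewrite inE => /eqP.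
have [//|P Ps Pmin] := IH.
have [[QP QnP]|nQP] := pselect (P `<=` Q /\ Q <> P).
  exists Q; first by rewrite mem_head.
  move=> P'; rewrite inE => /orP[/eqP//|P's P'Q].
  have P'P := Pmin _ P's (subset_trans QP P'Q).
  by apply/seteqP; split=> //; rewrite P'P.
exists P; first by rewrite inE Ps orbT.
move=> P'; rewrite inE => /orP[/eqP ->|/Pmin//] QP.
by apply: contrapT => QnP; apply: nQP.
Qed.

Variable R : realType.

(** Principal (stopping) sets; [a P] will be an average over [P]. Large sets are decided first: a
    minimal [P] is set aside and added to the choice made among the others only if no chosen set
    above it already has half of [a P]. Being minimal, [P] contains no chosen set strictly, so the
    earlier choices stay valid. *)
Lemma principal_family s (a : set T -> R) : (forall P, 0 <= a P) ->
  exists S : seq (set T), [/\ uniq S, {subset S <= s},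
    (forall P Q, P \in S -> Q \in S -> Q `<=` P -> Q <> P -> 2 * a P <= a Q) &
    (forall Q, Q \in s -> exists P, [/\ P \in S, Q `<=` P & a Q <= 2 * a P])].
Proof.
move=> a0; move: {2}(size s) (leqnn (size s)) => m.
elim: m s => [|m IH] s sm.
  by exists [::]; split=> // Q; move: sm; rewrite leqn0 size_eq0 => /eqP ->.
have [->|s0] := eqVneq s [::]; first by exists [::].
have [P Ps Pmin] := minimal_set s0.
have [|S [uS Ss Sa Sd]] := IH (rem P s).
  by rewrite size_rem //; case: (size s) sm.
have sE Q : Q \in s -> Q = P \/ Q \in rem P s.
  by move=> Qs; have [->|QP] := eqVneq Q P; [left|right; move: Qs; rewrite (perm_mem (perm_to_rem Ps)) inE (negbTE QP)].
have [[P' [P'S PP' aP]]|nP] := pselect (exists P', [/\ P' \in S, P `<=` P' & a P <= 2 * a P']).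
  exists S; split=> //; first by move=> Q /Ss /mem_rem.
  by move=> Q /sE[->|/Sd//]; exists P'.
exists (P :: S); split.
- rewrite /= uS andbT; apply/negP => PS; apply: nP; exists P; split => //.
  by have := a0 P; lra.
- by move=> Q; rewrite inE => /orP[/eqP->//|/Ss /mem_rem].
- move=> Q Q'; rewrite !inE => /orP[/eqP->|QS] /orP[/eqP->|Q'S] //.
  + by move=> /(Pmin _ (mem_rem (Ss _ Q'S))) ->.
  + move=> PQ _; apply/ltW; rewrite ltNge; apply/negP => h; apply: nP; by exists Q.
  + exact: Sa.
- move=> Q /sE[->|/Sd [Q' [Q'S QQ' aQ]]].
    by exists P; split=> //; [exact: mem_head|have := a0 P; lra].
  by exists Q'; split=> //; rewrite inE Q'S orbT.
Qed.

(** Discrete integration of $(m+1)s^m\,ds$ along the chain: the inner sum is the mass of the sets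
    above [P], and for the smallest set it is the whole sum. Removing that set and using
    [powrS_chord] is the induction step. *)
Lemma chain_power_sum (m : nat) s (c : set T -> R) : uniq s ->
  (forall P, 0 <= c P) ->
  {in s &, forall P Q, P `<=` Q \/ Q `<=` P} ->
  (\sum_(P <- s) c P) ^+ m.+1 <= m.+1%:R *
   \sum_(P <- s) (\sum_(Q <- s | `[< P `<=` Q >]) c Q) ^+ m * c P.
Proof.
move=> + c0; move: {2}(size s) (leqnn (size s)) => k.
elim: k s => [|k IH] s sk us ch.
  by move: sk; rewrite leqn0 size_eq0 => /eqP ->; rewrite !big_nil expr0n /= mulr0.
have [->|s0] := eqVneq s [::]; first by rewrite !big_nil expr0n /= mulr0.
have [P Ps Pmin] := minimal_set s0.
have pP := perm_to_rem Ps.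
have Psub Q : Q \in s -> P `<=` Q.
  by move=> Qs; have [//|/(Pmin _ Qs) ->] := ch _ _ Ps Qs.
have ur := rem_uniq P us.
rewrite !(perm_big _ pP) !big_cons /=.
set y := \sum_(j <- rem P s) c j.
have y0 : 0 <= y by apply: sumr_ge0.
have /= := @powrS_chord R m (c P + y) y y0; rewrite lerDr addrK => /(_ (c0 P)) h.
apply: (le_trans h); rewrite mulrDr addrC lerD //.
  rewrite (big_rem P) //= asboolT //.
  rewrite (_ : \sum_(i <- rem P s | _) _ = y) // /y big_seq_cond [RHS]big_seq_cond.
  apply: eq_bigl => Q; rewrite andbT; apply: andb_idr => /mem_rem /Psub h'; exact/asboolP.
apply: le_trans (IH _ _ ur _) _.
- by rewrite size_rem //; case: (size s) sk.
- by move=> Q Q' /mem_rem Qs /mem_rem Q's; exact: ch.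
rewrite ler_wpM2l // big_seq [leRHS]big_seq ler_sum // => Q Qr.
rewrite ler_wpM2r // lerXn2r ?nnegrE ?sumr_ge0 //.
rewrite [leRHS](big_rem P) //= lerDr.
by case: ifP.
Qed.

End set_families.

Ltac meas := repeat first
  [ assumption
  | exact: measurable_cst
  | exact: measurable_id
  | match goal with |- measurable_fun _ (fun x => _ - _) => apply: measurable_funB end
  | match goal with |- measurable_fun _ (fun x => _ + _) => apply: measurable_funD end
  | match goal with |- measurable_fun _ (fun x => _ * _) => apply: measurable_funM end
  | match goal with |- measurable_fun _ (fun x => _ ^+ _) => apply: measurable_funX end
  | match goal with |- measurable_fun _ (fun x => Num.min _ _) => apply: measurable_minr end
  | match goal with |- measurable_fun _ (fun x => Num.max _ _) => apply: measurable_maxr end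
  | match goal with |- measurable_fun _ (fun x => powR _ _) =>
      apply: (measurableT_comp (@measurable_powR _ _)) end
  | match goal with |- measurable_fun _ (fun x => Num.norm _) =>
      apply: (measurableT_comp (@normr_measurable _ _)) end
  | match goal with |- measurable_fun _ (fun x => indic _ _) => apply: measurable_indic end
  | match goal with |- measurable_fun _ (indic _) => apply: measurable_indic end
  | match goal with |- measurable_fun _ (fun x => (_)%:E) => apply/measurable_EFinP end
  | match goal with |- measurable_fun _ (fun x => \sum_(_ <- _ | _) _) =>
      apply: measurable_sum => ? end ].

(** * Integrals of nonnegative real functions *)

Section real_integrals.
Context d (T : measurableType d) (R : realType).
Variable mu : {measure set T -> \bar R}.
Implicit Types (f g : T -> R) (Q : set T).

Definition rint f : \bar R := (\int[mu]_x (f x)%:E)%E.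

Lemma rint_ge0 f : (forall x, 0 <= f x) -> (0 <= rint f)%E.
Proof. by move=> f0; apply: integral_ge0 => x _; rewrite lee_fin. Qed.

Lemma le_rint f g : measurable_fun setT f -> measurable_fun setT g ->
  (forall x, 0 <= f x) -> (forall x, f x <= g x) -> (rint f <= rint g)%E.
Proof.
move=> mf mg f0 fg; apply: ge0_le_integral => //=; try exact/measurable_EFinP.
- by move=> x _; rewrite lee_fin.
- by move=> x _; rewrite lee_fin.
Qed.

Lemma ae_le_rint f g : measurable_fun setT f -> measurable_fun setT g ->
  (forall x, 0 <= f x) -> (forall x, 0 <= g x) ->
  {ae mu, forall x, f x <= g x} -> (rint f <= rint g)%E.
Proof.
move=> mf mg f0 g0 fg; apply: ae_ge0_le_integral => //=; try exact/measurable_EFinP.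
- by move=> x _; rewrite lee_fin.
- by move=> x _; rewrite lee_fin.
- by apply: filterS fg => x h _; rewrite lee_fin.
Qed.

Lemma rintD f g : measurable_fun setT f -> measurable_fun setT g ->
  (forall x, 0 <= f x) -> (forall x, 0 <= g x) ->
  rint (fun x => f x + g x) = (rint f + rint g)%E.
Proof.
move=> mf mg f0 g0; rewrite /rint -ge0_integralD //=; try exact/measurable_EFinP.
- by move=> x _; rewrite lee_fin.
- by move=> x _; rewrite lee_fin.
Qed.

Lemma rintZ (k : R) f : measurable_fun setT f -> (forall x, 0 <= f x) -> 0 <= k ->
  rint (fun x => k * f x) = (k%:E * rint f)%E.
Proof.
move=> mf f0 k0; rewrite /rint -ge0_integralZl_EFin //=; try exact/measurable_EFinP.
by move=> x _; rewrite lee_fin.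
Qed.

Lemma rint_sum (I : Type) (s : seq I) (f : I -> T -> R) :
  (forall i, measurable_fun setT (f i)) -> (forall i x, 0 <= f i x) ->
  rint (fun x => \sum_(i <- s) f i x) = (\sum_(i <- s) rint (f i))%E.
Proof.
move=> mf f0; rewrite /rint -ge0_integral_sum //=; last 2 first.
- by move=> i; exact/measurable_EFinP.
- by move=> i x _; rewrite lee_fin.
by apply: eq_integral => x _; rewrite sumEFin.
Qed.

Lemma rint_indic Q : measurable Q -> rint (\1_Q) = mu Q.
Proof. by move=> mQ; rewrite /rint integral_indic // setIT. Qed.

Lemma rint_setE f Q : measurable Q ->
  (\int[mu]_(x in Q) (f x)%:E)%E = rint (fun x => f x * \1_Q x).
Proof.
move=> mQ; rewrite integral_mkcond; apply: eq_integral => x _.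
rewrite patchE indicE; case: ifP => _; by rewrite ?mulr1 ?mulr0.
Qed.

Lemma rint_fatou (f : nat -> T -> R) (g : T -> R) :
  (forall k, measurable_fun setT (f k)) -> measurable_fun setT g ->
  (forall k x, 0 <= f k x) ->
  {ae mu, forall x, f k x @[k --> \oo] --> g x} ->
  forall B, (forall k, rint (f k) <= B)%E -> (forall x, 0 <= g x) -> (rint g <= B)%E.
Proof.
move=> mf mg f0 fg B fB g0.
have := @fatou _ T R mu setT measurableT (fun k x => (f k x)%:E).
rewrite /= => /(_ (fun k => proj2 (measurable_EFinP _ _) (mf k))).
have f0' : forall n x, setT x -> (0 <= (f n x)%:E)%E by move=> n x _; rewrite lee_fin.
move=> /(_ f0') h.
have : (\int[mu]_x limn_einf (fun k => (f k x)%:E) <= B)%E.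
  apply: (le_trans h); rewrite limn_einf_lim.
  apply: lime_le; first exact: is_cvg_einfs.
  by apply: nearW => k; apply: le_trans (fB k); apply: ereal_inf_lbound; exists k => /=.
apply: le_trans; apply: ae_ge0_le_integral => //=.
- by move=> x _; rewrite lee_fin.
- exact/measurable_EFinP.
- move=> x _; rewrite limn_einf_lim; apply: lime_ge; first exact: is_cvg_einfs.
  by apply: nearW => k; apply: le_ereal_inf_tmp => _ [j _ <-]; rewrite lee_fin.
- have -> : (fun x => limn_einf (fun k => (f k x)%:E)) =
      (-%E \o (fun x => limn_esup (fun k => (- f k x)%:E)))%E.
    apply/funext => x /=; rewrite -limn_einfN.
    by congr limn_einf; apply/funext => k /=; rewrite opprK.
  apply: measurableT_comp => //; apply: measurable_fun_limn_esup => k.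
  by apply/measurable_EFinP; exact: measurableT_comp.
- apply: filterS fg => x fgx _.
  have c : (f k x)%:E @[k --> \oo] --> (g x)%:E by apply: cvg_EFin => //; exact: nearW.
  by rewrite is_cvg_limn_einfE; [rewrite (cvg_lim _ c)|apply/cvg_ex; exists (g x)%:E].
Qed.

End real_integrals.
Notation "\rint[ mu ]_ x f" := (rint mu (fun x => f%R))
  (at level 36, f at level 36, mu at level 10, x at level 0,
   format "'[' \rint[ mu ]_ x '/  '  f ']'").

(** * Weak type and weighted bounds along a laminar family *)

Section laminar_maximal.
Context d (T : measurableType d) (R : realType).
Variable mu : {measure set T -> \bar R}.
Implicit Types (f g phi u : T -> R) (P Q : set T) (s : seq (set T)).

Definition seq_union s : set T := \big[setU/set0]_(Q <- s) Q.

Lemma seq_unionP s x : seq_union s x <-> exists2 Q, Q \in s & Q x.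
Proof. by rewrite /seq_union -bigcup_seq; split=> -[Q] /= Qs Qx; exists Q. Qed.

Lemma measurable_seq_union s : (forall Q, Q \in s -> measurable Q) ->
  measurable (seq_union s).
Proof.
move=> ms; rewrite /seq_union big_seq; apply: bigsetU_measurable => Q; exact: ms.
Qed.

(** A maximal set [P] contains every member that meets it, so the union is [P] plus the union of the
    members disjoint from [P]. The union thus splits into disjoint members and the constant is 1. *)
Lemma laminar_weak_type s g (c : R) : laminar s ->
  (forall Q, Q \in s -> measurable Q) -> measurable_fun setT g ->
  (forall x, 0 <= g x) -> 0 <= c ->
  (forall Q, Q \in s -> (c%:E * mu Q <= \rint[mu]_x (g x * \1_Q x))%E) ->
  (c%:E * mu (seq_union s) <= \rint[mu]_x (g x * \1_(seq_union s) x))%E.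
Proof.
move=> + + mg g0 c0; move: {2}(size s) (leqnn (size s)) => m.
elim: m s => [|m IH] s sm ls ms sc.
  move: sm; rewrite leqn0 size_eq0 => /eqP ->.
  rewrite /seq_union big_nil measure0 mule0; apply: rint_ge0 => x.
  by rewrite mulr_ge0.
have [->|s0] := eqVneq s [::].
  rewrite /seq_union big_nil measure0 mule0; apply: rint_ge0 => x.
  by rewrite mulr_ge0.
have [P Ps Pmax] := maximal_set s0.
pose t := [seq Q <- rem P s | `[< P `&` Q = set0 >]].
have ts : {subset t <= s} by move=> Q; rewrite mem_filter => /andP[_ /mem_rem].
have mt Q : Q \in t -> measurable Q by move=> /ts /ms.
have mP := ms _ Ps.
have mUt := measurable_seq_union mt.
have PUt : P `&` seq_union t = set0.
  apply/seteqP; split=> // x [Px /seq_unionP[Q]]; rewrite mem_filter => /andP[/asboolP PQ _] Qx.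
  by rewrite -PQ.
have sE : seq_union s = P `|` seq_union t.
  apply/seteqP; split=> x.
    move=> /seq_unionP[Q Qs Qx]; have [Px|nPx] := pselect (P x); first by left.
    right; apply/seq_unionP; exists Q => //; rewrite mem_filter.
    have QP : Q <> P by move=> QP; apply: nPx; rewrite -QP.
    apply/andP; split; last first.
      by move: Qs; rewrite (perm_mem (perm_to_rem Ps)) inE => /orP[/eqP//|].
    apply/asboolP; have [PQ|QP'|//] := ls _ _ Ps Qs.
      by have := Pmax _ Qs PQ.
    by exfalso; apply: nPx; exact: QP'.
  move=> [Px|/seq_unionP[Q /ts Qs Qx]]; apply/seq_unionP; [by exists P|by exists Q].
rewrite sE measureU // muleDr //; last by rewrite ge0_adde_def // inE.
have -> : (fun x => g x * \1_(P `|` seq_union t) x) =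
          (fun x => g x * \1_P x + g x * \1_(seq_union t) x).
  apply/funext => x; rewrite -mulrDr; congr (_ * _).
  rewrite !indicE in_setU; have [xP|] := boolP (x \in P); last by rewrite add0r.
  have -> : (x \in seq_union t) = false; last by rewrite addr0.
  apply/negP => xt; have : (P `&` seq_union t) x by split; rewrite -in_setE.
  by rewrite PUt.
rewrite rintD; [|meas|meas|by move=> x; rewrite mulr_ge0|by move=> x; rewrite mulr_ge0].
rewrite leeD //; first exact: sc.
apply: IH => //.
- rewrite size_filter (leq_trans (count_size _ _)) // size_rem //.
  by case: (size s) sm.
- exact: laminar_sub ls.
- by move=> Q /ts; exact: sc.
Qed.

(** The sets of [S] through a given point form a chain, along which [b] is lacunary. *)
Lemma lacunary_chain_sum (k : R) (S : seq (set T)) (b : set T -> R) (x : T) (B : R) :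
  1 < k -> uniq S -> (forall P, 0 <= b P) -> laminar S ->
  (forall P Q, P \in S -> Q \in S -> Q `<=` P -> Q <> P -> k * b P <= b Q) ->
  0 <= B -> (forall P, P \in S -> P x -> b P <= B) ->
  \sum_(P <- S) b P * \1_P x <= k / (k - 1) * B.
Proof.
move=> k1 uS b0 lS Sb B0 bB.
have -> : \sum_(P <- S) b P * \1_P x = \sum_(P <- [seq P <- S | x \in P]) b P.
  rewrite big_filter [RHS]big_mkcond /=; apply: eq_bigr => P _.
  by rewrite indicE; case: (x \in P); rewrite ?mulr1 ?mulr0.
apply: lacunary_sum => //.
- exact: filter_uniq.
- move=> P Q; rewrite !mem_filter => /andP[/set_mem Px PS] /andP[/set_mem Qx QS] PQ.
  have [PsQ|QsP|PQ0] := lS _ _ PS QS.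
  + by right; apply: Sb => //; exact/eqP.
  + by left; apply: Sb => // QP; rewrite QP eqxx in PQ.
  + by have : (P `&` Q) x by []; rewrite PQ0.
- by move=> P; rewrite mem_filter => /andP[/set_mem Px PS]; exact: bB.
Qed.

(** Let [M] be the sum of the averages [a P] over the principal sets through a point. By lacunarity
    $M^p$ is comparable with the sum of the $a_P^p$; writing $a_P^p\,u(P)=a_P^{p-1}\int_P\phi u$
    bounds $\int M^pu$ by a multiple of $\int M^{p-1}\phi u$, and Young's inequality absorbs. The
    constant depends on [p] alone. Boundedness of [m] is recorded so that powers of [m] can later be
    integrated over the cubes. *)
Lemma weighted_maximal (p : R) : 1 < p -> exists2 C : R, 0 < C &
  forall s phi u, laminar s -> (forall Q, Q \in s -> measurable Q) ->
  measurable_fun setT phi -> measurable_fun setT u ->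
  (forall x, 0 <= phi x) -> (forall x, 0 <= u x) ->
  (forall Q, Q \in s -> (0 < \rint[mu]_x (u x * \1_Q x) < +oo)%E) ->
  (forall Q, Q \in s -> (\rint[mu]_x (phi x * u x * \1_Q x) < +oo)%E) ->
  exists m : T -> R, [/\ measurable_fun setT m,
    forall x, 0 <= m x, exists B, forall x, m x <= B,
    forall Q x, Q \in s -> Q x -> (\rint[mu]_x (phi x * u x * \1_Q x) <=
      (m x)%:E * \rint[mu]_x (u x * \1_Q x))%E &
    (\rint[mu]_x (m x `^ p * u x) <=
     C%:E * \rint[mu]_x (phi x `^ p * u x))%E].
Proof.
move=> p1; have p0 : 0 < p by lra.
have p10 : 0 < p - 1 by lra.
(* The factor by which $a_P^{p-1}$ grows when $a_P$ doubles; [C1] sums the resulting geometric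
   series. *)
pose k : R := 2 `^ (p - 1).
have k1 : 1 < k.
  have := @gt0_ltr_powR R (p - 1) p10 1 2; rewrite powR1; apply; rewrite ?nnegrE; lra.
pose C1 : R := k / (k - 1).
have C10 : 0 < C1 by apply: divr_gt0; lra.
have tp0 : 0 < (2 : R) `^ p by apply: powR_gt0.
(* Chosen so that Young's inequality returns exactly half of the left-hand side, as recorded in
   [KE]. *)
pose K : R := 2 * (2 `^ p * C1).
have K0 : 0 < K by do !apply: mulr_gt0 => //.
have KE : 2 `^ p * (C1 / K) = 2^-1 by rewrite /K; field; rewrite !gt_eqF.
pose C2 : R := 2 * (2 `^ p * C1 * K `^ (p - 1)).
have C20 : 0 < C2 by do !apply: mulr_gt0 => //; exact: powR_gt0.
exists (2 `^ p * C2); first by rewrite mulr_gt0.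
move=> s phi u ls ms mphi mu_ phi0 u0 us phius.
pose a Q : R := fine (\rint[mu]_x (phi x * u x * \1_Q x)) /
              fine (\rint[mu]_x (u x * \1_Q x)).
have a0 Q : 0 <= a Q.
  by rewrite divr_ge0 // fine_ge0 // rint_ge0 // => x; rewrite !mulr_ge0.
have aE Q : Q \in s -> \rint[mu]_x (phi x * u x * \1_Q x) =
    ((a Q)%:E * \rint[mu]_x (u x * \1_Q x))%E.
  move=> Qs; have /andP[uQ0 uQoo] := us _ Qs; have := phius _ Qs.
  have uQfin : \rint[mu]_x (u x * \1_Q x) \is a fin_num by rewrite ge0_fin_numE // ltW.
  move=> h; have h' : \rint[mu]_x (phi x * u x * \1_Q x) \is a fin_num.
    by rewrite ge0_fin_numE // rint_ge0 // => x; rewrite !mulr_ge0.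
  rewrite /a -[in RHS](fineK uQfin) -EFinM fineK // mulfVK ?fineK //.
  by rewrite gt_eqF // fine_gt0 // uQ0.
clearbody a.
have [S [uS Ss Sa Sd]] := principal_family s a0.
have lS := laminar_sub Ss ls.
pose M x := \sum_(P <- S) a P * \1_P x.
have M0 x : 0 <= M x by apply: sumr_ge0 => P _; rewrite mulr_ge0.
have aM P x : P \in S -> P x -> a P <= M x.
  move=> PS Px; rewrite /M (big_rem P) //= indicE mem_set // mulr1 lerDl.
  by apply: sumr_ge0 => Q _; rewrite mulr_ge0.
have indS P : P \in S -> measurable_fun setT (\1_P : T -> R).
  by move=> /Ss /ms mP; meas.
have msum (b : set T -> R) : measurable_fun setT (fun x => \sum_(P <- S) b P * \1_P x).
  rewrite (_ : (fun x => _) = (fun x => \sum_(i < size S) b (nth set0 S i) * \1_(nth set0 S i) x)).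
    apply: measurable_sum => i; apply: measurable_funM => //.
    by apply: indS; exact: mem_nth.
  by apply/funext => x; rewrite (big_nth set0) big_mkord.
have mM : measurable_fun setT M by exact: msum.
have Mp x : M x `^ p <= 2 `^ p * \sum_(P <- S) a P `^ p * \1_P x.
  have sum0 : 0 <= \sum_(P <- S) a P `^ p * \1_P x.
    by apply: sumr_ge0 => P _; rewrite mulr_ge0 // powR_ge0.
  have [S0|S0] := eqVneq [seq P <- S | x \in P] [::].
    have -> : M x = 0.
      rewrite /M; transitivity (\sum_(P <- [seq P <- S | x \in P]) a P).
        rewrite big_filter [RHS]big_mkcond /=; apply: eq_bigr => P _.
        by rewrite indicE; case: (x \in P); rewrite ?mulr1 ?mulr0.
      by rewrite S0 big_nil.
    by rewrite powR0 ?gt_eqF // mulr_ge0 // ltW.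
  have [P] := seq_max_real a S0; rewrite mem_filter => /andP[/set_mem Px PS] Pmax.
  have : M x <= 2 / (2 - 1) * a P.
    apply: lacunary_chain_sum => //; first lra.
    by move=> Q QS Qx; apply: Pmax; rewrite mem_filter QS andbT mem_set.
  have -> : (2 / (2 - 1) : R) = 2 by field.
  move=> MP; apply: (@le_trans _ _ ((2 * a P) `^ p)).
    by apply: ge0_ler_powR; rewrite ?nnegrE ?mulr_ge0 //; lra.
  rewrite powRM // ler_pM2l // (big_rem P) //= indicE mem_set // mulr1 lerDl.
  by apply: sumr_ge0 => Q _; rewrite mulr_ge0 // powR_ge0.
have Mp1 x : \sum_(P <- S) a P `^ (p - 1) * \1_P x <= C1 * M x `^ (p - 1).
  apply: lacunary_chain_sum => //.
  - by move=> P; exact: powR_ge0.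
  - move=> P Q PS QS QP nQP; rewrite /k -powRM //.
    by apply: ge0_ler_powR; rewrite ?nnegrE ?mulr_ge0 ?Sa //; lra.
  - exact: powR_ge0.
  - move=> P PS Px; apply: ge0_ler_powR; rewrite ?nnegrE //; first lra.
    exact: aM.
have C1ge := ltW C10; have Kge := ltW K0; clearbody K C1.
(* Young's inequality by comparing [K * phi x] with [M x]. *)
have young x : phi x * M x `^ (p - 1) <= M x `^ p / K + K `^ (p - 1) * phi x `^ p.
  have [h|h] := leP (K * phi x) (M x).
    rewrite -[leLHS]addr0 lerD ?mulr_ge0 ?powR_ge0 //.
    rewrite -(mulr_powRB1 (M0 x) p0) mulrAC ler_wpM2r ?powR_ge0 //.
    by rewrite ler_pdivlMr // mulrC.
  rewrite -[leLHS]add0r lerD // ?divr_ge0 ?powR_ge0 ?(ltW K0) //.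
  rewrite -(mulr_powRB1 (phi0 x) p0) mulrCA ler_wpM2l // -powRM // ?(ltW K0) //.
  by apply: ge0_ler_powR; rewrite ?nnegrE ?(mulr_ge0 (ltW K0) (phi0 x)) //; exact: ltW.
pose I := \rint[mu]_x (M x `^ p * u x).
pose J := \rint[mu]_x (phi x `^ p * u x).
have mMp r : measurable_fun setT (fun x => M x `^ r).
  by apply: (measurableT_comp (@measurable_powR _ _)).
have mphip r : measurable_fun setT (fun x => phi x `^ r).
  by apply: (measurableT_comp (@measurable_powR _ _)).
have I_ge0 : (0 <= I)%E by apply: rint_ge0 => x; rewrite mulr_ge0 // powR_ge0.
have J_ge0 : (0 <= J)%E by apply: rint_ge0 => x; rewrite mulr_ge0 // powR_ge0.
have sumE (b : set T -> R) (v : T -> R) : (forall P, 0 <= b P) -> (forall x, 0 <= v x) ->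
    measurable_fun setT v ->
    \rint[mu]_x (\sum_(P <- S) b P * \1_P x * v x) =
    (\sum_(P <- S) (b P)%:E * \rint[mu]_x (v x * \1_P x))%E.
  move=> b0 v0 mv; transitivity (\rint[mu]_x (\sum_(i < size S)
      b (nth set0 S i) * \1_(nth set0 S i) x * v x)).
    by congr (rint mu _); apply/funext => x; rewrite (big_nth set0) big_mkord.
  have mS (i : 'I_(size S)) : measurable (nth set0 S i).
    by apply/ms/Ss/mem_nth.
  rewrite rint_sum; last 2 first.
  - by move=> i; have := mS i => ?; meas.
  - by move=> i x; rewrite !mulr_ge0.
  rewrite [RHS](big_nth set0) big_mkord; apply: eq_bigr => i _.
  have := mS i => ?; rewrite -rintZ //; [|meas|by move=> x; rewrite mulr_ge0].
  by congr (rint mu _); apply/funext => x; ring.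
have I1 : (I <= (2 `^ p)%:E * \sum_(P <- S) (a P `^ p)%:E * \rint[mu]_x (u x * \1_P x))%E.
  rewrite -sumE //; last by move=> P; exact: powR_ge0.
  rewrite -rintZ //; last 2 first.
  - rewrite (_ : (fun x => _) = (fun x => (\sum_(P <- S) a P `^ p * \1_P x) * u x)).
      by have := msum (fun P => a P `^ p) => ?; meas.
    by apply/funext => x; rewrite mulr_suml.
  - by move=> x; apply: sumr_ge0 => P _; rewrite !mulr_ge0 // powR_ge0.
  apply: le_rint; [by meas| | |].
  - rewrite (_ : (fun x => _) = (fun x => 2 `^ p * ((\sum_(P <- S) a P `^ p * \1_P x) * u x))).
      by have := msum (fun P => a P `^ p) => ?; meas.
    by apply/funext => x; rewrite mulr_suml.
  - by move=> x; rewrite mulr_ge0 // powR_ge0.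
  - by move=> x; rewrite -mulr_suml mulrA ler_wpM2r.
(* Absorbing half of [I] needs [I] finite, which the finiteness of the family provides. *)
have Ioo : (I < +oo)%E.
  apply: (le_lt_trans I1); rewrite lte_mul_pinfty ?lee_fin ?(ltW tp0) //.
  rewrite big_seq; apply: lte_sum_pinfty => P PS; have /andP[uP0 uPoo] := us _ (Ss _ PS).
  by apply: lte_mul_pinfty; rewrite ?lee_fin ?powR_ge0.
have I2 : (I <= (2^-1)%:E * I + (2 `^ p * C1 * K `^ (p - 1))%:E * J)%E.
  apply: (le_trans I1).
  have -> : (\sum_(P <- S) (a P `^ p)%:E * \rint[mu]_x (u x * \1_P x) =
      \sum_(P <- S) (a P `^ (p - 1))%:E * \rint[mu]_x ((phi x * u x) * \1_P x))%E.
    rewrite big_seq [RHS]big_seq; apply: eq_bigr => P PS; rewrite aE ?Ss //.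
    by rewrite muleA -EFinM [(_ * a P)%R]mulrC mulr_powRB1.
  rewrite -sumE; last 3 first.
  - by move=> P; exact: powR_ge0.
  - by move=> x; rewrite mulr_ge0.
  - by meas.
  have h : (\rint[mu]_x ((\sum_(P <- S) a P `^ (p - 1) * \1_P x * (phi x * u x))%R) <=
      \rint[mu]_x ((C1 / K * (M x `^ p * u x) + C1 * K `^ (p - 1) * (phi x `^ p * u x))%R))%E.
    apply: le_rint; [|by meas| |].
    - rewrite (_ : (fun x => _) = (fun x => (\sum_(P <- S) a P `^ (p-1) * \1_P x) * (phi x * u x))).
        by have := msum (fun P => a P `^ (p - 1)) => ?; meas.
      by apply/funext => x; rewrite mulr_suml.
    - by move=> x; apply: sumr_ge0 => P _; rewrite !mulr_ge0 // powR_ge0.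
    - move=> x; rewrite -mulr_suml.
      have := ler_wpM2r (mulr_ge0 (phi0 x) (u0 x)) (Mp1 x).
      move/le_trans; apply.
      rewrite (_ : C1 * M x `^ (p - 1) * (phi x * u x) = (C1 * u x) * (phi x * M x `^ (p - 1))); last by ring.
      have := ler_wpM2l (mulr_ge0 (ltW C10) (u0 x)) (young x).
      move/le_trans; apply; rewrite le_eqVlt; apply/orP; left; apply/eqP.
      by field; rewrite gt_eqF.
  apply: (le_trans (lee_wpmul2l _ h)); first by rewrite lee_fin ltW.
  rewrite rintD; [|by meas|by meas| |]; last 2 first.
  - by move=> x; rewrite !mulr_ge0 ?powR_ge0 ?invr_ge0.
  - by move=> x; rewrite !mulr_ge0 ?powR_ge0.
  rewrite !rintZ; [|by meas| | |by meas| |]; last 4 first.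
  - by move=> x; rewrite mulr_ge0 // powR_ge0.
  - by rewrite mulr_ge0 ?powR_ge0 ?(ltW C10).
  - by move=> x; rewrite mulr_ge0 // powR_ge0.
  - by rewrite divr_ge0 ?(ltW K0) ?(ltW C10).
  rewrite -/I -/J; clearbody I J.
  rewrite ge0_muleDr ?mule_ge0 ?lee_fin ?mulr_ge0 ?powR_ge0 ?invr_ge0 //.
  by rewrite !muleA -!EFinM KE mulrA.
have I3 : (I <= C2%:E * J)%E.
  clearbody I J; clear I1; move: I2 J_ge0.
  case: J => [j| |//]; last by move=> _ _; rewrite gt0_muley ?leey // lte_fin.
  case: I Ioo I_ge0 => // i _ _; rewrite /C2 -!EFinM -EFinD !lee_fin.
  lra.
exists (fun x => 2 * M x); split.
- by meas.
- by move=> x; rewrite mulr_ge0.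
- exists (2 * \sum_(P <- S) a P) => x; rewrite ler_pM2l //; apply: ler_sum => P _.
  by rewrite indicE ler_piMr //; case: (_ \in _).
- move=> Q x Qs Qx; have [P [PS QP aQ]] := Sd _ Qs.
  rewrite aE // lee_wpmul2r //; first by have /andP[/ltW] := us _ Qs.
  by rewrite lee_fin (le_trans aQ) // ler_pM2l //; apply: aM => //; exact: QP.
- rewrite (_ : (fun x => _) = (fun x => 2 `^ p * (M x `^ p * u x))); last first.
    by apply/funext => x; rewrite powRM // mulrA.
  rewrite rintZ; [|by meas|by move=> x; rewrite mulr_ge0 // powR_ge0|exact: ltW].
  by rewrite EFinM -muleA; apply: lee_wpmul2l; [rewrite lee_fin ltW|exact: I3].
Qed.

End laminar_maximal.

(** * Muckenhoupt weights along a laminar family *)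

Section laminar_weights.
Context d (T : measurableType d) (R : realType).
Variable mu : {measure set T -> \bar R}.
Implicit Types (f g w : T -> R) (Q : set T) (s : seq (set T)).

Lemma rint_eq0 f : measurable_fun setT f -> (forall x, 0 <= f x) ->
  rint mu f = 0%E -> {ae mu, forall x, f x = 0}.
Proof.
move=> mf f0 if0; have /(ae_eq_integral_abs mu measurableT) : measurable_fun setT (EFin \o f).
  exact/measurable_EFinP.
move=> /= [+ _] => h; have : (\int[mu]_x `|(f x)%:E| = 0)%E.
  by rewrite -[RHS]if0; apply: eq_integral => x _; rewrite gee0_abs ?lee_fin.
by move/h; apply: filterS => x /(_ I) [].
Qed.

Lemma rint_gt0 f Q : measurable_fun setT f -> measurable Q ->
  (forall x, 0 <= f x) -> (forall x, Q x -> 0 < f x) -> (0 < mu Q)%E ->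
  (0 < \rint[mu]_x (f x * \1_Q x))%E.
Proof.
move=> mf mQ f0 fQ muQ; rewrite lt0e rint_ge0 ?andbT; last by move=> x; rewrite mulr_ge0.
apply/eqP => h; have [||N [mN N0 sN]] := rint_eq0 _ _ h.
- by meas.
- by move=> x; rewrite mulr_ge0.
have : (mu Q <= mu N)%E.
  apply: le_measure; rewrite ?inE // => x Qx; apply: sN => /= /eqP.
  by rewrite indicE mem_set // mulr1 gt_eqF // fQ.
by rewrite N0 leNgt muQ.
Qed.

Lemma rint_le_set f Q (B : R) : measurable_fun setT f -> measurable Q ->
  (forall x, 0 <= f x) -> (forall x, Q x -> f x <= B) -> 0 <= B ->
  (\rint[mu]_x (f x * \1_Q x) <= B%:E * mu Q)%E.
Proof.
move=> mf mQ f0 fB B0; rewrite -rint_indic // -rintZ //.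
apply: le_rint; [by meas|by meas|by move=> x; rewrite mulr_ge0|move=> x].
by rewrite indicE; have [/set_mem/fB|] := boolP (x \in Q); rewrite ?mulr1 ?mulr0.
Qed.

Lemma rint_ge_set f Q (B : R) : measurable_fun setT f -> measurable Q ->
  (forall x, 0 <= f x) -> (forall x, Q x -> B <= f x) -> 0 <= B ->
  (B%:E * mu Q <= \rint[mu]_x (f x * \1_Q x))%E.
Proof.
move=> mf mQ f0 fB B0; rewrite -rint_indic // -rintZ //.
apply: le_rint; [by meas|by meas|by move=> x; rewrite mulr_ge0|move=> x].
by rewrite indicE; have [/set_mem/fB|] := boolP (x \in Q); rewrite ?mulr1 ?mulr0.
Qed.

(* Lerner's argument: the average of [f] over [Q] is controlled by applying the
   weighted maximal operator twice, first for the dual weight, then for [w]. *)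
Lemma laminar_muckenhoupt (q K : R) : 1 < q -> 0 < K -> exists2 C : R, 0 < C &
  forall s f w, laminar s -> (forall Q, Q \in s -> measurable Q) ->
  (forall Q, Q \in s -> (0 < mu Q < +oo)%E) ->
  measurable_fun setT f -> measurable_fun setT w ->
  (forall x, 0 <= f x) -> (forall x, 0 < w x) ->
  (forall Q, Q \in s -> (\rint[mu]_x (f x * \1_Q x) < +oo)%E) ->
  (forall Q, Q \in s -> (\rint[mu]_x (w x * \1_Q x) < +oo)%E) ->
  (forall Q, Q \in s -> (\rint[mu]_x (w x `^ (- (q - 1)^-1) * \1_Q x) < +oo)%E) ->
  (forall Q, Q \in s -> fine (\rint[mu]_x (w x * \1_Q x)) *
     fine (\rint[mu]_x (w x `^ (- (q - 1)^-1) * \1_Q x)) `^ (q - 1) <=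
     K * fine (mu Q) `^ q) ->
  exists m : T -> R, [/\ measurable_fun setT m, forall x, 0 <= m x,
    forall Q x, Q \in s -> Q x -> (\rint[mu]_x (f x * \1_Q x) <= (m x)%:E * mu Q)%E &
    (\rint[mu]_x (m x `^ q * w x) <= C%:E * \rint[mu]_x (f x `^ q * w x))%E].
Proof.
move=> q1 K0; have q10 : 0 < q - 1 by lra.
pose r := (q - 1)^-1; have r0 : 0 < r by rewrite invr_gt0.
have rq : (q - 1) * r = 1 by rewrite mulfV // gt_eqF.
have q'1 : 1 < 1 + r by lra.
have [C1 C10 H1] := weighted_maximal mu q1.
have [C2 C20 H2] := weighted_maximal mu q'1.
have Kr0 : 0 < K `^ (1 + r) by exact: powR_gt0.
exists (K `^ (1 + r) * (C2 * C1)); first by do !apply: mulr_gt0 => //.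
move=> s f w ls ms mus mf mw f0 w0 fs ws ss Aq.
rewrite -/r in ss Aq.
have w_ge0 x : 0 <= w x by exact: ltW.
(* The dual weight $w^{1-q'}$; [1 + r] is the conjugate exponent $q'$. *)
pose sg x := w x `^ (- r).
have sg0 x : 0 < sg x by exact: powR_gt0.
have sg_ge0 x : 0 <= sg x by exact: ltW.
have msg : measurable_fun setT sg by rewrite /sg; meas.
have fsg x Q : f x * w x `^ r * sg x * \1_Q x = f x * \1_Q x.
  by congr (_ * _); rewrite /sg -mulrA -powRD ?subrr ?powRr0 ?mulr1 // (gt_eqF (w0 x)) implybT.
have [||||||Q Qs|Q Qs|m1 [mm1 m10 [B m1B] m1Q m1I]] := H1 s (fun x => f x * w x `^ r) sg => //.
- by meas.
- by move=> x; rewrite mulr_ge0 // powR_ge0.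
- rewrite ss // andbT; apply: rint_gt0 => //; first exact: ms.
  by have /andP[] := mus _ Qs.
- rewrite (_ : (fun x => _) = (fun x => f x * \1_Q x)); first exact: fs.
  by apply/funext => x.
(* Designed so that $\psi w=m_1^{q-1}$ and $\psi^{q'}w=m_1^q\,sg$: the $L^{q'}(w)$ bound for the
   second maximal function feeds on the $L^q(sg)$ bound for the first. *)
pose psi x := m1 x `^ (q - 1) * (w x)^-1.
have wV x : (w x)^-1 = w x `^ (-1) by rewrite powR_inv1.
have psiE x : psi x = m1 x `^ (q - 1) * w x `^ (-1) by rewrite /psi wV.
have mpsi : measurable_fun setT psi.
  rewrite (_ : psi = (fun x => m1 x `^ (q - 1) * w x `^ (-1))); first by meas.
  exact/funext.
have psi0 x : 0 <= psi x by rewrite mulr_ge0 ?powR_ge0 // invr_ge0.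
have psiw x : psi x * w x = m1 x `^ (q - 1) by rewrite /psi divfK // gt_eqF.
have psiwE Q : (fun x => psi x * w x * \1_Q x) = (fun x => m1 x `^ (q - 1) * \1_Q x).
  by apply/funext => x; rewrite psiw.
have psiQ Q : Q \in s -> (\rint[mu]_x (psi x * w x * \1_Q x) < +oo)%E.
  move=> Qs; rewrite psiwE.
  have /andP[_ muQ] := mus _ Qs; have mQ := ms _ Qs.
  (* Boundedness of [m1] makes this integral finite. *)
  apply: (@le_lt_trans _ _ ((Num.max B 0 `^ (q - 1))%:E * mu Q)%E).
    apply: rint_le_set => //; [by meas|by move=> x; exact: powR_ge0|move=> x _|exact: powR_ge0].
    by apply: ge0_ler_powR; rewrite ?nnegrE ?le_max ?m1B ?lexx ?orbT // ltW.
  by rewrite lte_mul_pinfty ?lee_fin ?powR_ge0.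
have wQ0 Q : Q \in s -> (0 < \rint[mu]_x (w x * \1_Q x) < +oo)%E.
  move=> Qs; rewrite ws // andbT; apply: rint_gt0 => //; first exact: ms.
  by have /andP[] := mus _ Qs.
have [m2 [mm2 m20 _ m2Q m2I]] := H2 s psi w ls ms mpsi mw psi0 w_ge0 wQ0 psiQ.
have Km2 x : 0 <= K * m2 x by rewrite mulr_ge0 // ltW.
exists (fun x => (K * m2 x) `^ r); split.
- by meas.
- by move=> x; exact: powR_ge0.
- move=> Q x Qs Qx; have /andP[muQ0 muQ] := mus _ Qs; have mQ := ms _ Qs.
  have muQfin : mu Q \is a fin_num by rewrite ge0_fin_numE // ltW.
  have fQ0 : (0 <= \rint[mu]_x (f x * \1_Q x))%E by apply: rint_ge0 => y; rewrite mulr_ge0.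
  have /andP[{}wQ0 _] := wQ0 _ Qs.
  have sQ0 : (0 < \rint[mu]_x (sg x * \1_Q x))%E by apply: rint_gt0.
  have fQfin := fs _ Qs; have wQfin := ws _ Qs; have sQfin := ss _ Qs.
  have m1Q' y : Q y -> (\rint[mu]_x (f x * \1_Q x) <=
      (m1 y)%:E * \rint[mu]_x (sg x * \1_Q x))%E.
    move=> Qy; have := m1Q _ _ Qs Qy; congr (_ <= _)%E.
    by congr (rint mu _); apply/funext => z.
  have m2Q' := m2Q _ _ Qs Qx.
  have {m2Q'} m2Q' : (\rint[mu]_x (m1 x `^ (q - 1) * \1_Q x) <=
      (m2 x)%:E * \rint[mu]_x (w x * \1_Q x))%E.
    by move: m2Q'; rewrite psiwE.
  have AqQ := Aq _ Qs.
  rewrite -/sg in sQfin AqQ.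
  move: fQ0 wQ0 sQ0 fQfin wQfin sQfin m1Q' m2Q' AqQ.
  rewrite (_ : (fun x => w x `^ (- r) * _) = (fun x => sg x * \1_Q x)) //.
  set F := rint mu _; set W := rint mu (fun x => w x * _).
  set S := rint mu (fun x => sg x * _).
  case: F W S => [F| |] [W| |] [S| |] //; rewrite !lte_fin lee_fin /=.
  move=> F0 W0 S0 _ _ _ m1Q' m2Q' AqQ.
  move: muQ0; rewrite -(fineK muQfin) lte_fin => D0; rewrite -EFinM lee_fin.
  move: AqQ m2Q'; set D := fine (mu Q) in D0 *; move=> AqQ m2Q'.
  (* [F], [W], [S], [D] are the integrals over [Q] of [f], [w], [sg] and 1. As [m1] is at least
     [F / S] on [Q], the bound by [m2] gives $(F/S)^{q-1}D\le m_2W$, and the $A_q$ condition on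
     $WS^{q-1}$ concludes. *)
  have h1 : (((F / S) `^ (q - 1))%:E * mu Q <= \rint[mu]_x (m1 x `^ (q - 1) * \1_Q x))%E.
    apply: rint_ge_set => //; [by meas|by move=> y; exact: powR_ge0| |exact: powR_ge0].
    move=> y Qy; apply: ge0_ler_powR; rewrite ?nnegrE ?divr_ge0 ?(ltW S0) ?(ltW q10) //.
    by rewrite ler_pdivrMr // -lee_fin EFinM m1Q'.
  have := le_trans h1 m2Q'; rewrite -(fineK muQfin) -/D -!EFinM lee_fin => h2.
  rewrite -ler_pdivrMr //.
  have -> : F / D = ((F / D) `^ (q - 1)) `^ r by rewrite -powRrM rq powRr1 // divr_ge0 // ltW.
  apply: ge0_ler_powR; rewrite ?nnegrE ?powR_ge0 ?(ltW r0) //.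
  have -> : (F / D) `^ (q - 1) = (F / S) `^ (q - 1) * S `^ (q - 1) * D `^ (- (q - 1)).
    rewrite -powRM ?divr_ge0 ?(ltW S0) // divfK ?gt_eqF //.
    rewrite powRM ?invr_ge0 ?(ltW D0) //; congr (_ * _).
    by rewrite -powR_inv1 ?(ltW D0) // -powRrM mulN1r.
  rewrite powRN ler_pdivrMr ?powR_gt0 //.
  move: AqQ; rewrite -(mulr_powRB1 (ltW D0) (lt_trans ltr01 q1)) => AqQ.
  rewrite -(ler_pM2r D0) mulrAC.
  apply: (le_trans (ler_wpM2r (powR_ge0 S (q - 1)) h2)); rewrite -mulrA.
  apply: (le_trans (ler_wpM2l (m20 x) AqQ)).
  by rewrite le_eqVlt; apply/orP; left; apply/eqP; ring.
have qr : r * q = 1 + r by move: rq; rewrite mulrBl mul1r => /eqP; rewrite subr_eq => /eqP <-; ring.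
have q1r : (q - 1) * (1 + r) = q by rewrite mulrDr rq mulr1 subrK.
have E1 : (fun x => ((K * m2 x) `^ r) `^ q * w x) =
    (fun x => K `^ (1 + r) * (m2 x `^ (1 + r) * w x)).
  by apply/funext => x; rewrite -powRrM qr powRM ?(ltW K0) // mulrA.
have E2 : (fun x => psi x `^ (1 + r) * w x) = (fun x => m1 x `^ q * sg x).
  apply/funext => x; rewrite psiE powRM ?powR_ge0 // -!powRrM q1r -mulrA; congr (_ * _).
  rewrite -[X in _ * X]powRr1 // -powRD; last by rewrite (gt_eqF (w0 x)) implybT.
  by rewrite /sg mulN1r opprD addrAC addNr add0r.
have E3 : (fun x => (f x * w x `^ r) `^ q * sg x) = (fun x => f x `^ q * w x).
  apply/funext => x; rewrite powRM ?powR_ge0 // -powRrM -mulrA; congr (_ * _).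
  rewrite qr /sg -powRD; last by rewrite (gt_eqF (w0 x)) implybT.
  by rewrite addrK powRr1.
rewrite E1 rintZ; last 3 first.
- by meas.
- by move=> x; rewrite mulr_ge0 // powR_ge0.
- exact: ltW.
rewrite EFinM -muleA; apply: lee_wpmul2l; first by rewrite lee_fin ltW.
apply: (le_trans m2I); rewrite E2 EFinM -muleA.
apply: lee_wpmul2l; first by rewrite lee_fin ltW.
by apply: (le_trans m1I); rewrite E3.
Qed.

End laminar_weights.

(** * The maximal operator and dyadic cubes *)

Section cubes.
Variables (R : realType) (n : nat).
Implicit Types (c x : Rn R n) (l r : R) (f g : Rn R n -> R).
Local Notation mu := (lebesgue_Rn R n).

Lemma cube_box c l :
  cube c l = [set x | forall i, `](tnth c i : R), (tnth c i : R) + l[%classic (tnth x i)].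
Proof. by apply/seteqP; split=> x h i; have := h i; rewrite /= in_itv. Qed.

Lemma measurable_cube c l : measurable (cube c l).
Proof.
rewrite cube_box [X in measurable X](_ : _ =
    \bigcap_(i in [set: 'I_n]) ((fun x => tnth x i) @^-1`
       `](tnth c i : R), (tnth c i : R) + l[%classic)).
  apply: fin_bigcap_measurable => // i _.
  by rewrite -[X in measurable X]setTI; apply: measurable_tnth.
by apply/seteqP; split => x /= Ax i => [_|]; exact: Ax.
Qed.

Lemma lebesgue_cube c l : 0 < l -> mu (cube c l) = (l ^+ n)%:E.
Proof.
move=> l0; rewrite cube_box (@lebesgue_Rn_box R n (fun i => `](tnth c i : R), (tnth c i : R) + l[%classic)) //.
rewrite (eq_bigr (fun=> l%:E)); last first.
  move=> i _; rewrite lebesgue_measure_itv /= lte_fin ltrDl l0 -EFinD.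
  by congr _%:E; rewrite addrC addKr.
by rewrite prodEFin prodr_const card_ord.
Qed.

Definition cube_average f c l : \bar R :=
  ((l ^+ n)^-1%:E * \rint[mu]_x (`|f x| * \1_(cube c l) x))%E.

Lemma maximal_term f c l x : 0 < l ->
  ((\1_(cube c l) x)%:E * ((mu (cube c l))^-1 *
      \int[mu]_(y in cube c l) `|f y|%:E) =
   (\1_(cube c l) x)%:E * cube_average f c l)%E.
Proof.
move=> l0; rewrite lebesgue_cube // inver ifF; last by rewrite gt_eqF // exprn_gt0.
by rewrite rint_setE //; exact: measurable_cube.
Qed.

Lemma cube_average_ge0 f c l : 0 < l -> (0 <= cube_average f c l)%E.
Proof.
move=> l0; rewrite mule_ge0 ?lee_fin ?invr_ge0 ?exprn_ge0 ?(ltW l0) //.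
by apply: rint_ge0 => y; rewrite mulr_ge0.
Qed.

Lemma maximal_ge f c l x : 0 < l -> cube c l x ->
  (cube_average f c l <= maximal f x)%E.
Proof.
move=> l0 cx; apply: ereal_sup_ubound; exists (cube c l); first by exists c, l.
by rewrite maximal_term // indicE mem_set // mul1e.
Qed.

Lemma maximal_le f x (B : \bar R) : (0 <= B)%E ->
  (forall c l, 0 < l -> cube c l x -> (cube_average f c l <= B)%E) ->
  (maximal f x <= B)%E.
Proof.
move=> B0 fB; apply: ge_ereal_sup => _ [_ [c [l [l0 ->]]] <-].
rewrite maximal_term // indicE; have [/set_mem cx|_] := boolP (x \in cube c l).
  by rewrite mul1e fB.
by rewrite mul0e.
Qed.

Lemma unit_cube_around x l : 0 < l ->
  exists2 c, cube c l x & forall i, (tnth c i : R) = tnth x i - l / 2.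
Proof.
move=> l0; exists [tuple (tnth x i : R) - l / 2 : measurableTypeR R | i < n].
  by move=> i; rewrite tnth_mktuple; apply/andP; split; lra.
by move=> i; rewrite tnth_mktuple.
Qed.

Lemma maximal_ge0 f x : (0 <= maximal f x)%E.
Proof.
have [c cx _] := unit_cube_around x ltr01.
exact: le_trans (cube_average_ge0 _ _ _) (maximal_ge f ltr01 cx).
Qed.

Lemma le_cube_average f g c l : measurable_fun setT f -> measurable_fun setT g ->
  0 < l -> {ae mu, forall x, `|f x| <= `|g x|} ->
  (cube_average f c l <= cube_average g c l)%E.
Proof.
move=> mf mg l0 fg; apply: lee_wpmul2l; first by rewrite lee_fin invr_ge0 exprn_ge0 // ltW.
have mc := measurable_cube c l.
apply: ae_le_rint; [by meas|by meas| | |].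
- by move=> x; rewrite mulr_ge0.
- by move=> x; rewrite mulr_ge0.
- by apply: filterS fg => x h; rewrite ler_wpM2r.
Qed.

Lemma le_maximal f g x : measurable_fun setT f -> measurable_fun setT g ->
  {ae mu, forall x, `|f x| <= `|g x|} -> (maximal f x <= maximal g x)%E.
Proof.
move=> mf mg fg; apply: maximal_le (maximal_ge0 _ _) _ => c l l0 cx.
exact: le_trans (le_cube_average c mf mg l0 fg) (maximal_ge g l0 cx).
Qed.

Lemma ae_eq_maximal f g : measurable_fun setT f -> measurable_fun setT g ->
  {ae mu, forall x, `|f x| = `|g x|} -> maximal f = maximal g.
Proof.
move=> mf mg fg; apply/funext => x; apply/eqP; rewrite eq_le; apply/andP; split;
  by apply: le_maximal => //; apply: filterS fg => y ->.
Qed.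

Lemma cube_average_expand f c l c' l' (s : R) : measurable_fun setT f ->
  0 < l -> 0 < l' -> cube c l `<=` cube c' l' -> l' ^+ n <= s * l ^+ n -> 0 <= s ->
  (cube_average f c l <= s%:E * cube_average f c' l')%E.
Proof.
move=> mf l0 l'0 cc' ll' s0.
have [mc mc'] := (measurable_cube c l, measurable_cube c' l').
have ln0 : 0 < l ^+ n by rewrite exprn_gt0.
have l'n0 : 0 < l' ^+ n by rewrite exprn_gt0.
rewrite /cube_average muleA -EFinM.
apply: (@le_trans _ _ ((s * (l' ^+ n)^-1)%:E * \rint[mu]_x (`|f x| * \1_(cube c l) x))%E).
  apply: lee_wpmul2r; first by apply: rint_ge0 => x; rewrite mulr_ge0.
  by rewrite lee_fin -[leLHS]mul1r ler_pdivrMr // mulrAC ler_pdivlMr // mul1r.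
apply: lee_wpmul2l; first by rewrite lee_fin mulr_ge0 // invr_ge0 ltW.
apply: le_rint; [by meas|by meas|by move=> x; rewrite mulr_ge0|move=> x].
apply: ler_wpM2l => //; rewrite !indicE ler_nat.
by have [/set_mem/cc' h|//] := boolP (x \in cube c l); rewrite mem_set.
Qed.

(** An enumeration of the cubes with rational corner and side. Invalid codes and nonpositive sides
    give a cube of side 1, so that every index yields a genuine cube. *)
Definition rational_cube (k : nat) : Rn R n * R :=
  match (unpickle k : option (n.-tuple rat * rat)) with
  | Some (c, l) => ([tuple ratr (tnth c i) : measurableTypeR R | i < n],
      if 0 < l then ratr l else 1)
  | None => ([tuple 0 : measurableTypeR R | i < n], 1) end.

Definition qcube k := cube (rational_cube k).1 (rational_cube k).2.

Lemma qcube_side k : 0 < (rational_cube k).2.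
Proof.
by rewrite /rational_cube; case: unpickle => [[c l]|] //=; case: ifP; rewrite ?ltr0q.
Qed.

Hypothesis n_gt0 : (0 < n)%N.

(** Approximation from outside, so that an average loses only the ratio of the volumes. Enlarging
    the side by the [n]-th root [s] of [1 + e] leaves room for rational data on both sides. *)
Lemma qcube_outer c l e : 0 < l -> 0 < e ->
  exists k, cube c l `<=` qcube k /\ (rational_cube k).2 ^+ n <= (1 + e) * l ^+ n.
Proof.
move=> l0 e0; pose s : R := (1 + e) `^ n%:R^-1.
have n0 : (0 : R) < n%:R by rewrite ltr0n.
have s1 : 1 < s.
  have := @gt0_ltr_powR R n%:R^-1 _ 1 (1 + e); rewrite powR1; apply; rewrite ?invr_gt0 ?nnegrE; lra.
have sn : s ^+ n = 1 + e.
  by rewrite -powR_mulrn ?powR_ge0 // -powRrM mulVf ?powRr1 ?gt_eqF //; lra.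
pose dl := (l * s - l) / 2; have dl0 : 0 < dl by rewrite /dl; nra.
have /choice[q qP] : forall i, exists q : rat, (ratr q : R) \in `](tnth c i : R) - dl, (tnth c i : R)[.
  by move=> i; apply: rat_in_itvoo; lra.
have [l' l'P] : exists q : rat, ratr q \in `]l + dl, l * s[.
  by apply: rat_in_itvoo; rewrite /dl; nra.
move: l'P; rewrite in_itv /= => /andP[l'1 l'2].
have l'0 : (0 : rat) < l' by rewrite -(ltr0q R); lra.
exists (pickle ([tuple q i | i < n], l')); rewrite /qcube /rational_cube pickleK l'0 /=; split.
  move=> x cx i; have := cx i; have := qP i; rewrite in_itv /= !tnth_mktuple => /andP[? ?] /andP[? ?].
  by apply/andP; split; lra.
rewrite -sn -exprMn; apply: lerXn2r; rewrite ?nnegrE; [lra|nra|].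
by rewrite mulrC ltW.
Qed.

(** Countably many cubes suffice; this gives measurability of the maximal function and its
    exhaustion by maxima over finitely many cubes. *)
Lemma maximal_qcube f x : measurable_fun setT f -> maximal f x =
  ereal_sup (range (fun k => (\1_(qcube k) x)%:E *
    cube_average f (rational_cube k).1 (rational_cube k).2)%E).
Proof.
move=> mf; set S := ereal_sup _; apply/eqP; rewrite eq_le; apply/andP; split; last first.
  apply: ge_ereal_sup => _ [k _ <-]; rewrite indicE.
  have [/set_mem kx|_] := boolP (x \in _); last by rewrite mul0e maximal_ge0.
  by rewrite mul1e maximal_ge // qcube_side.
have S0 : (0 <= S)%E.
  apply: le_trans (ereal_sup_ubound _); last by exists 0%N.
  by rewrite mule_ge0 ?lee_fin // cube_average_ge0 // qcube_side.
apply: maximal_le => // c l l0 cx.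
apply/lee_addgt0Pr => e e0.
(* The loss is a factor [1 + t]; for a finite supremum a small [t] turns it into the additive error
   [e]. *)
suff H : forall t, 0 < t -> (cube_average f c l <= (1 + t)%:E * S)%E.
  move: (S) S0 H; case=> [r| |] //; last by move=> _ _; rewrite addye ?leey.
  rewrite lee_fin => r0 H; apply: le_trans (H (e / (1 + r)) _) _; first by rewrite divr_gt0; lra.
  rewrite -EFinM -EFinD lee_fin mulrDl mul1r lerD2l -mulrA ler_piMr ?(ltW e0) //.
  by rewrite mulrC ler_pdivrMr; lra.
move=> t t0; have [k [ck kl]] := qcube_outer c l0 t0.
apply: le_trans (cube_average_expand _ _ (qcube_side k) ck kl _) _ => //; first lra.
apply: lee_wpmul2l; first by rewrite lee_fin; lra.
apply: ereal_sup_ubound; exists k => //.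
by rewrite indicE mem_set ?mul1e //; exact: ck.
Qed.

Lemma measurable_maximal f : measurable_fun setT f -> measurable_fun setT (maximal f).
Proof.
move=> mf; have -> : maximal f = fun x => esups (fun k => (\1_(qcube k) x)%:E *
    cube_average f (rational_cube k).1 (rational_cube k).2)%E 0.
  apply/funext => x; rewrite maximal_qcube // /esups /= /sdrop; congr ereal_sup.
  by apply/seteqP; split=> _ [k _ <-]; exists k.
apply: measurable_fun_esups => k; apply: emeasurable_funM => //.
by have := measurable_cube (rational_cube k).1 (rational_cube k).2 => ?; meas.
Qed.

Lemma maximal_sum_le (I : Type) (s : seq I) (b : I -> R) (f : I -> Rn R n -> R) x :
  (forall i, measurable_fun setT (f i)) -> (forall i, 0 <= b i) -> (forall i y, 0 <= f i y) ->
  (maximal (fun y => \sum_(i <- s) b i * f i y)%R x <= \sum_(i <- s) (b i)%:E * maximal (f i) x)%E.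
Proof.
move=> mf b0 f0; apply: maximal_le => [|c l l0 cx].
  by apply: sume_ge0 => i _; rewrite mule_ge0 ?lee_fin // maximal_ge0.
have mc := measurable_cube c l.
rewrite /cube_average.
have -> : \rint[mu]_y (`|\sum_(i <- s) b i * f i y| * \1_(cube c l) y) =
    (\sum_(i <- s) (b i)%:E * \rint[mu]_y (`|f i y| * \1_(cube c l) y))%E.
  transitivity (\rint[mu]_y (\sum_(i <- s) b i * (`|f i y| * \1_(cube c l) y))).
    congr (rint mu _); apply/funext => y; rewrite ger0_norm; last first.
      by apply: sumr_ge0 => i _; rewrite mulr_ge0.
    by rewrite mulr_suml; apply: eq_bigr => i _; rewrite mulrA ger0_norm.
  rewrite rint_sum; last 2 first.
  - by move=> i; have := mf i => ?; meas.
  - by move=> i y; rewrite !mulr_ge0.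
  apply: eq_bigr => i _; by rewrite rintZ //; have := mf i => ?; meas.
rewrite ge0_sume_distrr; last by move=> i _; rewrite mule_ge0 ?lee_fin // rint_ge0 // => y; rewrite mulr_ge0.
apply: lee_sum => i _; rewrite muleCA; apply: lee_wpmul2l; first by rewrite lee_fin.
exact: maximal_ge.
Qed.

End cubes.
Arguments rational_cube : clear implicits.
Arguments qcube : clear implicits.

(** * Exhaustion by cubes and shifted dyadic grids *)

Section dyadic.
Variables (R : realType) (n : nat).
Implicit Types (c x : Rn R n) (l r : R).
Local Notation mu := (lebesgue_Rn R n).

Lemma euclidean_ballE c r : 0 < r ->
  euclidean_ball c r = [set x | \sum_(i < n) ((tnth x i : R) - tnth c i) ^+ 2 < r ^+ 2].
Proof.
move=> r0; have h (a : R) : (Num.sqrt a < r) = (a < r ^+ 2).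
  by rewrite -[in LHS](gtr0_norm r0) -sqrtr_sqr ltr_sqrt // exprn_gt0.
by apply/seteqP; split=> x; rewrite /euclidean_ball /= h.
Qed.

Lemma measurable_euclidean_ball c r : 0 < r -> measurable (euclidean_ball c r).
Proof.
move=> r0; rewrite euclidean_ballE //.
have mS : measurable_fun setT (fun x : Rn R n => \sum_(i < n) ((tnth x i : R) - tnth c i) ^+ 2).
  apply: measurable_sum => i; apply: measurable_funX; apply: measurable_funB => //.
  exact: measurable_tnth.
have -> : [set x : Rn R n | \sum_(i < n) ((tnth x i : R) - tnth c i) ^+ 2 < r ^+ 2] =
    setT `&` (fun x : Rn R n => \sum_(i < n) ((tnth x i : R) - tnth c i) ^+ 2) @^-1` `]-oo, r ^+ 2[%classic.
  by rewrite setTI; apply/seteqP; split=> x /=; rewrite in_itv.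
exact: mS.
Qed.

(** A crude radius: the center of the ball is a corner of the cube, whose diameter is $l\sqrt n$. *)
Lemma cube_sub_ball c l : 0 < l -> cube c l `<=` euclidean_ball c (l * n.+1%:R).
Proof.
move=> l0 x cx; rewrite euclidean_ballE ?mulr_gt0 // /=.
apply: (@le_lt_trans _ _ (\sum_(i < n) l ^+ 2)).
  apply: ler_sum => i _; have /andP[? ?] := cx i.
  by apply: lerXn2r; rewrite ?nnegrE; lra.
rewrite sumr_const card_ord exprMn -[X in X < _]mulr_natr ltr_pM2l ?exprn_gt0 //.
by rewrite -natrX ltr_nat -mulnn; lia.
Qed.

Lemma ball_sub_cube c r : 0 < r -> exists c', euclidean_ball c r `<=` cube c' (2 * r).
Proof.
move=> r0; exists [tuple (tnth c i : R) - r : measurableTypeR R | i < n].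
rewrite euclidean_ballE // => x /= h i; rewrite tnth_mktuple.
have : ((tnth x i : R) - tnth c i) ^+ 2 < r ^+ 2.
  apply: le_lt_trans h; rewrite (bigD1 i) //= lerDl.
  by apply: sumr_ge0 => j _; exact: sqr_ge0.
move: (tnth x i : R) (tnth c i : R) => a b ab.
have : `|a - b| < r by rewrite -(gtr0_norm r0) -ltr_sqr ?nnegrE // !real_normK ?num_real // .
by rewrite ltr_norml => /andP[? ?]; apply/andP; split; lra.
Qed.

Definition centered_cube (k : nat) : set (Rn R n) :=
  cube [tuple - k.+1%:R : measurableTypeR R | i < n] (2 * k.+1%:R).

Lemma centered_cubeP k x :
  centered_cube k x <-> forall i, `|(tnth x i : R)| < k.+1%:R.
Proof.
split=> h i; have := h i; rewrite ?tnth_mktuple ltr_norml => /andP[? ?]; apply/andP; split; lra.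
Qed.

Lemma centered_cube_cover x : exists k0, forall k, (k0 <= k)%N -> centered_cube k x.
Proof.
exists (Num.bound (\sum_(i < n) `|(tnth x i : R)|)) => k k0k; apply/centered_cubeP => i.
apply: (@le_lt_trans _ _ (\sum_(i < n) `|(tnth x i : R)|)).
  by rewrite (bigD1 i) //= lerDl sumr_ge0.
apply: (@lt_le_trans _ _ (Num.bound (\sum_(i < n) `|(tnth x i : R)|))%:R).
  by apply: archi_boundP; rewrite sumr_ge0.
by rewrite ler_nat; exact: leqW.
Qed.

Lemma centered_cube_mono k k' : (k <= k')%N -> centered_cube k `<=` centered_cube k'.
Proof.
move=> kk' x /centered_cubeP h; apply/centered_cubeP => i.
by apply: lt_le_trans (h i) _; rewrite ler_nat.
Qed.

Lemma cube_sub_centered c l : exists k, cube c l `<=` centered_cube k.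
Proof.
pose B := \sum_(i < n) `|(tnth c i : R)| + `|l|.
have B0 : 0 <= B by rewrite addr_ge0 // sumr_ge0.
exists (Num.bound B) => x cx; apply/centered_cubeP => i.
apply: (@lt_le_trans _ _ (Num.bound B)%:R); last by rewrite ler_nat.
apply: le_lt_trans (archi_boundP B0).
have ci : `|(tnth c i : R)| <= \sum_(i < n) `|(tnth c i : R)|.
  by rewrite (bigD1 i) //= lerDl sumr_ge0.
have /andP[x1 x2] := cx i.
rewrite /B ler_norml; have := ler_norm (tnth c i : R); have := ler_norm l.
have := ler_norm (- (tnth c i : R)); rewrite normrN => *.
by apply/andP; split; lra.
Qed.

(* The left endpoints of the two grids at scale [3 * t / 2 ^ j], one of them
   shifted by [t], are pairwise at distance at least a third of the scale. *)
Lemma third_trick (j : nat) (s t c l : R) : s * 2 ^+ j = 3 * t -> 0 < s -> 0 < l ->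
  3 * l <= s -> exists (b : bool) (m : int),
  m%:~R * s + b%:R * t <= c /\ c + l <= (m + 1)%:~R * s + b%:R * t.
Proof.
move=> st s0 l0 ls.
pose m0 := Num.floor (c / s); pose m1 := Num.floor ((c - t) / s).
have /andP[] := floor_itv (c / s); rewrite -/m0 ler_pdivlMr // ltr_pdivrMr // => m01 m02.
have /andP[] := floor_itv ((c - t) / s); rewrite -/m1 ler_pdivlMr // ltr_pdivrMr // => m11 m12.
have [h0|h0] := leP (c + l) ((m0 + 1)%:~R * s).
  by exists false, m0; rewrite !mul0r !addr0.
have [h1|h1] := leP (c + l) ((m1 + 1)%:~R * s + t).
  by exists true, m1; rewrite !mul1r; split=> //; lra.
(* Otherwise a point of each grid lies inside the interval, and the two are closer than
   [l <= s / 3]. Three times their difference is [z * s], so the integer [z] vanishes and 3 divides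
   a power of 2. *)
exfalso; pose z : int := 3 * (m0 - m1) - 2 ^+ j.
have zE : (z%:~R : R) * s = 3 * ((m0 + 1)%:~R * s - ((m1 + 1)%:~R * s + t)).
  rewrite /z rmorphB rmorphM /= rmorphB rmorphXn /= mulrBl [2 ^+ j * s]mulrC st !rmorphD /=.
  by ring.
have zs : `|(z%:~R : R) * s| < s by rewrite zE ltr_norml; apply/andP; split; lra.
have : `|(z%:~R : R)| < 1.
  by move: zs; rewrite normrM (gtr0_norm s0) -[X in _ < X]mul1r ltr_pM2r.
rewrite -intr_norm -[1]/(1%:~R) ltr_int => z1.
have z0 : z = 0 by lia.
have : (3 %| 2 ^ j)%N.
  apply/dvdnP; exists `|m0 - m1|%N.
  have : (2 ^+ j : int) = 3 * (m0 - m1) by move: z0; rewrite /z => /eqP; rewrite subr_eq0 => /eqP.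
  move/(congr1 absz); rewrite abszM abszX /= mulnC => h; exact: h.
by rewrite Euclid_dvdX.
Qed.

(** The grid is shifted by [t] in the coordinates selected by [al], by the same amount at every
    scale: for fixed [al] the grids are nested, and [t] is a third of the top scale, as the
    one-third trick demands. *)
Definition dyadic_cube (t : R) (al : {ffun 'I_n -> bool}) (j : nat) (m : 'I_n -> int) : set (Rn R n) :=
  cube [tuple (m i)%:~R * (3 * t / 2 ^+ j) + (al i)%:R * t : measurableTypeR R | i < n] (3 * t / 2 ^+ j).

Lemma dyadic_cube_nested t al j j' m m' : 0 < t -> (j <= j')%N ->
  dyadic_cube t al j' m' `<=` dyadic_cube t al j m \/
  dyadic_cube t al j m `&` dyadic_cube t al j' m' = set0.
Proof.
move=> t0 jj'.
have [[x [xj xj']]|h] := pselect (exists x, dyadic_cube t al j m x /\ dyadic_cube t al j' m' x); last first.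
  by right; apply/seteqP; split => // x xx; apply: h; exists x.
left => y yj' i; have := xj i; have := xj' i; have := yj' i; rewrite !tnth_mktuple.
set s' := 3 * t / 2 ^+ j'; set s := 3 * t / 2 ^+ j.
have s'0 : 0 < s' by rewrite divr_gt0 ?mulr_gt0 ?exprn_gt0.
have ss' : s = (2 ^+ (j' - j))%:~R * s'.
  rewrite rmorphXn /= /s /s' -[in RHS](subnK jj') exprD addnK; field.
  by rewrite !gt_eqF // exprn_gt0.
move: (tnth x i : R) (tnth y i : R) ((al i)%:R * t) (m i) (m' i) => a b u k k'.
move=> /andP[b1 b2] /andP[a1' a2'] /andP[a1 a2].
set D : int := 2 ^+ (j' - j); rewrite -/D in ss'.
(* A common point gives the inclusion up to less than one unit of the finer scale; integrality makes
   it exact. *)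
have e1 : k * D <= k'.
  rewrite -ltzD1 -(ltr_int R) -(ltr_pM2r s'0) rmorphM rmorphD /= -mulrA -ss' mulrDl mul1r; lra.
have e2 : k' + 1 <= (k + 1) * D.
  rewrite lezD1 -(ltr_int R) -(ltr_pM2r s'0) rmorphM rmorphD /= -mulrA -ss' mulrDl mul1r; lra.
have f1 : k%:~R * s <= k'%:~R * s' by rewrite ss' mulrA -rmorphM /= ler_pM2r // ler_int.
have f2 : k'%:~R * s' + s' <= k%:~R * s + s.
  have -> : k'%:~R * s' + s' = (k' + 1)%:~R * s' by rewrite rmorphD /= mulrDl mul1r.
  have -> : k%:~R * s + s = ((k + 1) * D)%:~R * s'.
    by rewrite rmorphM /= -mulrA -ss' rmorphD /= mulrDl mul1r.
  by rewrite ler_pM2r // ler_int.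
by apply/andP; split; lra.
Qed.

Lemma dyadic_scale (L l : R) : 0 < l -> l <= L ->
  exists j : nat, l <= L / 2 ^+ j /\ L / 2 ^+ j < 2 * l.
Proof.
move=> l0 lL; have L0 : 0 < L by lra.
have ex : exists j, L / 2 ^+ j < 2 * l.
  exists (Num.bound (L / l)); rewrite ltr_pdivrMr ?exprn_gt0 //.
  have h : L / l < (Num.bound (L / l))%:R by apply: archi_boundP; rewrite divr_ge0 // ltW.
  have : (Num.bound (L / l))%:R <= (2 ^+ Num.bound (L / l) : R).
    by rewrite -natrX ler_nat ltnW // ltn_expl.
  by move: h; rewrite ltr_pdivrMr // => ? ?; nra.
have [j jP jmin] := ex_minnP ex; exists j; split => //.
case: j jP jmin => [|j] jP jmin; first by rewrite expr0 divr1.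
rewrite leNgt; apply/negP => h.
have : (j.+1 <= j)%N; last by rewrite ltnn.
apply: jmin; move: h; rewrite exprS.
have : 0 < (2 : R) ^+ j by rewrite exprn_gt0.
move: (2 ^+ j) => e e0.
have -> : L / (2 * e) = (L / e) / 2 by field; rewrite gt_eqF.
lra.
Qed.

(** Each of the first [N] rational cubes is placed at a scale between three and six times its side,
    whence [6 ^+ n]; the one-third trick, applied in every coordinate, selects the grid [al] that
    contains it. *)
Lemma dyadic_families N : exists S : {ffun 'I_n -> bool} -> seq (set (Rn R n)),
  [/\ forall al, laminar (S al),
      forall al Q, Q \in S al -> exists c l, 0 < l /\ Q = cube c l &
      forall k, (k < N)%N -> exists al c l, [/\ 0 < l, cube c l \in S al,
        qcube R n k `<=` cube c l & l ^+ n <= 6 ^+ n * (rational_cube R n k).2 ^+ n]].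
Proof.
pose side k := (rational_cube R n k).2.
have side0 k : 0 < side k by exact: qcube_side.
(* Dominates all [N] sides, so that the top scale [3 * t] is at least three times each of them. *)
pose t := \sum_(k < N) side k + 1.
have t0 : 0 < t by rewrite ltr_wpDl // sumr_ge0 // => k _; exact: ltW.
have sidet k : (k < N)%N -> side k <= t.
  move=> kN; rewrite /t (bigD1 (Ordinal kN)) //= -addrA lerDl addr_ge0 //.
  by rewrite sumr_ge0 // => i _; exact: ltW.
have ex k : exists z : {ffun 'I_n -> bool} * nat * ('I_n -> int), (k < N)%N ->
    qcube R n k `<=` dyadic_cube t z.1.1 z.1.2 z.2 /\ 3 * t / 2 ^+ z.1.2 <= 6 * side k.
  have [kN|_] := boolP (k < N)%N; last by exists (finfun (fun=> true), 0%N, fun=> 0).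
  have [j [j1 j2]] : exists j : nat, 3 * side k <= 3 * t / 2 ^+ j /\ 3 * t / 2 ^+ j < 2 * (3 * side k).
    by apply: dyadic_scale; rewrite ?mulr_gt0 ?ler_pM2l // sidet.
  have s0 : 0 < 3 * t / 2 ^+ j by rewrite divr_gt0 ?mulr_gt0 ?exprn_gt0.
  have st : 3 * t / 2 ^+ j * 2 ^+ j = 3 * t by rewrite divfK // gt_eqF // exprn_gt0.
  have /choice[b bP] : forall i : 'I_n, exists b : bool, exists m : int,
      m%:~R * (3 * t / 2 ^+ j) + b%:R * t <= (tnth (rational_cube R n k).1 i : R) /\
      (tnth (rational_cube R n k).1 i : R) + side k <= (m + 1)%:~R * (3 * t / 2 ^+ j) + b%:R * t.
    by move=> i; exact: third_trick st s0 (side0 k) j1.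
  have /choice[m mP] := bP.
  exists (finfun b, j, m) => _; split=> /=; last by lra.
  move=> x xk i; have /andP[x1 x2] := xk i; have [] := mP i.
  rewrite tnth_mktuple ffunE rmorphD /= mulrDl mul1r; rewrite -/(side k) in x2 => ? ?.
  by apply/andP; split; lra.
have /choice[z zP] := ex.
pose D k := dyadic_cube t (z k).1.1 (z k).1.2 (z k).2.
exists (fun al => [seq D k | k <- iota 0 N & (z k).1.1 == al]); split.
- move=> al _ _ /mapP[k + ->] /mapP[k' + ->].
  rewrite !mem_filter /D => /andP[/eqP -> _] /andP[/eqP -> _].
  have [jj|jj] := leqP (z k).1.2 (z k').1.2.
    have [h|h] := dyadic_cube_nested al (z k).2 (z k').2 t0 jj; [exact: Or32|exact: Or33].
  have [h|h] := dyadic_cube_nested al (z k').2 (z k).2 t0 (ltnW jj); first exact: Or31.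
  by apply: Or33; rewrite setIC.
- move=> al _ /mapP[k _ ->]; rewrite /D /dyadic_cube.
  by eexists; eexists; split; last reflexivity; rewrite divr_gt0 ?mulr_gt0 ?exprn_gt0.
- move=> k kN; have [kD ks] := zP k kN; exists (z k).1.1.
  have s0 : 0 < 3 * t / 2 ^+ (z k).1.2 by rewrite divr_gt0 ?mulr_gt0 ?exprn_gt0.
  eexists; exists (3 * t / 2 ^+ (z k).1.2); split=> //.
  + by apply/mapP; exists k; last reflexivity; rewrite mem_filter eqxx mem_iota.
  + exact: kD.
  + by rewrite -exprMn; apply: lerXn2r; rewrite ?nnegrE ?(ltW s0) ?mulr_ge0 // ltW //; exact: side0.
Qed.

End dyadic.
Arguments centered_cube : clear implicits.

(** * Function spaces and their associate spaces *)

Section function_spaces.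
Variables (R : realType) (n : nat).
Implicit Types (Z : fspace R n) (f g : Rn R n -> R) (F : Rn R n -> \bar R).
Local Notation mu := (lebesgue_Rn R n).

Definition ideal_space Z := forall f g, Z f -> measurable_fun setT g ->
  {ae mu, forall x, `|g x| <= `|f x|} -> Z g /\ fnorm Z g <= fnorm Z f.

(** All representatives have the same norm by the ideal property, so the infimum runs over one
    value. *)
Lemma enorm_rep Z f F : ideal_space Z -> (forall f, Z f -> measurable_fun setT f) ->
  Z f -> {ae mu, forall x, F x = (f x)%:E} -> enorm Z F = (fnorm Z f)%:E.
Proof.
move=> iZ mZ Zf Ff; apply/eqP; rewrite eq_le; apply/andP; split.
  by apply: ereal_inf_lbound; exists f.
apply: le_ereal_inf_tmp => _ [g [Zg Fg] <-]; rewrite lee_fin.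
apply: (iZ _ _ Zg (mZ _ Zf) _).2; near=> x.
suff -> : f x = g x by [].
by apply: EFin_inj; transitivity (F x); [symmetry|]; near: x.
Unshelve. all: by end_near. Qed.

Lemma enorm_fin Z F : (enorm Z F < +oo)%E -> fspace_mem Z F.
Proof.
move=> h; apply: contrapT => nF; move: h.
rewrite /enorm (_ : [set f | _] = set0) ?image_set0 ?ereal_inf0 //.
by apply/seteqP; split=> // f [Zf Ff]; apply: nF; exists f.
Qed.

Lemma enorm_le Z F (B : R) : ideal_space Z -> (forall f, Z f -> measurable_fun setT f) ->
  (enorm Z F <= B%:E)%E ->
  exists2 f, Z f /\ fnorm Z f <= B & {ae mu, forall x, F x = (f x)%:E}.
Proof.
move=> iZ mZ FB; have [|f Zf Ff] := @enorm_fin Z F.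
  by apply: le_lt_trans FB _; rewrite ltry.
by exists f => //; split => //; rewrite -lee_fin -(enorm_rep iZ mZ Zf Ff).
Qed.

Lemma le_enorm Z F G : ideal_space Z -> (forall f, Z f -> measurable_fun setT f) ->
  measurable_fun setT F -> (forall x, 0 <= F x)%E ->
  {ae mu, forall x, (F x <= G x)%E} -> (enorm Z F <= enorm Z G)%E.
Proof.
move=> iZ mZ mF F0 FG; apply: le_ereal_inf_tmp => _ [g [Zg Gg] <-].
have mf : measurable_fun setT (fine \o F).
  by apply: measurableT_comp => //; exact: fine_measurable.
have Ffin : {ae mu, forall x, F x = (fine (F x))%:E /\ (F x <= (g x)%:E)%E}.
  apply: filterS2 FG Gg => x FGx Ggx; rewrite Ggx in FGx; split=> //.
  rewrite fineK // ge0_fin_numE //; exact: le_lt_trans FGx (ltry _).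
have [|Zf fg] := iZ g (fine \o F) Zg mf.
  apply: filterS Ffin => x /= [Fx]; rewrite Fx lee_fin /= => h.
  by rewrite (ger0_norm (fine_ge0 (F0 x))) (le_trans h) // ler_norm.
rewrite (enorm_rep iZ mZ Zf) ?lee_fin //.
by apply: filterS Ffin => x [].
Qed.

(* What a ball Banach function space and its associate space have in common; the
   Fatou property is stated without the a priori existence of a finite limit. *)
Record levi_space Z : Prop := {
  levi_measurable : forall f, Z f -> measurable_fun setT f ;
  levi_ideal : ideal_space Z ;
  levi_norm_ge0 : forall f, Z f -> 0 <= fnorm Z f ;
  levi_add : forall f g, Z f -> Z g ->
    Z (fun x => f x + g x) /\ fnorm Z (fun x => f x + g x) <= fnorm Z f + fnorm Z g ;
  levi_scale : forall (a : R) f, Z f ->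
    Z (fun x => a * f x) /\ fnorm Z (fun x => a * f x) <= `|a| * fnorm Z f ;
  levi_cube : forall c l, 0 < l -> Z (\1_(cube c l)) ;
  levi_local : forall c l, 0 < l -> exists2 C : R, 0 <= C & forall f, Z f ->
    (\rint[mu]_x (`|f x| * \1_(cube c l) x) <= (C * fnorm Z f)%:E)%E ;
  levi_limit : forall (u : nat -> Rn R n -> R) (B : R),
    (forall k, Z (u k)) -> (forall k x, 0 <= u k x <= u k.+1 x) ->
    (forall k, fnorm Z (u k) <= B) ->
    exists f, [/\ Z f, fnorm Z f <= B, forall x, 0 <= f x,
      {ae mu, forall x, u k x @[k --> \oo] --> f x} &
      {ae mu, forall x, forall k, u k x <= f x}] }.

Lemma levi_zero Z : levi_space Z -> Z (cst 0) /\ fnorm Z (cst 0) = 0.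
Proof.
move=> lZ; have Z1 := levi_cube lZ [tuple 0 : measurableTypeR R | i < n] ltr01.
have [Z0 n0] := levi_scale lZ 0 Z1.
have E : (fun x => 0 * \1_(cube [tuple 0 : measurableTypeR R | i < n] 1) x) = cst 0 :> (Rn R n -> R).
  by apply/funext => x; rewrite mul0r.
rewrite E normr0 mul0r in Z0 n0; split => //.
by apply/eqP; rewrite eq_le n0 levi_norm_ge0.
Qed.

Lemma levi_sum Z (I : Type) (s : seq I) (b : I -> R) (f : I -> Rn R n -> R) :
  levi_space Z -> (forall i, Z (f i)) -> (forall i, 0 <= b i) ->
  Z (fun x => \sum_(i <- s) b i * f i x) /\
  fnorm Z (fun x => \sum_(i <- s) b i * f i x) <= \sum_(i <- s) b i * fnorm Z (f i).
Proof.
move=> lZ Zf b0; elim: s => [|i s [IH1 IH2]].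
  rewrite (_ : (fun x => _) = cst 0); last by apply/funext => x; rewrite big_nil.
  by have [Z0 ->] := levi_zero lZ; rewrite big_nil.
rewrite (_ : (fun x => _) = (fun x => b i * f i x + \sum_(i <- s) b i * f i x)); last first.
  by apply/funext => x; rewrite big_cons.
have [Z1 n1] := levi_scale lZ (b i) (Zf i).
have [Z2 n2] := levi_add lZ Z1 IH1; split => //.
by rewrite big_cons; apply: le_trans n2 _; rewrite lerD // -[X in X * _](ger0_norm (b0 i)).
Qed.

(** By monotone convergence the bounds on the integrals over centered cubes pass to the limit and
    force it to be finite a.e.; [fine] then provides a real-valued representative. *)
Lemma monotone_limit (u : nat -> Rn R n -> R) :
  (forall k, measurable_fun setT (u k)) -> (forall k x, 0 <= u k x <= u k.+1 x) ->
  (forall j, exists B : R, forall k, (\rint[mu]_x (u k x * \1_(centered_cube R n j) x) <= B%:E)%E) ->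
  exists f, [/\ measurable_fun setT f, forall x, 0 <= f x,
      {ae mu, forall x, u k x @[k --> \oo] --> f x} &
      {ae mu, forall x, forall k, u k x <= f x}].
Proof.
move=> mu_ u0 uB.
have u_ge0 k x : 0 <= u k x by have /andP[] := u0 k x.
have ndu x : {homo (fun k => (u k x)%:E) : m k / (m <= k)%N >-> (m <= k)%E}.
  by apply/nondecreasing_seqP => k; rewrite lee_fin; have /andP[] := u0 k x.
pose g x := limn (fun k => (u k x)%:E).
have gE x : g x = ereal_sup (range (fun k => (u k x)%:E)).
  by apply/cvg_lim => //; exact: ereal_nondecreasing_cvgn.
have gu k x : ((u k x)%:E <= g x)%E by rewrite gE; apply: ereal_sup_ubound; exists k.
have g0 x : (0 <= g x)%E by apply: le_trans (gu 0%N x); rewrite lee_fin.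
have mg : measurable_fun setT g.
  rewrite (_ : g = fun x => esups (fun k => (u k x)%:E) 0).
    by apply: measurable_fun_esups => k; exact/measurable_EFinP.
  apply/funext => x; rewrite gE /esups /= /sdrop; congr ereal_sup.
  by apply/seteqP; split=> _ [k _ <-]; exists k.
have mQ j : measurable (centered_cube R n j) by exact: measurable_cube.
have gfin : {ae mu, forall x, g x \is a fin_num}.
  have : {ae mu, forall x, forall j, centered_cube R n j x -> g x \is a fin_num}.
    apply: ae_foralln => j; apply: integrable_ae => //; apply/integrableP; split.
      exact: measurable_funS mg.
    have [B uBj] := uB j.
    under eq_integral do rewrite gee0_abs //.
    apply: (@le_lt_trans _ _ B%:E); last exact: ltry.
    have := @cvg_monotone_convergence _ _ _ mu _ (mQ j) (fun k x => (u k x)%:E).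
    move=> /(_ (fun k => measurable_funS measurableT (@subsetT _ _) (proj2 (measurable_EFinP _ _) (mu_ k)))).
    have h1 : forall (k : nat) (x : Rn R n), centered_cube R n j x -> (0%R <= (u k x)%:E)%E.
      by move=> k x _; rewrite lee_fin.
    move=> /(_ h1 (fun x _ => ndu x)) c.
    rewrite -(cvg_lim _ c) //; apply: lime_le; first by apply/cvg_ex; eexists; exact: c.
    by apply: nearW => k; rewrite rint_setE // uBj.
  apply: filterS => x h; have [k0 k0P] := centered_cube_cover x.
  exact: h k0 (k0P _ (leqnn _)).
exists (fine \o g); split.
- by apply: measurableT_comp => //; exact: fine_measurable.
- by move=> x; rewrite /= fine_ge0.
- apply: filterS gfin => x gx.
  have : (u k x)%:E @[k --> \oo] --> (fine (g x))%:E.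
    by rewrite fineK // gE; exact: ereal_nondecreasing_cvgn.
  by move/fine_cvgP => [_].
- by apply: filterS gfin => x gx k; rewrite /= -lee_fin fineK.
Qed.

(** The Fatou axiom presupposes a finite limit function; the local integrability axiom produces one
    through [monotone_limit]. *)
Lemma ball_banach_levi X : ball_banach X -> levi_space X.
Proof.
move=> [bX locX]; have iX : ideal_space X by move=> f g; exact: (bfs_ideal bX).
have loc c l : 0 < l -> exists2 C : R, 0 <= C & forall f, X f ->
    (\rint[mu]_x (`|f x| * \1_(cube c l) x) <= (C * fnorm X f)%:E)%E.
  move=> l0; have l'0 : 0 < l * n.+1%:R by rewrite mulr_gt0.
  have [C CP] := locX c _ l'0; exists `|C| => // f Xf.
  have mf := bfs_measurable bX Xf; have mc := measurable_cube c l.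
  have mb := measurable_euclidean_ball c l'0.
  apply: (@le_trans _ _ (C * fnorm X f)%:E); last first.
    by rewrite lee_fin ler_wpM2r ?ler_norm //; exact: (bfs_norm_ge0 bX).
  apply: le_trans (CP f Xf); rewrite rint_setE //.
  apply: le_rint; [by meas|by meas|by move=> x; rewrite mulr_ge0|move=> x].
  apply: ler_wpM2l => //; rewrite !indicE ler_nat.
  by have [/set_mem/(cube_sub_ball l0) h|//] := boolP (x \in cube c l); rewrite mem_set.
split => //.
- exact: (bfs_measurable bX).
- exact: (bfs_norm_ge0 bX).
- move=> f g Xf Xg; split; first exact: (bfs_add bX).
  by rewrite -[leRHS]mul1r; exact: (bfs_norm_add bX).
- by move=> a f Xf; split; [exact: (bfs_scale bX)|rewrite (bfs_norm_scale bX a Xf)].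
- move=> c l l0; have l'0 : 0 < l * n.+1%:R by rewrite mulr_gt0.
  apply: (iX _ _ (bfs_ball bX c l'0) _ _).1.
    by have := measurable_cube c l => ?; meas.
  apply: nearW => x; rewrite !ger0_norm // !indicE ler_nat.
  by have [/set_mem/(cube_sub_ball l0) h|//] := boolP (x \in cube c l); rewrite mem_set.
- move=> u B Xu u0 uB.
  have [|//||f [mf f0 uf fu]] := @monotone_limit u.
  + by move=> k; exact: (bfs_measurable bX).
  + move=> j; have [C C0 CP] := loc [tuple - j.+1%:R : measurableTypeR R | i < n] (2 * j.+1%:R)
      (mulr_gt0 (ltr0Sn R 1) (ltr0Sn R j)).
    exists (C * B) => k; apply: (@le_trans _ _ (C * fnorm X (u k))%:E).
      apply: le_trans (CP _ (Xu k)); rewrite le_eqVlt; apply/orP; left; apply/eqP.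
      congr (rint mu _); apply/funext => x; rewrite ger0_norm //.
      by have /andP[] := u0 k x.
    by rewrite lee_fin ler_wpM2l.
  + have ub : has_ubound (range (fun k => fnorm X (u k))) by exists B => _ [k _ <-].
    have [|Xf nf] := bfs_fatou bX Xu mf _ ub; first by apply: filterS uf => x; split.
    exists f; split => //; rewrite nf; apply: ge_sup; first by exists (fnorm X (u 0%N)), 0%N.
    by move=> _ [k _ <-].
Qed.

(** * The associate space *)

Section associate.
Variable X : fspace R n.
Hypothesis bX : ball_banach X.
Let lX := ball_banach_levi bX.

Lemma associate_norm_ge0 g : (0 <= associate_norm X g)%E.
Proof.
have [X0 n0] := levi_zero lX; apply: le_trans (ereal_sup_ubound _); last first.
  by exists (cst 0) => //; split => //; rewrite n0.
exact: integral_ge0.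
Qed.

Lemma le_associate_norm g (B : R) : (forall f, X f -> fnorm X f <= 1 ->
    (\rint[mu]_x (`|f x * g x|) <= B%:E)%E) -> (associate_norm X g <= B%:E)%E.
Proof. by move=> h; apply: ge_ereal_sup => _ [f [Xf f1] <-]; exact: h. Qed.

(** Hölder's inequality by homogeneity. The norm of [f] may vanish, so [f] is divided by its norm
    plus [e], and [e] tends to 0. *)
Lemma associate_pairing f g : X f -> measurable_fun setT g -> (associate_norm X g < +oo)%E ->
  (\rint[mu]_x `|f x * g x| <= (fnorm X f)%:E * associate_norm X g)%E.
Proof.
move=> Xf mg gfin; have mf := levi_measurable lX Xf.
have : (associate_norm X g \is a fin_num) by rewrite ge0_fin_numE // associate_norm_ge0.
move/fineK => <-; set B := fine _.
have B0 : 0 <= B by apply: fine_ge0; exact: associate_norm_ge0.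
have key e : 0 < e -> (\rint[mu]_x `|f x * g x| <= ((fnorm X f + e) * B)%:E)%E.
  move=> e0; have nf0 := levi_norm_ge0 lX Xf.
  have ne0 : 0 < fnorm X f + e by lra.
  have [Xf' nf'] := levi_scale lX (fnorm X f + e)^-1 Xf.
  have nf1 : fnorm X (fun x => (fnorm X f + e)^-1 * f x) <= 1.
    apply: le_trans nf' _; rewrite gtr0_norm ?invr_gt0 // mulrC ler_pdivrMr //; lra.
  have : (\rint[mu]_x `|((fnorm X f + e)^-1 * f x) * g x| <= B%:E)%E.
    rewrite /B fineK ?ge0_fin_numE ?associate_norm_ge0 //.
    by apply: ereal_sup_ubound; exists (fun x => (fnorm X f + e)^-1 * f x).
  rewrite (_ : (fun x => _) = (fun x => (fnorm X f + e)^-1 * `|f x * g x|)); last first.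
    by apply/funext => x; rewrite -mulrA normrM gtr0_norm // invr_gt0.
  rewrite rintZ //; [|by meas|by rewrite invr_ge0 ltW].
  by rewrite EFinM -lee_pdivrMl // inver gt_eqF.
rewrite -EFinM; apply/lee_addgt0Pr => e e0.
have eB : 0 < e / (B + 1) by apply: divr_gt0 => //; lra.
apply: le_trans (key _ eB) _.
rewrite -EFinD lee_fin mulrDl lerD2l mulrAC ler_pdivrMr ?ler_pM2l //; lra.
Qed.

(** Duality exchanges two axioms: cubes belong to $X'$ because $X$ is locally integrable, and $X'$
    is locally integrable because cubes belong to $X$. The limit property is Fatou's lemma tested
    against the unit ball of $X$. Arguments about [levi_space] thus serve both spaces. *)
Lemma associate_levi : levi_space (associate X).
Proof.
have fin g : associate X g -> associate_norm X g \is a fin_num.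
  by move=> [_ gf]; rewrite ge0_fin_numE // associate_norm_ge0.
have inX g (B : R) : measurable_fun setT g -> (associate_norm X g <= B%:E)%E ->
    associate X g /\ fnorm (associate X) g <= B.
  move=> mg gB; have gf : (associate_norm X g < +oo)%E by exact: le_lt_trans gB (ltry _).
  split; first by split.
  by rewrite /= -lee_fin fineK // ge0_fin_numE // associate_norm_ge0.
have pair f g : X f -> associate X g -> fnorm X f <= 1 ->
    (\rint[mu]_x `|f x * g x| <= (fnorm (associate X) g)%:E)%E.
  move=> Xf Zg f1; rewrite /= fineK ?fin //.
  by apply: ereal_sup_ubound; exists f.
have iZ : ideal_space (associate X).
  move=> f g Zf mg gf; apply: inX => //; apply: le_associate_norm => h Xh h1.
  have [mf _] := Zf; have mh := levi_measurable lX Xh.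
  apply: le_trans (pair _ _ Xh Zf h1); apply: ae_le_rint; [by meas|by meas|by []|by []|].
  by apply: filterS gf => x; rewrite !normrM => ?; rewrite ler_wpM2l.
have loc c l : 0 < l -> exists2 C : R, 0 <= C & forall f, associate X f ->
    (\rint[mu]_x (`|f x| * \1_(cube c l) x) <= (C * fnorm (associate X) f)%:E)%E.
  move=> l0; have X1 := levi_cube lX c l0; exists (fnorm X (\1_(cube c l))).
    exact: levi_norm_ge0.
  move=> f Zf; have [mf ff] := Zf; have := associate_pairing X1 mf ff.
  rewrite EFinM /= fineK ?fin //; apply: le_trans; rewrite le_eqVlt; apply/orP; left; apply/eqP.
  by congr (rint mu _); apply/funext => x; rewrite normrM mulrC ger0_norm.
split => //.
- by move=> f [].
- by move=> f Zf; rewrite /= fine_ge0 // associate_norm_ge0.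
- move=> f g Zf Zg; have [mf _] := Zf; have [mg _] := Zg.
  apply: inX; [by meas|apply: le_associate_norm => h Xh h1].
  have mh := levi_measurable lX Xh.
  apply: (@le_trans _ _ (\rint[mu]_x (`|h x * f x| + `|h x * g x|))).
    apply: le_rint; [by meas|by meas|by []|move=> x].
    by rewrite mulrDr ler_normD.
  rewrite rintD; [|by meas|by meas|by []|by []].
  by rewrite EFinD leeD // pair.
- move=> a f Zf; have [mf _] := Zf.
  apply: inX; [by meas|apply: le_associate_norm => h Xh h1].
  have mh := levi_measurable lX Xh.
  rewrite (_ : (fun x => _) = (fun x => `|a| * `|h x * f x|)); last first.
    by apply/funext => x; rewrite mulrCA normrM.
  rewrite rintZ //; last by meas.
  by rewrite EFinM; apply: lee_wpmul2l; [rewrite lee_fin|exact: pair].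
- move=> c l l0; have [C C0 CP] := levi_local lX c l0; apply: (inX _ C _ _).1.
    by have := measurable_cube c l => ?; meas.
  apply: le_associate_norm => f Xf f1.
  apply: (@le_trans _ _ (C * fnorm X f)%:E).
    apply: le_trans (CP f Xf); rewrite le_eqVlt; apply/orP; left; apply/eqP.
    by congr (rint mu _); apply/funext => x; rewrite normrM [`|\1__ _|]ger0_norm.
  by rewrite lee_fin ler_piMr.
- move=> u B Zu u0 uB.
  have u_ge0 k x : 0 <= u k x by have /andP[] := u0 k x.
  have [|//||f [mf f0 uf fu]] := @monotone_limit u.
  + by move=> k; have [] := Zu k.
  + move=> j; have [C C0 CP] := loc [tuple - j.+1%:R : measurableTypeR R | i < n] (2 * j.+1%:R)
      (mulr_gt0 (ltr0Sn R 1) (ltr0Sn R j)).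
    exists (C * B) => k; apply: (@le_trans _ _ (C * fnorm (associate X) (u k))%:E).
      apply: le_trans (CP _ (Zu k)); rewrite le_eqVlt; apply/orP; left; apply/eqP.
      by congr (rint mu _); apply/funext => x; rewrite ger0_norm.
    by rewrite lee_fin ler_wpM2l.
  + exists f; have [|Zf nf] := inX f B mf.
      apply: le_associate_norm => h Xh h1; have mh := levi_measurable lX Xh.
      apply: (@rint_fatou _ _ _ mu (fun k x => `|h x * u k x|)) => //.
      * by move=> k; have [? _] := Zu k; meas.
      * by meas.
      * by apply: filterS uf => x c; apply: cvg_norm; apply: cvgM => //; exact: cvg_cst.
      * move=> k; apply: le_trans (pair _ _ Xh (Zu k) h1) _; by rewrite lee_fin.
    by split.
Qed.

End associate.

(** [G] is the sum of $(2A)^{-k}M^kf$, whose terms have norms decaying like $2^{-k}$. Its partial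
    sums satisfy $Mu_k\le2A\,u_{k+1}\le2AG$ a.e., and Fatou's lemma on each cube transfers this to
    [G]. *)
Lemma rubio_de_francia Z (A : R) f : levi_space Z -> 0 < A -> maximal_bound Z A ->
  Z f -> (forall x, 0 <= f x) ->
  exists G, [/\ Z G, forall x, 0 <= G x, {ae mu, forall x, f x <= G x},
    {ae mu, forall x, (maximal G x <= (2 * A * G x)%:E)%E} & fnorm Z G <= 2 * fnorm Z f].
Proof.
move=> lZ A0 MA Zf f0; have [mZ iZ] := (levi_measurable lZ, levi_ideal lZ).
(* The maximal function may be infinite on a null set; iterating it requires a real-valued,
   nonnegative representative. *)
have /choice[next nextP] : forall g : Rn R n -> R, exists g', Z g ->
    [/\ Z g', forall x, 0 <= g' x, {ae mu, forall x, maximal g x = (g' x)%:E} &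
      fnorm Z g' <= A * fnorm Z g].
  move=> g; have [Zg|] := pselect (Z g); last by exists g.
  have [g' [Zg' ng'] gg'] := enorm_le iZ mZ (MA _ Zg).
  have mg' := mZ _ Zg'.
  have [||Zg'' ng''] := iZ g' (fun x => `|g' x|) Zg'; first by meas.
    by apply: nearW => x; rewrite normr_id.
  exists (fun x => `|g' x|) => _; split => //; last exact: le_trans ng'' ng'.
  by apply: filterS gg' => x e; rewrite e ger0_norm // -lee_fin -e maximal_ge0.
pose g k := iter k next f.
have Zg k : Z (g k).
  by elim: k => //= k IH; have [] := nextP _ IH.
have g0 k x : 0 <= g k x by case: k => //= k; have [_ +] := nextP _ (Zg k).
have ng k : fnorm Z (g k) <= A ^+ k * fnorm Z f.
  elim: k => [|k IH]; first by rewrite expr0 mul1r.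
  rewrite /= exprS -mulrA; have [_ _ _ h] := nextP _ (Zg k); apply: le_trans h _.
  by rewrite ler_pM2l.
pose b k := (2 * A)^-1 ^+ k.
have A20 : 0 < 2 * A by rewrite mulr_gt0.
have b0 k : 0 <= b k by rewrite exprn_ge0 // invr_ge0 ltW.
pose u k x := \sum_(i < k.+1) b i * g i x.
have Zu k : Z (u k) /\ fnorm Z (u k) <= 2 * fnorm Z f.
  have [Zuk nuk] := @levi_sum Z _ (index_enum 'I_k.+1) b (fun i : 'I_k.+1 => g i) lZ (fun i => Zg i) (fun i => b0 i).
  split=> //; apply: le_trans nuk _.
  apply: (@le_trans _ _ (\sum_(i < k.+1) 2^-1 ^+ i * fnorm Z f)).
    apply: ler_sum => i _; apply: (le_trans (ler_wpM2l (b0 i) (ng i))).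
    rewrite mulrA -exprMn invfM -mulrA mulVf ?mulr1 // gt_eqF //.
  rewrite -mulr_suml ler_wpM2r ?(levi_norm_ge0 lZ) //.
  have -> : \sum_(i < k.+1) (2^-1 : R) ^+ i = 2 - 2^-1 ^+ k.
    elim: k {Zuk} => [|k IH]; first by rewrite big_ord1 expr0; lra.
    rewrite big_ord_recr /= IH !exprS; lra.
  by rewrite gerBl exprn_ge0.
have u0 k x : 0 <= u k x <= u k.+1 x.
  apply/andP; split; first by apply: sumr_ge0 => i _; rewrite mulr_ge0.
  rewrite /u [leRHS]big_ord_recr lerDl; exact: mulr_ge0 (b0 _) (g0 _ _).
have [G [ZG nG G0 uG Gu]] := levi_limit lZ (fun k => (Zu k).1) u0 (fun k => (Zu k).2).
have mG := mZ _ ZG.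
exists G; split => //.
  by apply: filterS Gu => x /(_ 0%N); rewrite /u big_ord1 /b expr0 mul1r.
have gM : {ae mu, forall x, forall k, maximal (g k) x = (g k.+1 x)%:E}.
  by apply: ae_foralln => k; have [_ _ + _] := nextP _ (Zg k).
apply: filterS2 gM Gu => x gMx Gux; apply: maximal_le => [|c l l0 cx].
  by rewrite lee_fin mulr_ge0 // ltW.
have mc := measurable_cube c l.
have ln0 : 0 < l ^+ n by rewrite exprn_gt0.
rewrite /cube_average lee_pdivrMl //.
rewrite -EFinM; apply: (@rint_fatou _ _ _ mu (fun k x => `|u k x| * \1_(cube c l) x)).
- by move=> k; have := mZ _ (Zu k).1 => ?; meas.
- by meas.
- by move=> k y; rewrite mulr_ge0.
- apply: filterS uG => y cv; apply: cvgM; last exact: cvg_cst.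
  exact: cvg_norm.
- move=> k; have muk := mZ _ (Zu k).1.
  have h : (maximal (u k) x <= (2 * A * G x)%:E)%E.
    apply: le_trans (maximal_sum_le _ _ (fun i : 'I_k.+1 => mZ _ (Zg i))
      (fun i => b0 i) (fun i => g0 i)) _.
    apply: (@le_trans _ _ (\sum_(i < k.+1) (2 * A * (b i.+1 * g i.+1 x))%:E)%E).
      apply: lee_sum => i _; rewrite gMx -EFinM lee_fin mulrA ler_wpM2r //.
      by rewrite /b exprS mulrA divff ?mul1r // gt_eqF.
    rewrite sumEFin lee_fin -mulr_sumr ler_pM2l //; apply: le_trans (Gux k.+1).
    rewrite /u [leRHS]big_ord_recl lerDr; exact: mulr_ge0 (b0 _) (g0 _ _).
  have := le_trans (maximal_ge (u k) l0 cx) h.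
  by rewrite /cube_average lee_pdivrMl // -EFinM.
- by move=> y; rewrite mulr_ge0.
Qed.

End function_spaces.

(** * Sequences and maxima *)

Section vector_valued.
Variables (R : realType) (n : nat).
Implicit Types (X Z : fspace R n) (f g : Rn R n -> R) (F : nat -> Rn R n -> \bar R).
Local Notation mu := (lebesgue_Rn R n).

(** The Fatou property for extended-valued functions: cutting [F k] off at height [k] gives finite
    functions that still increase and have the same supremum. *)
Lemma levi_enorm Z (F : nat -> Rn R n -> \bar R) (B : R) : levi_space Z ->
  (forall k, measurable_fun setT (F k)) -> (forall k x, 0 <= F k x)%E ->
  (forall k x, F k x <= F k.+1 x)%E -> (forall k, enorm Z (F k) <= B%:E)%E ->
  (enorm Z (fun x => ereal_sup (range (F ^~ x))) <= B%:E)%E.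
Proof.
move=> lZ mF F0 ndF FB; have [mZ iZ] := (levi_measurable lZ, levi_ideal lZ).
pose u k x : R := fine (mine (F k x) k%:R%:E).
have ufin k x : (u k x)%:E = mine (F k x) k%:R%:E.
  rewrite /u fineK // ge0_fin_numE; last by rewrite le_min F0 lee_fin ler0n.
  by rewrite gt_min ltry orbT.
have mu_ k : measurable_fun setT (u k).
  apply: measurableT_comp; first exact: fine_measurable.
  exact: measurable_mine.
have u0 k x : 0 <= u k x <= u k.+1 x.
  rewrite -!lee_fin !ufin le_min F0 lee_fin ler0n /=.
  by apply: le_min2 => //; rewrite lee_fin ler_nat.
have u_ge0 k x : 0 <= u k x by have /andP[] := u0 k x.
have Zu k : Z (u k) /\ fnorm Z (u k) <= B.
  have [f [Zf nf] Ff] := enorm_le iZ mZ (FB k).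
  have [|Zu nu] := iZ f (u k) Zf (mu_ k).
    apply: filterS Ff => x e; rewrite ger0_norm // -lee_fin ufin e.
    by apply: (@le_trans _ _ (f x)%:E); [rewrite ge_min lexx|rewrite lee_fin ler_norm].
  by split=> //; exact: le_trans nu nf.
have [f [Zf nf f0 uf _]] := levi_limit lZ (fun k => (Zu k).1) u0 (fun k => (Zu k).2).
rewrite (enorm_rep iZ mZ Zf) ?lee_fin //.
apply: filterS uf => x c.
have ndu : {homo (fun k => (u k x)%:E) : m k / (m <= k)%N >-> (m <= k)%E}.
  by apply/nondecreasing_seqP => k; rewrite lee_fin; have /andP[] := u0 k x.
have c' : (u k x)%:E @[k --> \oo] --> (f x)%:E by apply: cvg_EFin => //; exact: nearW.
have -> : (f x)%:E = ereal_sup (range (fun k => (u k x)%:E)).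
  by rewrite -(cvg_lim _ c') // (cvg_lim _ (ereal_nondecreasing_cvgn ndu)).
have ndF' : {homo (F^~ x) : m k / (m <= k)%N >-> (m <= k)%E} by apply/nondecreasing_seqP => k.
apply/eqP; rewrite eq_le; apply/andP; split; last first.
  apply: ge_ereal_sup => _ [k _ <-]; rewrite ufin ge_min; apply/orP; left.
  by apply: ereal_sup_ubound; exists k.
apply: ge_ereal_sup => _ [k _ <-].
set S := ereal_sup _; have uS j : ((u j x)%:E <= S)%E by apply: ereal_sup_ubound; exists j.
(* Where [F k] is infinite, the later cut-offs equal their index, so their supremum is infinite as
   well. *)
have [Fk|Fk] := leP +oo%E (F k x).
  move: Fk; rewrite leye_eq => /eqP Fk.
  have jS j : ((k + j)%:R%:E <= S)%E.
    apply: le_trans (uS (k + j)%N); rewrite ufin le_min lexx andbT.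
    by apply: (@le_trans _ _ (F k x)); [rewrite Fk leey|apply: ndF'; exact: leq_addr].
  move: S jS {uS} => [s| |] jS; rewrite ?leey //; last by have := jS 0%N.
  have := jS (Num.bound `|s|); rewrite lee_fin leNgt => /negP[].
  apply: le_lt_trans (ler_norm s) _; apply: lt_le_trans (archi_boundP (normr_ge0 s)) _.
  by rewrite ler_nat leq_addl.
have Fkfin : F k x \is a fin_num by rewrite ge0_fin_numE.
pose j := (k + Num.bound (fine (F k x)))%N.
apply: le_trans (uS j); rewrite ufin le_min; apply/andP; split.
  by apply: ndF'; exact: leq_addr.
rewrite -[X in (X <= _)%E](fineK Fkfin) lee_fin.
apply: le_trans (ltW (archi_boundP (fine_ge0 (F0 k x)))) _.
by rewrite ler_nat leq_addl.
Qed.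

Lemma poweR_cancel (x : \bar R) (q : R) : (0 <= x)%E -> 0 < q -> ((x `^ q) `^ q^-1 = x)%E.
Proof. by move=> x0 q0; rewrite -poweRrM mulfV ?gt_eqF // poweRe1. Qed.

Lemma poweR_cancelV (x : \bar R) (q : R) : (0 <= x)%E -> 0 < q -> ((x `^ q^-1) `^ q = x)%E.
Proof. by move=> x0 q0; rewrite -poweRrM mulVf ?gt_eqF // poweRe1. Qed.

Lemma ge0_le_poweR (x y : \bar R) (q : R) : (0 <= x)%E -> (x <= y)%E -> 0 <= q ->
  (x `^ q <= y `^ q)%E.
Proof.
move=> x0 xy q0; apply: gt0_ler_poweR => //; rewrite in_itv /= leey andbT //.
exact: le_trans xy.
Qed.

Lemma lq_sum_ge0 N q (F : 'I_N -> Rn R n -> \bar R) x : (0 <= lq_sum q F x)%E.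
Proof. exact: poweR_ge0. Qed.

Lemma measurable_lq_sum N q (F : 'I_N -> Rn R n -> \bar R) :
  (forall j, measurable_fun setT (F j)) -> measurable_fun setT (lq_sum q F).
Proof.
move=> mF; apply: (measurableT_comp (@measurable_poweR R q^-1)).
by apply: emeasurable_sum => j; apply: (measurableT_comp (@measurable_poweR R q)).
Qed.

Lemma le_lq_sum N q (F G : 'I_N -> Rn R n -> \bar R) x : 0 < q ->
  (forall j, 0 <= F j x)%E -> (forall j, F j x <= G j x)%E ->
  (lq_sum q F x <= lq_sum q G x)%E.
Proof.
move=> q0 F0 FG; apply: ge0_le_poweR; last by rewrite invr_ge0 ltW.
  by apply: sume_ge0 => j _; exact: poweR_ge0.
by apply: lee_sum => j _; apply: ge0_le_poweR => //; exact: ltW.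
Qed.

Lemma lq_sum_series N q (F : nat -> Rn R n -> \bar R) x : 0 < q ->
  (lq_sum q (fun j : 'I_N => F j) x <= lq_series q F x)%E.
Proof.
move=> q0; apply: ge0_le_poweR; last by rewrite invr_ge0 ltW.
  by apply: sume_ge0 => j _; exact: poweR_ge0.
rewrite -(big_mkord xpredT (fun j => F j x `^ q)%E).
by apply: nneseries_lim_ge => k _ _; exact: poweR_ge0.
Qed.

Lemma lq_seriesE q (F : nat -> Rn R n -> \bar R) x : 0 < q ->
  lq_series q F x = ereal_sup (range (fun N => lq_sum q (fun j : 'I_N => F j) x)).
Proof.
move=> q0; apply/eqP; rewrite eq_le; apply/andP; split; last first.
  by apply: ge_ereal_sup => _ [N _ <-]; exact: lq_sum_series.
set S := ereal_sup _.
have SN N : (lq_sum q (fun j : 'I_N => F j) x <= S)%E by apply: ereal_sup_ubound; exists N.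
have S0 : (0 <= S)%E by apply: le_trans (SN 0%N); exact: lq_sum_ge0.
rewrite -(poweR_cancel S0 q0); apply: ge0_le_poweR; last by rewrite invr_ge0 ltW.
  by apply: nneseries_ge0 => k _ _; exact: poweR_ge0.
apply: lime_le; first by apply: is_cvg_nneseries => k _ _; exact: poweR_ge0.
apply: nearW => N; rewrite big_mkord.
rewrite -(@poweR_cancelV (\sum_(i < N) F i x `^ q)%E q) //; last first.
  by apply: sume_ge0 => j _; exact: poweR_ge0.
apply: ge0_le_poweR; [exact: poweR_ge0|exact: SN|exact: ltW].
Qed.

Lemma fs_finite_sequence X (q C : R) : (0 < n)%N -> ball_banach X -> 1 < q -> 0 < C ->
  fs_finite_rhs X q C -> fs_sequence X q C.
Proof.
move=> n0 /ball_banach_levi lX q1 C0 fs f mf [F XF seriesF].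
have q0 : 0 < q by lra.
have [mX iX] := (levi_measurable lX, levi_ideal lX).
have mM j := measurable_maximal n0 (mf j).
have mabs j : measurable_fun setT (abs_e (f j)) by have := mf j => ?; rewrite /abs_e; meas.
rewrite (enorm_rep iX mX XF seriesF) -EFinM.
rewrite (_ : lq_series q _ = fun x => ereal_sup (range (fun N => lq_sum q (fun j : 'I_N.+1 => maximal (f j)) x))); last first.
  apply/funext => x; rewrite lq_seriesE //; apply/eqP; rewrite eq_le; apply/andP; split.
    apply: ge_ereal_sup => _ [N _ <-].
    apply: (@le_trans _ _ (lq_sum q (fun j : 'I_N.+1 => maximal (f j)) x)).
      apply: ge0_le_poweR; last by rewrite invr_ge0 ltW.
        by apply: sume_ge0 => j _; exact: poweR_ge0.
      by rewrite [leRHS]big_ord_recr leeDl //; exact: poweR_ge0.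
    by apply: ereal_sup_ubound; exists N.
  by apply: ge_ereal_sup => _ [N _ <-]; apply: ereal_sup_ubound; exists N.+1.
apply: levi_enorm => //.
- by move=> k; apply: measurable_lq_sum => j; exact: mM.
- by move=> k x; exact: lq_sum_ge0.
- move=> k x; apply: ge0_le_poweR; last by rewrite invr_ge0 ltW.
    by apply: sume_ge0 => j _; exact: poweR_ge0.
  by rewrite [leRHS]big_ord_recr leeDl //; exact: poweR_ge0.
- move=> k.
  have h : (enorm X (lq_sum q (fun j : 'I_k.+1 => abs_e (f j))) <= (fnorm X F)%:E)%E.
    rewrite -(enorm_rep iX mX XF seriesF); apply: le_enorm => //.
    - by apply: measurable_lq_sum => j; exact: mabs.
    - by move=> x; exact: lq_sum_ge0.
    - by apply: nearW => x; exact: (@lq_sum_series k.+1 q (fun j => abs_e (f j))).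
  have := fs k.+1 (fun j => f j) isT (fun j => mf j) (le_lt_trans h (ltry _)).
  move/le_trans; apply; rewrite EFinM; apply: lee_wpmul2l => //.
  by rewrite lee_fin ltW.
Qed.

Lemma maximal_cst0 : maximal (cst 0 : Rn R n -> R) = cst 0%E.
Proof.
apply/funext => x; apply/eqP; rewrite eq_le maximal_ge0 andbT.
apply: maximal_le => // c l l0 _; rewrite /cube_average (_ : (fun x => _) = cst 0).
  by rewrite /rint integral0 mule0.
by apply/funext => y; rewrite normr0 mul0r.
Qed.

(** Padding by zero functions turns a finite family into a sequence; [abs_e] and [maximal] both send
    the padding to 0. *)
Definition extend_family N (f : 'I_N -> Rn R n -> R) (j : nat) : Rn R n -> R :=
  if insub j is Some i then f i else cst 0.

Lemma extend_familyE N (f : 'I_N -> Rn R n -> R) (j : 'I_N) : extend_family f j = f j.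
Proof.
rewrite /extend_family; case: insubP => [i _ ij|]; last by rewrite ltn_ord.
by congr f; apply: val_inj.
Qed.

Lemma extend_family_out N (f : 'I_N -> Rn R n -> R) j : (N <= j)%N -> extend_family f j = cst 0.
Proof. by move=> Nj; rewrite /extend_family insubN // -leqNgt. Qed.

Lemma lq_series_extend N q (f : 'I_N -> Rn R n -> R) (op : (Rn R n -> R) -> Rn R n -> \bar R) x :
  0 < q -> op (cst 0) = cst 0%E ->
  lq_series q (fun j => op (extend_family f j)) x = lq_sum q (fun j => op (f j)) x.
Proof.
move=> q0 op0; rewrite /lq_series /lq_sum; congr (_ `^ _)%E.
apply: lim_near_cst => //; near=> m.
have Nm : (N <= m)%N by near: m; exists N.
rewrite (big_cat_nat _ (n := N)) //= big_mkord [X in (_ + X)%E]big_nat_cond [X in (_ + X)%E]big1 ?adde0.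
  by apply: eq_bigr => j _; rewrite extend_familyE.
move=> j /andP[/andP[Nj _] _]; rewrite extend_family_out // op0 /= powR0 //.
by rewrite gt_eqF.
Unshelve. all: by end_near. Qed.

Lemma measurable_extend_family N (f : 'I_N -> Rn R n -> R) j :
  (forall j, measurable_fun setT (f j)) -> measurable_fun setT (extend_family f j).
Proof. by move=> mf; rewrite /extend_family; case: insub. Qed.

Lemma abs_e0 : abs_e (cst 0 : Rn R n -> R) = cst 0%E.
Proof. by apply/funext => x; rewrite /abs_e normr0. Qed.

Lemma fs_sequence_all X (q C : R) : 0 < q -> 0 < C -> fs_sequence X q C -> fs_all X q C.
Proof.
move=> q0 C0 fs N f N0 mf; rewrite /fs_inequality.
have [|fin] := leP +oo%E (enorm X (lq_sum q (fun j => abs_e (f j)))).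
  by rewrite leye_eq => /eqP ->; rewrite gt0_muley ?leey // lte_fin.
have E1 : lq_series q (fun j => abs_e (extend_family f j)) = lq_sum q (fun j => abs_e (f j)).
  by apply/funext => x; apply: lq_series_extend => //; exact: abs_e0.
have E2 : lq_series q (fun j => maximal (extend_family f j)) = lq_sum q (fun j => maximal (f j)).
  by apply/funext => x; apply: lq_series_extend => //; exact: maximal_cst0.
rewrite -E1 -E2; apply: fs => [j|]; first exact: measurable_extend_family.
by rewrite E1; exact: enorm_fin.
Qed.

Lemma max_family_ge N (F : 'I_N -> Rn R n -> \bar R) j x : (F j x <= max_family F x)%E.
Proof. by rewrite /max_family (bigmax_sup j). Qed.

Lemma max_family_le N (F : 'I_N -> Rn R n -> \bar R) x (B : \bar R) : (0 <= B)%E ->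
  (forall j, F j x <= B)%E -> (max_family F x <= B)%E.
Proof. by move=> B0 FB; apply/bigmax_leP; split. Qed.

(** By monotonicity every [maximal (f j)] lies below the maximal function of the common majorant;
    the converse is the case of a single function. *)
Lemma maximal_bound_max X (C : R) : (0 < n)%N -> ball_banach X ->
  (maximal_bound X C <-> max_inequality X C).
Proof.
move=> n0 /ball_banach_levi lX; have [mX iX] := (levi_measurable lX, levi_ideal lX).
split=> [MC N f N0 mf [F XF maxF]|MC f Xf].
  rewrite (enorm_rep iX mX XF maxF) -EFinM; apply: le_trans (MC _ XF).
  have mF := mX _ XF.
  apply: le_enorm => //.
  - rewrite /max_family; elim: (index_enum _) => [|j s IH].
      by rewrite (_ : (fun x => _) = cst 0%E) //; apply/funext => x; rewrite big_nil.
    rewrite (_ : (fun x => _) = (fun x => maxe (maximal (f j) x) (\big[maxe/0%E]_(j <- s) maximal (f j) x))).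
      by apply: measurable_maxe => //; exact: measurable_maximal.
    by apply/funext => x; rewrite big_cons.
  - by move=> x; apply: bigmax_ge_id.
  - apply: nearW => x; apply: max_family_le => [|j]; first exact: maximal_ge0.
    apply: le_maximal => //; apply: filterS maxF => y e.
    have := max_family_ge (fun j => abs_e (f j)) j y; rewrite e lee_fin => h.
    by apply: le_trans h _; exact: ler_norm.
have mf := mX _ Xf.
have E (F : Rn R n -> \bar R) : (forall x, 0 <= F x)%E -> max_family (fun j : 'I_1 => F) = F.
  by move=> F0; apply/funext => x; rewrite /max_family big_ord_recl big_ord0 max_l.
have a0 x : (0 <= abs_e f x)%E by rewrite lee_fin.
have Xaf : X (fun x => `|f x|) /\ fnorm X (fun x => `|f x|) <= fnorm X f.
  by apply: iX => //; [meas|apply: nearW => x; rewrite normr_id].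
have ae_abs : {ae mu, forall x, abs_e f x = (`|f x|)%:E} by exact: nearW.
have := MC 1%N (fun=> f) isT (fun=> mf).
rewrite !E //; last by move=> x; exact: maximal_ge0.
move=> /(_ (ex_intro2 _ _ _ Xaf.1 ae_abs)).
rewrite (enorm_rep iX mX Xaf.1 ae_abs) -EFinM.
(* A negative [C] reverses the comparison between the norms of [f] and its absolute value; both
   directions follow from the ideal property. *)
have [C0|C0] := leP 0 C.
  by move/le_trans; apply; rewrite lee_fin ler_wpM2l // Xaf.2.
move/le_trans; apply; rewrite lee_fin ler_nM2l //.
by apply: (iX _ _ Xaf.1 mf _).2; apply: nearW => x; rewrite normr_id.
Qed.

(** No limit is taken: the finite inequality gives the scalar bound, which is then applied to the
    supremum itself. *)
Lemma max_sup_inequality X (C : R) : (0 < n)%N -> ball_banach X ->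
  (max_inequality X C <-> sup_inequality X C).
Proof.
move=> n0 bX; have lX := ball_banach_levi bX.
have [mX iX] := (levi_measurable lX, levi_ideal lX); split; last first.
  move=> MC N f N0 mf.
  have E (op : (Rn R n -> R) -> Rn R n -> \bar R) : op (cst 0) = cst 0%E ->
      (forall g x, 0 <= op g x)%E ->
      sup_family (fun j => op (extend_family f j)) = max_family (fun j => op (f j)).
    move=> op0 op_ge0; apply/funext => x; apply/eqP; rewrite eq_le; apply/andP; split.
      apply: ge_ereal_sup => _ [j _ <-].
      have [jN|Nj] := ltnP j N.
        have -> : extend_family f j = f (Ordinal jN) by rewrite -extend_familyE.
        exact: (max_family_ge (fun j => op (f j))).
      by rewrite extend_family_out // op0; exact: bigmax_ge_id.
    apply: max_family_le => [|j].
      by apply: le_trans (ereal_sup_ubound _); [exact: (op_ge0 (extend_family f 0%N) x)|exists 0%N].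
    by apply: ereal_sup_ubound; exists (j : nat) => //; rewrite extend_familyE.
  have a0 g x : (0 <= abs_e g x)%E by rewrite lee_fin.
  rewrite -(E (@abs_e R n) abs_e0 a0) -(E (@maximal R n) maximal_cst0 (@maximal_ge0 R n)).
  by apply: MC => j; exact: measurable_extend_family.
move=> /(maximal_bound_max C n0 bX) MC f mf [F XF supF].
rewrite (enorm_rep iX mX XF supF) -EFinM; apply: le_trans (MC _ XF).
have mF := mX _ XF.
apply: le_enorm => //.
- rewrite (_ : sup_family _ = fun x => esups (fun j => maximal (f j) x) 0).
    by apply: measurable_fun_esups => k; exact: measurable_maximal.
  apply/funext => x; rewrite /esups /= /sdrop; congr ereal_sup.
  by apply/seteqP; split=> _ [k _ <-]; exists k.
- move=> x; apply: le_trans (ereal_sup_ubound _); [exact: (maximal_ge0 (f 0%N) x)|by exists 0%N].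
- apply: nearW => x; apply: ge_ereal_sup => _ [j _ <-].
  apply: le_maximal => //; apply: filterS supF => y e.
  have : (abs_e (f j) y <= sup_family (fun j => abs_e (f j)) y)%E.
    by apply: ereal_sup_ubound; exists j.
  by rewrite e lee_fin => h; apply: le_trans h _; exact: ler_norm.
Qed.

End vector_valued.

(** * Failure for exponents at most one *)

Section failure_small_exponents.
Variables (R : realType) (n : nat).
Hypothesis n_gt0 : (0 < n)%N.
Local Notation mu := (lebesgue_Rn R n).
Let i0 : 'I_n := Ordinal n_gt0.

(** A layer of thickness $1/N$ orthogonal to the first axis, cut off by $(-5,5)^n$, which is large
    enough to contain the cubes used below. *)
Definition slab (N j : nat) : set (Rn R n) :=
  [set y | centered_cube R n 4 y /\ j%:R <= N%:R * (tnth y i0 : R) < j.+1%:R].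

Lemma measurable_slab N j : measurable (slab N j).
Proof.
have -> : slab N j = centered_cube R n 4 `&`
    (setT `&` (fun y : Rn R n => N%:R * (tnth y i0 : R)) @^-1` `[j%:R, j.+1%:R[%classic).
  by rewrite setTI; apply/seteqP; split=> y /=; rewrite /slab /= in_itv.
apply: measurableI; first exact: measurable_cube.
have m : measurable_fun setT (fun y : Rn R n => N%:R * (tnth y i0 : R)).
  by apply: measurable_funM => //; exact: measurable_tnth.
exact: m.
Qed.

(** The cube spans the layers [j - 1] to [i + 1], with one spare on either side: [i - j + 3] layers
    in all. Layer [j] fills the reciprocal fraction of it. *)
Lemma maximal_slab_ge (N i j : nat) (x : Rn R n) : (0 < N)%N -> (j <= i)%N -> (i < N)%N ->
  i%:R <= N%:R * (tnth x i0 : R) < i.+1%:R -> (forall k, 0 < (tnth x k : R) < 1) ->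
  (((i - j + 3)%:R^-1)%:E <= maximal (\1_(slab N j) : Rn R n -> R) x)%E.
Proof.
move=> N0 ji iN /andP[ix xi] x01.
have NR0 : (0 : R) < N%:R by rewrite ltr0n.
pose d : R := (i - j + 3)%:R; have d0 : 0 < d by rewrite ltr0n addn3.
have dE : d = i%:R - j%:R + 3 by rewrite /d natrD natrB.
pose l := d / N%:R; have l0 : 0 < l by rewrite divr_gt0.
have N1 : (1 : R) <= N%:R by rewrite ler1n.
have iN1 : i%:R + 1 <= (N%:R : R) by rewrite natr1 ler_nat.
have ji1 : (j%:R : R) <= i%:R by rewrite ler_nat.
have j0 : (0 : R) <= j%:R by exact: ler0n.
have l3 : l <= 4 by rewrite ler_pdivrMr // dE; lra.
pose c := [tuple (if k == i0 then (j%:R - 1) / N%:R else (tnth x k : R) - l / 2) : measurableTypeR R | k < n].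
pose A k : set R := if k == i0 then `[j%:R / N%:R, j.+1%:R / N%:R[%classic
  else `](tnth c k : R), (tnth c k : R) + l[%classic.
have mA k : measurable (A k) by rewrite /A; case: ifP.
pose box := [set y : Rn R n | forall k, A k (tnth y k)].
have mubox : mu box = (N%:R^-1 * l ^+ n.-1)%:E.
  rewrite /box lebesgue_Rn_box // (bigD1 i0) //= EFinM; congr (_ * _)%E.
    rewrite /A eqxx lebesgue_measure_itv /= lte_fin ltr_pM2r ?invr_gt0 // ltr_nat ltnSn.
    by rewrite -EFinD -mulrBl -natrB // subSnn mul1r.
  rewrite (eq_bigr (fun=> l%:E)) => [|k /negbTE ki].
    rewrite prodEFin prodr_const cardC1 card_ord //.
  by rewrite /A ki lebesgue_measure_itv /= lte_fin ltrDl l0 -EFinD addrAC subrr add0r.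
have xc : cube c l x.
  move=> k; rewrite tnth_mktuple; case: eqP => [->|_]; last by apply/andP; split; lra.
  rewrite /l -mulrDl ltr_pdivrMr // ltr_pdivlMr // dE; rewrite -natr1 in xi.
  by apply/andP; split; lra.
have boxc : box `<=` cube c l `&` slab N j.
  move=> y yA; have y0 := yA i0; rewrite /A eqxx /= in_itv /= ler_pdivrMr // ltr_pdivlMr // in y0.
  have /andP[y1 y2] := y0.
  have yc : cube c l y.
    move=> k; have := yA k; rewrite /A; case: eqP => [->|_]; last by rewrite /= in_itv.
    move=> _; rewrite tnth_mktuple eqxx /l -mulrDl ltr_pdivrMr // ltr_pdivlMr // dE.
    by rewrite -natr1 in y2; apply/andP; split; lra.
  split=> //; split; last by rewrite mulrC y0.
  apply/centered_cubeP => k; have /andP[] := yc k; rewrite tnth_mktuple.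
  have [->|_] := eqVneq k i0.
    move=> _ _; rewrite -natr1 in y2.
    have y3 : (tnth y i0 : R) < 5.
      by rewrite -(ltr_pM2r NR0); apply: lt_le_trans y2 _; lra.
    have y4 : - 5 < (tnth y i0 : R).
      by rewrite -(ltr_pM2r NR0); apply: lt_le_trans y1; lra.
    by rewrite ltr_norml; apply/andP; split; lra.
  have /andP[? ?] := x01 k => ? ?; rewrite ltr_norml; apply/andP; split; lra.
apply: le_trans (maximal_ge _ l0 xc).
have mc := measurable_cube c l; have ms := measurable_slab N j.
have mbox : measurable box.
  rewrite /box [X in measurable X](_ : _ =
    \bigcap_(k in [set: 'I_n]) ((fun x => tnth x k) @^-1` A k)).
    apply: fin_bigcap_measurable => // k _.
    by rewrite -[X in measurable X]setTI; apply: measurable_tnth => //; exact: mA.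
  by apply/seteqP; split => y /= Ay k => [_|]; exact: Ay.
rewrite /cube_average; apply: (@le_trans _ _ (((l ^+ n)^-1)%:E * mu box)%E); last first.
  apply: lee_wpmul2l; first by rewrite lee_fin invr_ge0 exprn_ge0 // ltW.
  rewrite -rint_indic //; apply: le_rint; [by meas|by meas|by []|move=> y].
  rewrite ger0_norm // !indicE; have [/set_mem/boxc[yc ys]|_] := boolP (y \in box).
    by rewrite !mem_set ?mulr1.
  by rewrite mulr_ge0.
rewrite mubox -EFinM lee_fin -/d -[X in l ^+ X](prednK n_gt0) exprS le_eqVlt; apply/orP; left; apply/eqP.
have ln0 : l ^+ n.-1 != 0 by rewrite gt_eqF // exprn_gt0.
have lN : l * N%:R = d by rewrite /l divfK // gt_eqF.
rewrite -lN; move: (l ^+ n.-1) ln0 => e e0; field.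
by rewrite e0 !gt_eqF.
Qed.

Lemma harmonic_unbounded (B : R) : exists m, B < \sum_(d < m) (d + 3)%:R^-1.
Proof.
have nd : nondecreasing_seq (series (@harmonic R)).
  by apply/nondecreasing_seqP => k; rewrite /series /= big_nat_recr //= lerDl /harmonic /= invr_ge0.
have [m mP] : exists m, B + 2 < series (@harmonic R) m.
  apply: contrapT => h; apply: (@dvg_harmonic R); apply: nondecreasing_is_cvgn => //.
  exists (B + 2) => _ [k _ <-]; rewrite leNgt; apply/negP => hk; apply: h; by exists k.
exists m; have h : series (@harmonic R) m <= series (@harmonic R) m.+2 by apply: nd; rewrite !leqW.
have E : series (@harmonic R) m.+2 = 1 + (2^-1 + \sum_(d < m) (d + 3)%:R^-1).
  rewrite /series /= big_mkord big_ord_recl big_ord_recl /= /harmonic /= invr1; congr (_ + (_ + _)).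
  by apply: eq_bigr => i _; rewrite /bump !add1n addn3.
rewrite E in h; have : (2 : R)^-1 <= 1 by lra.
by move=> ?; have := lt_le_trans mP h; lra.
Qed.

(** The layers are disjoint, so the right-hand side is at most the norm of [\1_B] whatever their
    number [N]. At a point of [Q], the cube $(1/2,1)^n$, at least [m] layers lie below; since
    [q <= 1], the powers of the numbers $1/(i-j+3)$ are at least those numbers, and harmonic sums
    appear. *)
Lemma no_fs_small_exponent (Y : fspace R n) (q : R) : ball_quasi_banach Y ->
  0 < q -> q <= 1 -> ~ exists C : R, fs_finite_rhs Y q C.
Proof.
move=> [K _ bY] q0 q1 [C fs].
have iY : ideal_space Y by move=> f g; exact: (bfs_ideal bY).
have mY := bfs_measurable bY.
have half0 : 0 < 2^-1 :> R by rewrite invr_gt0.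
have YQ c l : 0 < l -> Y (\1_(cube c l)).
  move=> l0; have l'0 : 0 < l * n.+1%:R by rewrite mulr_gt0.
  apply: (iY _ _ (bfs_ball bY c l'0) _ _).1.
    by have := measurable_cube c l => ?; meas.
  apply: nearW => x; rewrite !ger0_norm // !indicE ler_nat.
  by have [/set_mem/(cube_sub_ball l0) h|//] := boolP (x \in cube c l); rewrite mem_set.
pose Q := cube [tuple 2^-1 : measurableTypeR R | k < n] 2^-1.
have mQ : measurable Q by exact: measurable_cube.
have YQ1 : Y (\1_Q) by exact: YQ.
have Q0 : 0 < fnorm Y (\1_Q).
  rewrite lt0r (bfs_norm_ge0 bY) // andbT; apply/eqP => /(bfs_norm_eq0 bY YQ1)[M [mM M0 QM]].
  have : (mu Q <= mu M)%E.
    apply: le_measure; rewrite ?inE // => x Qx; apply: QM => /=.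
    by rewrite indicE mem_set // => /eqP; rewrite oner_eq0.
  by rewrite M0 lebesgue_cube // lee_fin leNgt exprn_gt0.
pose B := centered_cube R n 4.
have mB : measurable B by exact: measurable_cube.
have YB : Y (\1_B) by apply: YQ; rewrite mulr_gt0.
(* Makes [t] times the norm of [\1_Q] exceed $|C|$ times the norm of [\1_B]. *)
pose t := (`|C| * fnorm Y (\1_B)) / fnorm Y (\1_Q) + 1.
have t1 : 1 <= t by rewrite lerDr divr_ge0 ?mulr_ge0 ?(bfs_norm_ge0 bY).
have t0 : 0 < t by lra.
have [m mP] := harmonic_unbounded (t `^ q).
have m0 : (0 < m)%N.
  by case: m mP => // ; rewrite big_ord0 ltNge powR_ge0.
(* With twice [m] layers, a first coordinate above 1/2 has layer index at least [m]. *)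
pose N := (2 * m)%N; have N0 : (0 < N)%N by rewrite muln_gt0.
have NR0 : (0 : R) < N%:R by rewrite ltr0n.
pose f (j : 'I_N) : Rn R n -> R := \1_(slab N j).
have mf j : measurable_fun setT (f j) by have := measurable_slab N j => ?; rewrite /f; meas.
have rhs : (enorm Y (lq_sum q (fun j => abs_e (f j))) <= (fnorm Y (\1_B))%:E)%E.
  have EB : {ae mu, forall x, (\1_B x : R)%:E = (\1_B x)%:E} by exact: nearW.
  rewrite -(enorm_rep iY mY YB EB); apply: le_enorm => //.
  - by apply: measurable_lq_sum => j; have := mf j => ?; rewrite /abs_e; meas.
  - by move=> x; exact: lq_sum_ge0.
  apply: nearW => x; rewrite /lq_sum.
  have E : (\sum_(j < N) abs_e (f j) x `^ q <= (\1_B x)%:E)%E.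
    under eq_bigr => j _.
      rewrite /abs_e poweR_EFin ger0_norm; last by rewrite /f.
      over.
    rewrite sumEFin lee_fin.
    have [[j xj]|nj] := pselect (exists j : 'I_N, slab N j x); last first.
      rewrite big1 // => j _; rewrite /f indicE memNset ?powR0 ?gt_eqF //.
      by move=> xj; apply: nj; exists j.
    rewrite (bigD1 j) //= big1 ?addr0 => [|j' j'j].
      by rewrite /f !indicE !mem_set ?powR1 //; case: xj.
    rewrite /f indicE memNset ?powR0 ?gt_eqF // => xj'.
    move: xj xj' => [_ /andP[a1 a2]] [_ /andP[b1 b2]].
    have := le_lt_trans a1 b2; have := le_lt_trans b1 a2; rewrite !ltr_nat !ltnS => h1 h2.
    by move/eqP: j'j; apply; apply: val_inj => /=; apply/eqP; rewrite eqn_leq h1 h2.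
  apply: (@le_trans _ _ ((\1_B x)%:E `^ q^-1)%E).
    apply: ge0_le_poweR => //; last by rewrite invr_ge0 ltW.
    by apply: sume_ge0 => j _; exact: poweR_ge0.
  rewrite poweR_EFin lee_fin indicE; case: (_ \in _); first by rewrite powR1.
  by rewrite powR0 // gt_eqF // invr_gt0.
have lhs := fs N f N0 mf (le_lt_trans rhs (ltry _)).
have {lhs} lhs : (enorm Y (lq_sum q (fun j => maximal (f j))) <= (`|C| * fnorm Y (\1_B))%:E)%E.
  apply: le_trans lhs _; rewrite EFinM.
  apply: (@le_trans _ _ (`|C|%:E * enorm Y (lq_sum q (fun j => abs_e (f j))))%E).
    apply: lee_wpmul2r; last by rewrite lee_fin ler_norm.
    by apply: le_ereal_inf_tmp => _ [g [Yg _] <-]; rewrite lee_fin (bfs_norm_ge0 bY).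
  by apply: lee_wpmul2l.
have [y [Yy ny] yE] := enorm_le iY mY lhs.
have [||Yt nt] := iY y (fun x => t * \1_Q x) Yy; first by meas.
  apply: filterS yE => x yx; rewrite ger0_norm ?mulr_ge0 ?(ltW t0) // indicE.
  have [/set_mem xQ|_] := boolP (x \in Q); last by rewrite mulr0.
  rewrite mulr1; apply: le_trans (ler_norm _); rewrite -lee_fin -yx.
  have x01 k : 2^-1 < (tnth x k : R) < 1.
    by have := xQ k; rewrite tnth_mktuple => /andP[? ?]; apply/andP; split; lra.
  have /andP[xi1 xi2] := x01 i0.
  pose i := Num.trunc (N%:R * (tnth x i0 : R)).
  have Nx0 : 0 <= N%:R * (tnth x i0 : R) by rewrite mulr_ge0 //; lra.
  have /andP[ix xi] := Num.Theory.truncn_itv Nx0; rewrite -/i in ix xi.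
  have iN : (i < N)%N by rewrite -(ltr_nat R); apply: le_lt_trans ix _; nra.
  have mi : (m <= i)%N.
    rewrite -ltnS -(ltr_nat R); apply: lt_trans xi.
    rewrite /N natrM mulrAC mulrC -[X in X < _]mulr1 ltr_pM2l ?ltr0n //.
    by move: xi1; move: (tnth x i0 : R) => a; lra.
  have tq : ((t `^ q)%:E <= \sum_(j < N) maximal (f j) x `^ q)%E.
    pose T j := (maximal (\1_(slab N j) : Rn R n -> R) x `^ q)%E.
    rewrite -(big_mkord xpredT T) (big_cat_nat _ (n := i.+1)) //=.
    apply: (@le_trans _ _ (\sum_(0 <= j < i.+1) T j)%E); last first.
      by rewrite leeDl // sume_ge0 // => j _; exact: poweR_ge0.
    rewrite big_mkord; apply: (@le_trans _ _ (\sum_(j < i.+1) ((i - j + 3)%:R^-1)%:E)%E).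
      rewrite sumEFin lee_fin; apply: le_trans (ltW mP) _.
      rewrite [leRHS](reindex_inj rev_ord_inj) /=.
      have -> : \sum_(j < i.+1) (i - (i.+1 - j.+1) + 3)%:R^-1 = \sum_(j < i.+1) (j + 3)%:R^-1 :> R.
        by apply: eq_bigr => j _; rewrite subSS subKn // -ltnS.
      rewrite -(big_mkord xpredT (fun j => (j + 3)%:R^-1)) -(big_mkord xpredT (fun j => (j + 3)%:R^-1 : R)).
      by rewrite [leRHS](big_cat_nat _ (n := m)) //= ?lerDl ?sumr_ge0 // leqW.
    apply: lee_sum => j _; have ji : (j <= i)%N by rewrite -ltnS.
    have x01' k : 0 < (tnth x k : R) < 1 by have /andP[? ?] := x01 k; apply/andP; split; lra.
    have h := maximal_slab_ge N0 ji iN (introT andP (conj ix xi)) x01'.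
    apply: le_trans (ge0_le_poweR _ h (ltW q0)); last by rewrite lee_fin invr_ge0.
    rewrite poweR_EFin lee_fin; apply: ger1_powR => //.
    by rewrite invr_gt0 ltr0n addn3 /= invf_le1 ?ltr0n // ler1n.
  rewrite /lq_sum -(@poweR_cancel _ t%:E q) ?lee_fin ?(ltW t0) //; apply: ge0_le_poweR.
  - exact: poweR_ge0.
  - by rewrite poweR_EFin.
  - by rewrite invr_ge0 ltW.
move: nt; rewrite (_ : (fun x => _) = t \*o \1_Q) // (bfs_norm_scale bY) // gtr0_norm //.
move=> nt; have := le_trans nt ny; rewrite -ler_pdivlMr // /t; lra.
Qed.

End failure_small_exponents.

(** * Essentially bounded functions *)

Section essentially_bounded.
Variables (R : realType) (n : nat).
Implicit Types (f g : Rn R n -> R).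
Local Notation mu := (lebesgue_Rn R n).

Definition ess_bound f (K : R) : Prop := 0 <= K /\ {ae mu, forall x, `|f x| <= K}.

Definition Linf : fspace R n := FSpace
  (fun f => measurable_fun setT f /\ exists K, ess_bound f K)
  (fun f => inf [set K | ess_bound f K]).

Lemma Linf_norm_le f K : ess_bound f K -> fnorm Linf f <= K.
Proof. by move=> fK; apply: ge_inf => //; exists 0 => K' [? _]. Qed.

Lemma Linf_intro f K : measurable_fun setT f -> 0 <= K ->
  {ae mu, forall x, `|f x| <= K} -> Linf f /\ fnorm Linf f <= K.
Proof. by move=> mf K0 fK; split; [split=> //; exists K|exact: Linf_norm_le]. Qed.

Lemma Linf_norm_ge0 f : Linf f -> 0 <= fnorm Linf f.
Proof. by move=> [_ [K fK]]; apply: lb_le_inf; [exists K|move=> k []]. Qed.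

(** The infimum is attained, by intersecting countably many sets of full measure. *)
Lemma Linf_ae f : Linf f -> {ae mu, forall x, `|f x| <= fnorm Linf f}.
Proof.
move=> Lf; have [mf [K fK]] := Lf.
have h : {ae mu, forall x, forall k : nat, `|f x| <= fnorm Linf f + k.+1%:R^-1}.
  apply: ae_foralln => k; have k0 : (0 : R) < k.+1%:R^-1 by rewrite invr_gt0.
  have hi : has_inf [set K | ess_bound f K] by split; [exists K|exists 0 => K' []].
  have [K' [_ fK'] K'k] := inf_adherent k0 hi.
  by apply: filterS fK' => x h; apply: le_trans h (ltW K'k).
apply: filterS h => x h; apply/ler_addgt0Pr => e e0.
pose k := Num.bound e^-1.
apply: le_trans (h k) _; rewrite lerD2l.
have ke : e^-1 < k.+1%:R.
  apply: lt_le_trans (archi_boundP _) _; first by rewrite invr_ge0 ltW.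
  by rewrite ler_nat.
by rewrite -[e]invrK lef_pV2 ?posrE ?invr_gt0 // ltW.
Qed.

Lemma ae_mono f (K K' : R) : {ae mu, forall x, `|f x| <= K} -> K <= K' ->
  {ae mu, forall x, `|f x| <= K'}.
Proof. by move=> + KK'; apply: filterS => x h; exact: le_trans h KK'. Qed.

(** Off a single null set the sequence is uniformly Cauchy; its upper limit serves as a limit that
    is defined and measurable everywhere. *)
Lemma Linf_complete (u : nat -> Rn R n -> R) : (forall k, Linf (u k)) ->
  (forall e : R, 0 < e -> exists k0, forall i j,
      (k0 <= i)%N -> (k0 <= j)%N -> fnorm Linf (u i \- u j) < e) ->
  exists2 f, Linf f & fnorm Linf (u k \- f) @[k --> \oo] --> (0 : R).
Proof.
move=> Lu cu; have mu_ k : measurable_fun setT (u k) by have [] := Lu k.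
have Lsub i j : Linf (u i \- u j).
  have := Linf_ae (Lu i); have := Linf_ae (Lu j) => hj hi.
  apply: (@Linf_intro _ (fnorm Linf (u i) + fnorm Linf (u j)) _ _ _).1.
  - by apply: measurable_funB.
  - by rewrite addr_ge0 // Linf_norm_ge0.
  - by apply: filterS2 hi hj => x hi hj; apply: le_trans (ler_normB _ _) _; exact: lerD.
have ae_sub : {ae mu, forall x, forall i j, `|u i x - u j x| <= fnorm Linf (u i \- u j)}.
  by apply: ae_foralln => i; apply: ae_foralln => j; exact: Linf_ae (Lsub i j).
pose f x := fine (limn_esup (fun k => (u k x)%:E)).
have mf : measurable_fun setT f.
  apply: measurableT_comp; first exact: fine_measurable.
  by apply: measurable_fun_limn_esup => k; exact/measurable_EFinP.
have uf : {ae mu, forall x, u k x @[k --> \oo] --> f x}.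
  apply: filterS ae_sub => x ux.
  have cx : cvgn (fun k => u k x).
    apply: cauchy_cvg; apply: cauchy_exP => e e0.
    have [k0 k0P] := cu _ e0; exists (u k0 x); exists k0 => // k /= k0k.
    by rewrite /ball /=; apply: le_lt_trans (ux k0 k) (k0P _ _ (leqnn _) k0k).
  have [l ul] := proj1 (cvg_ex _) cx.
  have ul' : (u k x)%:E @[k --> \oo] --> l%:E by apply: cvg_EFin => //; exact: nearW.
  by rewrite /f (cvg_limn_einf_sup ul').2.
have close e : 0 < e -> exists k0, forall k, (k0 <= k)%N -> {ae mu, forall x, `|u k x - f x| <= e}.
  move=> e0; have [k0 k0P] := cu _ e0; exists k0 => k k0k.
  apply: filterS2 ae_sub uf => x ux ufx.
  have c : `|u k x - u j x| @[j --> \oo] --> `|u k x - f x|.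
    by apply: cvg_norm; apply: cvgB => //; exact: cvg_cst.
  apply: (ler_cvg_to c (cvg_cst e)); exists k0 => // j /= k0j.
  by apply: le_trans (ux k j) _; exact/ltW/k0P.
exists f.
  have [k0 k0P] := close _ ltr01; have [mk _] := Lu k0.
  apply: (@Linf_intro _ (fnorm Linf (u k0) + 1) mf _ _).1; first by rewrite addr_ge0 // Linf_norm_ge0.
  apply: filterS2 (k0P _ (leqnn _)) (Linf_ae (Lu k0)) => x h1 h2.
  have -> : f x = u k0 x - (u k0 x - f x) by ring.
  by apply: le_trans (ler_normB _ _) _; exact: lerD.
apply/cvgrPdist_le => e e0; have [k0 k0P] := close _ e0.
exists k0 => // k /= k0k; rewrite sub0r normrN.
have [|Lk nk] := @Linf_intro (u k \- f) e _ (ltW e0) (k0P _ k0k); first exact: measurable_funB.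
by rewrite ger0_norm // Linf_norm_ge0.
Qed.

Lemma Linf_ball_banach : ball_banach Linf.
Proof.
have ideal : ideal_space Linf.
  move=> f g Lf mg gf; apply: Linf_intro => //; first exact: Linf_norm_ge0.
  by apply: filterS2 gf (Linf_ae Lf) => x; exact: le_trans.
have zero : Linf (cst 0) by apply: (@Linf_intro _ 0 _ _ _).1 => //; apply: nearW => x; rewrite normr0.
have scale a f : Linf f -> Linf (a \*o f) /\ fnorm Linf (a \*o f) <= `|a| * fnorm Linf f.
  move=> Lf; have [mf _] := Lf; apply: Linf_intro.
  - by rewrite (_ : a \*o f = fun x => a * f x) //; meas.
  - by rewrite mulr_ge0 // Linf_norm_ge0.
  - by apply: filterS (Linf_ae Lf) => x h; rewrite /= normrM ler_wpM2l.
have add f g : Linf f -> Linf g -> Linf (f \+ g) /\ fnorm Linf (f \+ g) <= fnorm Linf f + fnorm Linf g.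
  move=> Lf Lg; have [mf _] := Lf; have [mg _] := Lg; apply: Linf_intro.
  - exact: measurable_funD.
  - by rewrite addr_ge0 // Linf_norm_ge0.
  - apply: filterS2 (Linf_ae Lf) (Linf_ae Lg) => x h1 h2.
    by apply: le_trans (ler_normD _ _) _; exact: lerD.
split; first split => //.
- by move=> f [].
- by move=> f g Lf Lg; exact: (add f g Lf Lg).1.
- by move=> a f Lf; exact: (scale a f Lf).1.
- by move=> f; exact: Linf_norm_ge0.
- move=> f Lf f0; have := Linf_ae Lf; rewrite f0; apply: filterS => x.
  by rewrite normr_le0 => /eqP.
- move=> a f Lf; apply/eqP; rewrite eq_le (scale a f Lf).2 /=.
  have [->|a0] := eqVneq a 0; first by rewrite normr0 mul0r; exact: Linf_norm_ge0 (scale 0 f Lf).1.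
  have := (scale a^-1 _ (scale a f Lf).1).2.
  rewrite (_ : a^-1 \*o (a \*o f) = f); last by apply/funext => x /=; rewrite mulKf.
  by rewrite normfV ler_pdivlMl // normr_gt0.
- by move=> f g Lf Lg; rewrite mul1r; exact: (add f g Lf Lg).2.
- exact: Linf_complete.
- move=> u f Lu mf uf ub; set S := sup _.
  have uS k : fnorm Linf (u k) <= S by apply: ub_le_sup => //; exists k.
  have S0 : 0 <= S by apply: le_trans (uS 0%N); exact: Linf_norm_ge0.
  have aeu : {ae mu, forall x, forall k, `|u k x| <= S}.
    by apply: ae_foralln => k; exact: ae_mono (Linf_ae (Lu k)) (uS k).
  have [|Lf nf] := @Linf_intro f S mf S0.
    apply: filterS2 aeu uf => x ux [_ c].
    by apply: (ler_cvg_to (cvg_norm c) (cvg_cst S)); apply: nearW => k; exact: ux.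
  split=> //; apply/eqP; rewrite eq_le nf /=; apply: ge_sup; first by exists (fnorm Linf (u 0%N)), 0%N.
  move=> _ [k _ <-]; apply: (ideal f (u k) Lf _ _).2; first by have [] := Lu k.
  apply: filterS uf => x [ux c]; have u0 k' : 0 <= u k' x by have /andP[] := ux k'.
  have nd : nondecreasing_seq (u^~ x) by apply/nondecreasing_seqP => k'; have /andP[] := ux k'.
  rewrite ger0_norm //; apply: le_trans (ler_norm _); rewrite -(cvg_lim _ c) //.
  by apply: nondecreasing_cvgn_le => //; apply/cvg_ex; exists (f x).
- move=> c r r0; apply: (@Linf_intro _ 1 _ _ _).1 => //.
    by have := measurable_euclidean_ball c r0 => ?; meas.
  by apply: nearW => x; rewrite ger0_norm // indicE; case: (_ \in _).
move=> c r r0; have mb := measurable_euclidean_ball c r0.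
have [c' bc'] := ball_sub_cube c r0; have r20 : 0 < 2 * r by rewrite mulr_gt0.
exists ((2 * r) ^+ n) => f Lf; have [mf _] := Lf.
have nf0 := Linf_norm_ge0 Lf.
apply: (@le_trans _ _ (\rint[mu]_x (fnorm Linf f * \1_(euclidean_ball c r) x))).
  rewrite rint_setE //; apply: ae_le_rint; [by meas|by meas|by move=> x; rewrite mulr_ge0|by move=> x; rewrite mulr_ge0|].
  by apply: filterS (Linf_ae Lf) => x h; rewrite ler_wpM2r.
rewrite rintZ // rint_indic // mulrC EFinM; apply: lee_wpmul2l; first by rewrite lee_fin.
by rewrite -(lebesgue_cube c' r20); apply: le_measure; rewrite ?inE //; exact: measurable_cube.
Qed.

Lemma Linf_maximal_bound : (0 < n)%N -> maximal_bound Linf 1.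
Proof.
move=> n0 f Lf; have [mf _] := Lf; have lL := ball_banach_levi Linf_ball_banach.
have [mL iL] := (levi_measurable lL, levi_ideal lL).
have nf0 := Linf_norm_ge0 Lf.
have Mf x : (maximal f x <= (fnorm Linf f)%:E)%E.
  apply: maximal_le => [|c l l0 cx]; first by rewrite lee_fin.
  have mc := measurable_cube c l; have ln0 : 0 < l ^+ n by rewrite exprn_gt0.
  rewrite /cube_average lee_pdivrMl // -EFinM mulrC EFinM -(lebesgue_cube c l0) -rint_indic // -rintZ //.
  apply: ae_le_rint; [by meas|by meas|by move=> y; rewrite mulr_ge0|by move=> y; rewrite mulr_ge0|].
  by apply: filterS (Linf_ae Lf) => y h; rewrite ler_wpM2r.
have [||Lc nc] := @Linf_intro (cst (fnorm Linf f)) (fnorm Linf f) _ nf0.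
- exact: measurable_cst.
- by apply: nearW => x; rewrite ger0_norm.
have E : {ae mu, forall x, ((fnorm Linf f)%:E : \bar R) = (cst (fnorm Linf f) x)%:E} by exact: nearW.
rewrite mul1r; apply: (@le_trans _ _ (enorm Linf (fun=> (fnorm Linf f)%:E))).
  apply: le_enorm => //; [exact: measurable_maximal|by move=> x; exact: maximal_ge0|exact: nearW].
by rewrite (enorm_rep iL mL Lc E) lee_fin.
Qed.

(** Elements of the associate space are integrable, as testing with the constant 1 shows. The
    maximal function of the unit cube is at least $2^{-kn}$ on a cube of measure $2^{kn}$ for every
    [k]. These contributions overlap, but at each point [lacunary_sum] bounds their sum by twice the
    function, so its integral is infinite. *)
Lemma Linf_associate_unbounded : (0 < n)%N -> ~ maximal_bounded (associate Linf).
Proof.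
move=> n0 [C MC]; have bL := Linf_ball_banach.
have lA := associate_levi bL; have [mA iA] := (levi_measurable lA, levi_ideal lA).
pose o : Rn R n := [tuple 0 : measurableTypeR R | i < n].
have Af := levi_cube lA o ltr01; set f := \1_(cube o 1) in Af.
have mf := mA _ Af.
have [g [Ag _] Mg] := enorm_le iA mA (MC _ Af).
have [mg gfin] := Ag.
have [B gB] : exists B : R, (\rint[mu]_x `|g x| <= B%:E)%E.
  have [||L1 n1] := @Linf_intro (cst 1) 1 _ ler01; first exact: measurable_cst.
    by apply: nearW => x; rewrite normr1.
  exists (fine (associate_norm Linf g)); rewrite fineK ?ge0_fin_numE ?associate_norm_ge0 //.
  apply: ereal_sup_ubound; exists (cst 1) => //.
  by apply: eq_integral => x _; rewrite mul1r.
pose Q k := cube o (2 ^+ k : R).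
have p0 k : 0 < (2 : R) ^+ k by rewrite exprn_gt0.
have mQ k : measurable (Q k) by exact: measurable_cube.
pose a (k : nat) : R := (2 ^+ k)^-1 ^+ n.
have a0 k : 0 < a k by rewrite exprn_gt0 // invr_gt0.
have Mfge k x : Q k x -> ((a k)%:E <= maximal f x)%E.
  move=> Qx; apply: le_trans (maximal_ge f (p0 k) Qx).
  rewrite /cube_average -[X in (X <= _)%E]mule1 -exprVn; apply: lee_wpmul2l.
    by rewrite lee_fin ltW // a0.
  have m01 := measurable_cube o 1.
  have := lebesgue_cube o (@ltr01 R); rewrite expr1n => <-; rewrite -rint_indic //.
  apply: le_rint; [by meas|by have := mQ k => ?; meas|by []|move=> y].
  rewrite ger0_norm // /f !indicE; have [/set_mem yc|_] := boolP (y \in cube o 1); last by rewrite mul0r.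
  rewrite mem_set ?mul1r // => i; have /andP[y1 y2] := yc i; rewrite y1 /=.
  by apply: lt_le_trans y2 _; rewrite lerD2l exprn_ege1 // ler1n.
have key K : (K.+1%:R%:E <= (2 * B)%:E)%E.
  have -> : (K.+1%:R : R)%:E = \rint[mu]_x (\sum_(k < K.+1) a k * \1_(Q k) x).
    rewrite rint_sum; last 2 first.
    - by move=> k; have := mQ k => ?; meas.
    - by move=> k x; rewrite mulr_ge0 // ltW.
    rewrite (eq_bigr (fun=> 1%E)) => [|k _].
      by rewrite sumEFin sumr_const card_ord.
    by rewrite rintZ // ?(ltW (a0 k)) // rint_indic // lebesgue_cube // -EFinM /a -exprMn mulVf ?expr1n.
  apply: (@le_trans _ _ (\rint[mu]_x (2 * `|g x|))); last first.
    by rewrite rintZ //; [rewrite EFinM; apply: lee_wpmul2l; rewrite ?lee_fin|meas].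
  apply: ae_le_rint.
  - by apply: measurable_sum => k; have := mQ k => ?; meas.
  - by meas.
  - by move=> x; apply: sumr_ge0 => k _; rewrite mulr_ge0 // ltW.
  - by move=> x; rewrite mulr_ge0.
  apply: filterS Mg => x gx.
  have ag k : Q k x -> a k <= `|g x|.
    move=> Qx; apply: le_trans (ler_norm _); rewrite -lee_fin -gx; exact: Mfge.
  rewrite -(big_mkord xpredT (fun k => a k * \1_(Q k) x)).
  have -> : \sum_(0 <= k < K.+1) a k * \1_(Q k) x = \sum_(k <- [seq k <- iota 0 K.+1 | x \in Q k]) a k.
    rewrite big_filter [RHS]big_mkcond /= /index_iota subn0; apply: eq_bigr => k _.
    by rewrite indicE; case: (x \in Q k); rewrite ?mulr1 ?mulr0.
  have -> : (2 : R) * `|g x| = 2 / (2 - 1) * `|g x| by field.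
  have half i j : (i < j)%N -> 2 * a j <= a i.
    move=> ij; rewrite /a !exprVn ler_pdivrMr ?exprn_gt0 // mulrC ler_pdivlMr ?exprn_gt0 //.
    rewrite -!exprM; apply: (@le_trans _ _ (2 ^+ ((i * n).+1))); first by rewrite exprS.
    rewrite ler_eXn2l ?ltr1n //. nia.
  apply: lacunary_sum => //; first lra.
  - by rewrite filter_uniq // iota_uniq.
  - by move=> k _; exact: ltW.
  - move=> i j _ _ ij; have [lij|lji|e] := ltngtP i j; [right|left|].
    + exact: half.
    + exact: half.
    + by rewrite e eqxx in ij.
  - by move=> k; rewrite mem_filter => /andP[/set_mem + _]; exact: ag.
have := key (Num.bound (2 * `|B|)); rewrite lee_fin leNgt => /negP; apply.
apply: (@le_lt_trans _ _ (2 * `|B|)); first by rewrite ler_pM2l // ler_norm.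
apply: lt_le_trans (archi_boundP _) _; first by rewrite mulr_ge0.
by rewrite ler_nat.
Qed.

End essentially_bounded.

(** * The Lorentz-Luxemburg theorem *)

Section lorentz_luxemburg.
Variables (R : realType) (n : nat).
Implicit Types (X Z : fspace R n) (f g h v : Rn R n -> R).
Local Notation mu := (lebesgue_Rn R n).

(** The infima [w k] over the tails increase to the same limit and lie below [u k], which removes
    monotonicity from the limit property. *)
Lemma levi_fatou Z (u : nat -> Rn R n -> R) f (B : R) : levi_space Z ->
  (forall k, Z (u k)) -> (forall k x, 0 <= u k x) -> measurable_fun setT f ->
  (forall x, 0 <= f x) -> {ae mu, forall x, u k x @[k --> \oo] --> f x} ->
  (forall k, fnorm Z (u k) <= B) -> Z f /\ fnorm Z f <= B.
Proof.
move=> lZ Zu u0 mf f0 uf uB; have [mZ iZ] := (levi_measurable lZ, levi_ideal lZ).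
have mu_ k := mZ _ (Zu k).
pose w k x := fine (einfs (fun j => (u j x)%:E) k).
have e0 k x : (0 <= einfs (fun j => (u j x)%:E) k)%E.
  by apply: le_ereal_inf_tmp => _ [j _ <-]; rewrite lee_fin.
have eu k x : (einfs (fun j => (u j x)%:E) k <= (u k x)%:E)%E.
  by apply: ereal_inf_lbound; exists k => /=.
have efin k x : einfs (fun j => (u j x)%:E) k \is a fin_num.
  by rewrite ge0_fin_numE // (le_lt_trans (eu k x)) // ltry.
have w0 k x : 0 <= w k x <= w k.+1 x.
  rewrite /w fine_ge0 //=; apply: fine_le => //.
  by apply: nondecreasing_einfs.
have wu k x : w k x <= u k x by rewrite -lee_fin fineK.
have w_ge0 k x : 0 <= w k x by have /andP[] := w0 k x.
have mw k : measurable_fun setT (w k).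
  apply: measurableT_comp; first exact: fine_measurable.
  by apply: measurable_fun_einfs => j; exact/measurable_EFinP.
have Zw k : Z (w k) /\ fnorm Z (w k) <= B.
  have [|Zwk nw] := iZ _ (w k) (Zu k) (mw k).
    by apply: nearW => x; rewrite !ger0_norm.
  by split => //; exact: le_trans nw (uB k).
have [F [ZF nF F0 wF _]] := levi_limit lZ (fun k => (Zw k).1) w0 (fun k => (Zw k).2).
have fF : {ae mu, forall x, f x = F x}.
  apply: filterS2 uf wF => x c1 c2.
  have c1' : (u k x)%:E @[k --> \oo] --> (f x)%:E by apply: cvg_EFin => //; exact: nearW.
  have c3 : w k x @[k --> \oo] --> f x by apply: (fine_cvg (cvg_einfs c1')).
  by rewrite -(cvg_lim _ c3) // (cvg_lim _ c2).
have [|Zf nf] := iZ F f ZF mf; first by apply: filterS fF => x ->.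
by split => //; exact: le_trans nf nF.
Qed.

(** The increments have summable integrals, so their sum is finite a.e. and the sequence converges
    there. Clamping the limit between 0 and [v] makes the bounds hold everywhere. *)
Lemma cauchy_ae_limit (u : nat -> Rn R n -> R) v (B : R) :
  (forall k, measurable_fun setT (u k)) -> measurable_fun setT v ->
  (forall k x, 0 <= u k x <= v x) ->
  (forall k, (\rint[mu]_x `|u k x - u k.+1 x| <= (2^-1 ^+ k * B)%:E)%E) ->
  exists g, [/\ measurable_fun setT g, forall x, 0 <= g x <= v x &
    {ae mu, forall x, u k x @[k --> \oo] --> g x}].
Proof.
move=> mu_ mv uv uB.
have B0 : 0 <= B.
  have := uB 0%N; rewrite expr0 mul1r -lee_fin; apply: le_trans.
  exact: rint_ge0.
pose s N x := \sum_(k < N) `|u k x - u k.+1 x|.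
have ms N : measurable_fun setT (s N).
  by rewrite /s; apply: measurable_sum => k; have := mu_ k => ?; have := mu_ k.+1 => ?; meas.
have [|j|f [mf f0 sf _]] := @monotone_limit _ _ s ms.
- move=> k x; rewrite sumr_ge0 //= /s big_ord_recr /= lerDl //.
- exists (2 * B) => k.
  apply: (@le_trans _ _ (rint mu (s k))).
    have mQ : measurable (centered_cube R n j) by exact: measurable_cube.
    have := ms k => msk; apply: le_rint; [by meas|by []| |] => x.
      by rewrite mulr_ge0 // sumr_ge0.
    by rewrite ler_piMr ?sumr_ge0 // indicE; case: (_ \in _).
  rewrite rint_sum //; last by move=> i; have := mu_ i => ?; have := mu_ i.+1 => ?; meas.
  apply: (@le_trans _ _ (\sum_(i < k) (2^-1 ^+ i * B)%:E)%E); first by apply: lee_sum => i _; exact: uB.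
  rewrite sumEFin lee_fin -mulr_suml ler_wpM2r //.
  have -> : \sum_(i < k) (2^-1 : R) ^+ i = 2 - 2 * 2^-1 ^+ k.
    elim: k => [|k IH]; first by rewrite big_ord0 expr0; lra.
    rewrite big_ord_recr /= IH exprS; lra.
  by rewrite gerBl mulr_ge0 // exprn_ge0.
have uc : {ae mu, forall x, cvgn (u^~ x)}.
  apply: filterS sf => x c.
  have c1 : cvgn [normed series (telescope (u^~ x))].
    rewrite (_ : [normed series _] = (s^~ x)); first by apply/cvg_ex; exists (f x).
    apply/funext => N; rewrite /= seriesEord /= /s; apply: eq_bigr => k _.
    by rewrite /telescope /= distrC.
  have := normed_cvg c1; rewrite telescopeK => c2.
  have -> : u^~ x = (fun k => (u k x - u 0%N x) + u 0%N x) by apply/funext => k; rewrite subrK.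
  by apply: is_cvgD => //; exact: is_cvg_cst.
pose g0 x := fine (limn_esup (fun k => (u k x)%:E)).
have mg0 : measurable_fun setT g0.
  apply: measurableT_comp; first exact: fine_measurable.
  by apply: measurable_fun_limn_esup => k; exact/measurable_EFinP.
exists (fun x => Num.min (Num.max (g0 x) 0) (v x)); split.
- by meas.
- move=> x; have /andP[h1 h2] := uv 0%N x.
  by rewrite le_min le_max lexx orbT (le_trans h1 h2) ge_min lexx orbT.
- apply: filterS uc => x cx; have [l ul] := proj1 (cvg_ex _) cx.
  have ul' : (u k x)%:E @[k --> \oo] --> l%:E by apply: cvg_EFin => //; exact: nearW.
  have -> : g0 x = l by rewrite /g0 (cvg_limn_einf_sup ul').2.
  have l0 : 0 <= l by apply: (ler_cvg_to (cvg_cst 0) ul); apply: nearW => k; have /andP[] := uv k x.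
  have lv : l <= v x by apply: (ler_cvg_to ul (cvg_cst (v x))); apply: nearW => k; have /andP[] := uv k x.
  by rewrite max_l // min_l.
Qed.

(** * Projection in L^2 onto a ball of X *)

Section projection.
Variables (X : fspace R n) (j : nat) (b K : R) (v : Rn R n -> R).
Hypotheses (lX : levi_space X) (b0 : 0 <= b) (K0 : 0 < K) (mv : measurable_fun setT v).
Hypothesis vb : forall x, 0 <= v x <= b * \1_(centered_cube R n j) x.
Let Q := centered_cube R n j.
Let mQ : measurable Q := measurable_cube _ _.

Let v0 x : 0 <= v x. Proof. by have /andP[] := vb x. Qed.
Let v_le_b x : v x <= b.
Proof.
have /andP[_ h] := vb x; apply: le_trans h _.
by rewrite ler_piMr // indicE; case: (_ \in _).
Qed.
Let v_out x : ~ Q x -> v x = 0.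
Proof.
move=> Qx; have /andP[h1 h2] := vb x; apply/eqP; rewrite eq_le h1 andbT.
by move: h2; rewrite indicE memNset // mulr0.
Qed.

Let muQ : mu Q \is a fin_num.
Proof. by rewrite /Q /centered_cube lebesgue_cube // mulr_gt0. Qed.

Let Xbounded f (M : R) : measurable_fun setT f -> (forall x, `|f x| <= M * \1_Q x) -> X f.
Proof.
move=> mf fM; have XQ : X (\1_Q) by apply: (levi_cube lX); rewrite mulr_gt0.
have [XM _] := levi_scale lX M XQ.
by apply: (levi_ideal lX XM mf _).1; apply: nearW => x; apply: le_trans (fM x) (ler_norm _).
Qed.

(** The convex set onto which [v] is projected. The cap by [v] keeps its members bounded and
    supported in [Q], hence in $L^2$. *)
Let Kset g := [/\ X g, forall x, 0 <= g x <= v x & fnorm X g <= K].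
Let D g : \bar R := \rint[mu]_x ((v x - g x) ^+ 2).

Let KsetI g : measurable_fun setT g -> (forall x, 0 <= g x <= v x) -> fnorm X g <= K -> Kset g.
Proof.
move=> mg gv nK; split=> //; apply: (Xbounded (M := b)) => // x.
have /andP[h1 h2] := gv x; rewrite ger0_norm //; apply: le_trans h2 _.
by have /andP[] := vb x.
Qed.

Let Dfin g : Kset g -> D g \is a fin_num.
Proof.
move=> [Xg gv _]; have mg := levi_measurable lX Xg.
rewrite ge0_fin_numE; last by apply: rint_ge0 => x; exact: sqr_ge0.
apply: (@le_lt_trans _ _ ((b ^+ 2)%:E * mu Q)%E); last first.
  by rewrite -(fineK muQ) -EFinM ltry.
rewrite -rint_indic // -rintZ ?exprn_ge0 //.
apply: le_rint; [by meas|by meas|by move=> x; exact: sqr_ge0|move=> x].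
have /andP[g0 gx] := gv x; rewrite indicE.
have [/set_mem Qx|/negP Qx] := boolP (x \in Q).
  rewrite mulr1; apply: lerXn2r; rewrite ?nnegrE ?subr_ge0 //.
  by have := v_le_b x; lra.
have vx : v x = 0 by apply: v_out => h; apply: Qx; rewrite inE.
have -> : g x = 0 by rewrite vx in gx; lra.
by rewrite vx subr0 expr0n /= mulr0.
Qed.

Let Kset_mid g1 g2 (t : R) : 0 <= t <= 1 -> Kset g1 -> Kset g2 ->
  Kset (fun x => (1 - t) * g1 x + t * g2 x).
Proof.
move=> /andP[t0 t1] [X1 gv1 n1] [X2 gv2 n2].
have t10 : 0 <= 1 - t by lra.
have [X1' n1'] := levi_scale lX (1 - t) X1; have [X2' n2'] := levi_scale lX t X2.
have [X3 n3] := levi_add lX X1' X2'; split => //.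
  move=> x; have /andP[? ?] := gv1 x; have /andP[? ?] := gv2 x.
  by apply/andP; split; nra.
apply: le_trans n3 _; rewrite ger0_norm // in n1'; rewrite ger0_norm // in n2'.
nra.
Qed.

(** A minimizing sequence is Cauchy in $L^2$ by the parallelogram law, hence in $L^1$ because
    everything lives on the set [Q] of finite measure; it converges a.e., and both the norm in $X$
    and the distance pass to the limit by Fatou. *)
Lemma projection_exists : exists2 g, Kset g & forall g', Kset g' -> (D g <= D g')%E.
Proof.
have Kset0 : Kset (cst 0).
  have [X0 n0] := levi_zero lX; split=> //; last by rewrite n0 ltW.
  by move=> x; rewrite lexx v0.
pose E := [set fine (D g) | g in Kset].
have D0 g : (0 <= D g)%E by apply: rint_ge0 => x; exact: sqr_ge0.
have hiE : has_inf E.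
  split; first by exists (fine (D (cst 0))), (cst 0).
  by exists 0 => _ [g _ <-]; rewrite fine_ge0.
pose d := inf E.
have dD g : Kset g -> d <= fine (D g).
  by move=> Kg; apply: ge_inf; [exact: hiE.2|exists g].
(* Errors $4^{-k}$, so that the distances between consecutive terms, of order $2^{-k}$, are
   summable. *)
pose e k : R := (2^-1 ^+ k) ^+ 2.
have e0 k : 0 < e k by rewrite !exprn_gt0 // invr_gt0.
have /choice[g gP] : forall k, exists g, Kset g /\ fine (D g) <= d + e k.
  move=> k; have [_ [g Kg <-] h] := inf_adherent (e0 k) hiE.
  by exists g; split => //; exact: ltW.
have Kg k := (gP k).1.
have Xg k : X (g k) by have [] := Kg k.
have gv k x : 0 <= g k x <= v x by have [_ +] := Kg k.
have mg k := levi_measurable lX (Xg k).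
have para k : (\rint[mu]_x ((g k x - g k.+1 x) ^+ 2) <= (4 * e k)%:E)%E.
  have half01 : 0 <= (2^-1 : R) <= 1 by apply/andP; split; lra.
  pose gm x := (1 - 2^-1) * g k x + 2^-1 * g k.+1 x.
  have Kmid : Kset gm by exact: Kset_mid half01 (Kg k) (Kg k.+1).
  have mk := mg k; have mk1 := mg k.+1.
  have : (\rint[mu]_x ((g k x - g k.+1 x) ^+ 2) + 4%:E * D gm =
      2%:E * D (g k) + 2%:E * D (g k.+1))%E.
    rewrite /D /gm -!rintZ; [|by meas|by move=> x; exact: sqr_ge0|by []|by meas|by move=> x; exact: sqr_ge0|by []|by meas|by move=> x; exact: sqr_ge0|by []].
    rewrite -!rintD; [|by meas|by meas|by move=> x; rewrite mulr_ge0 // sqr_ge0|by move=> x; rewrite mulr_ge0 // sqr_ge0|by meas|by meas|by move=> x; exact: sqr_ge0|by move=> x; rewrite mulr_ge0 // sqr_ge0].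
    by congr (rint mu _); apply/funext => x; field.
  have I0 : (0 <= \rint[mu]_x ((g k x - g k.+1 x) ^+ 2))%E by apply: rint_ge0 => x; exact: sqr_ge0.
  have := dD _ Kmid; have := (gP k).2; have := (gP k.+1).2.
  rewrite -(fineK (Dfin Kmid)) -(fineK (Dfin (Kg k))) -(fineK (Dfin (Kg k.+1))).
  move: (fine (D (g k))) (fine (D (g k.+1))) (fine (D gm)) I0 => d1 d2 d3.
  case: rint => [r| |] //; rewrite -!EFinM -!EFinD lee_fin => r0 h1 h2 h3 [h4].
  have ek : e k.+1 = 2^-1 ^+ 2 * e k by rewrite /e [2^-1 ^+ k.+1]exprS exprMn.
  have := e0 k; rewrite expr2 in ek.
  clear -ek h1 h2 h3 h4; move: (e k) (e k.+1) ek h1 h2 => x y ek h1 h2 x0.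
  by rewrite lee_fin; rewrite /= in h1 h2 h3; lra.
pose B := fine (mu Q) + 4.
have l1 k : (\rint[mu]_x `|g k x - g k.+1 x| <= (2^-1 ^+ k * B)%:E)%E.
  have mk := mg k; have mk1 := mg k.+1.
  have s0 : 0 < (2^-1 : R) ^+ k by rewrite exprn_gt0 // invr_gt0.
  set s : R := 2^-1 ^+ k in s0 *.
  (* The inequality $|y|\le s+y^2/s$ trades the $L^2$ bound for an $L^1$ bound; with $s=2^{-k}$ both
     terms are of order $s$. *)
  apply: (@le_trans _ _ (\rint[mu]_x (s * \1_Q x + s^-1 * ((g k x - g k.+1 x) ^+ 2)))).
    apply: le_rint; [by meas|by meas|by []|move=> x].
    rewrite indicE; have [/set_mem Qx|/negP Qx] := boolP (x \in Q).
      rewrite mulr1 -real_normK ?num_real //.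
      have [h|h] := leP `|g k x - g k.+1 x| s.
        by apply: le_trans h _; rewrite lerDl mulr_ge0 ?invr_ge0 ?sqr_ge0 // ltW.
      rewrite -[leLHS]add0r lerD ?(ltW s0) // expr2 mulrA ler_peMl //.
      by rewrite mulrC ler_pdivlMr // mul1r ltW.
    have vx : v x = 0 by apply: v_out => h; apply: Qx; rewrite inE.
    have g00 i : g i x = 0 by have := gv i x; rewrite vx => /andP[? ?]; lra.
    by rewrite !g00 subrr normr0 expr0n /= !mulr0 addr0.
  rewrite rintD; [|by meas|by meas|by move=> x; rewrite mulr_ge0 // ltW|
    by move=> x; rewrite mulr_ge0 ?sqr_ge0 // invr_ge0 ltW].
  rewrite !rintZ; [|by meas|by move=> x; exact: sqr_ge0|by rewrite invr_ge0 ltW|by meas|by []|exact: ltW].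
  rewrite rint_indic // -(fineK muQ) /B mulrDr EFinD EFinM leeD2l //.
  apply: (@le_trans _ _ (s^-1%:E * (4 * e k)%:E)%E).
    by apply: lee_wpmul2l; [rewrite lee_fin invr_ge0 ltW|exact: para].
  rewrite -EFinM lee_fin /e -/s le_eqVlt; apply/orP; left; apply/eqP; field.
  by rewrite gt_eqF.
have [G [mG Gv gG]] := cauchy_ae_limit mg mv gv l1.
have [XG nG] : X G /\ fnorm X G <= K.
  apply: (levi_fatou lX Xg _ mG _ gG) => [k x|x|k].
  - by have /andP[] := gv k x.
  - by have /andP[] := Gv x.
  - by have [] := Kg k.
exists G; first by split.
move=> g' Kg'; rewrite -(fineK (Dfin Kg')).
have : forall k, (D G <= (d + e k)%:E)%E.
  move=> k; apply: (@rint_fatou _ _ _ mu (fun i x => (v x - g (i + k)%N x) ^+ 2)).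
  - by move=> i; have := mg (i + k)%N => ?; meas.
  - by meas.
  - by move=> i x; exact: sqr_ge0.
  - apply: filterS gG => x c.
    have c' : g (i + k)%N x @[i --> \oo] --> G x by rewrite (cvg_shiftn k (g^~ x) (nbhs (G x))).
    have c2 : v x - g (i + k)%N x @[i --> \oo] --> v x - G x.
      by apply: cvgB => //; exact: cvg_cst.
    rewrite (_ : (fun i => _) = (fun i => (v x - g (i + k)%N x) * (v x - g (i + k)%N x))); last first.
      by apply/funext => i; rewrite expr2.
    by rewrite expr2; exact: cvgM.
  - move=> i; rewrite -/(D (g (i + k)%N)) -(fineK (Dfin (Kg (i + k)%N))) lee_fin.
    apply: le_trans (gP _).2 _; rewrite lerD2l /e.
    apply: lerXn2r; rewrite ?nnegrE ?exprn_ge0 // exprD ler_piMl ?exprn_ge0 //.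
    by rewrite exprn_ile1 // invf_le1 // ler1n.
  - by move=> x; exact: sqr_ge0.
have KG : Kset G by split.
rewrite -(fineK (Dfin KG)) => h; rewrite lee_fin.
apply: le_trans (dD _ Kg'); apply/ler_addgt0Pr => ep ep0.
pose k := Num.bound ep^-1.
have := h k; rewrite lee_fin => /le_trans; apply; rewrite lerD2l /e -exprM mulnC exprM.
have k1 : 2^-1 ^+ k <= ep.
  rewrite -[ep]invrK exprVn lef_pV2 ?posrE ?exprn_gt0 ?invr_gt0 //.
  apply: le_trans (ltW (archi_boundP _)) _; first by rewrite invr_ge0 ltW.
  by rewrite -natrX ler_nat ltnW // ltn_expl.
apply: le_trans k1; rewrite expr2 exprMn ler_piMl ?exprn_ge0 //.
by rewrite exprn_ile1 // invf_le1 // ler1n.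
Qed.

(* The residual [v - g] of the L2 projection [g] of [v] is a functional that
   attains its maximum over the ball of radius [K] at [g]. *)
Lemma projection_supports : exists2 g, Kset g & forall f, X f -> (forall x, 0 <= f x) ->
  fnorm X f <= K ->
  (\rint[mu]_x ((v x - g x) * f x) <= \rint[mu]_x ((v x - g x) * g x))%E.
Proof.
have [g Kg gmin] := projection_exists; exists g => //.
have [Xg gv ng] := Kg; have mg := levi_measurable lX Xg.
have g0 x : 0 <= g x by have /andP[] := gv x.
have h0 x : 0 <= v x - g x by have /andP[] := gv x; rewrite subr_ge0.
have hout x : ~ Q x -> v x - g x = 0.
  by move=> Qx; have := gv x; rewrite v_out // => /andP[? ?]; lra.
pose I f := \rint[mu]_x ((v x - g x) * f x).
have Ibounded f (M : R) : measurable_fun setT f -> (forall x, 0 <= f x <= M) -> 0 <= M -> I f \is a fin_num.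
  move=> mf fM M0; have f0 x : 0 <= f x by have /andP[] := fM x.
  rewrite ge0_fin_numE; last by apply: rint_ge0 => x; rewrite mulr_ge0.
  apply: (@le_lt_trans _ _ ((b * M)%:E * mu Q)%E); last by rewrite -(fineK muQ) -EFinM ltry.
  rewrite -rint_indic // -rintZ ?mulr_ge0 //.
  apply: le_rint; [by meas|by meas|by move=> x; rewrite mulr_ge0|move=> x].
  rewrite indicE; have [/set_mem Qx|/negP Qx] := boolP (x \in Q).
    rewrite mulr1 ler_pM //; last by have /andP[] := fM x.
    by have := v_le_b x; have := g0 x; lra.
  by rewrite hout ?mul0r ?mulr0 // => h; apply: Qx; rewrite inE.
have gb x : 0 <= g x <= b by have /andP[-> h] := gv x; exact: le_trans h (v_le_b x).
have bounded f (M : R) : X f -> (forall x, 0 <= f x <= M * \1_Q x) -> 0 <= M -> fnorm X f <= K ->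
    (I f <= I g)%E.
  move=> Xf fM M0 nf; have mf := levi_measurable lX Xf.
  have f0 x : 0 <= f x by have /andP[] := fM x.
  have fM' x : 0 <= f x <= M.
    rewrite f0 /=; have /andP[_ h] := fM x; apply: le_trans h _.
    by rewrite ler_piMr // indicE; case: (_ \in _).
  (* Bounds the term of order $t^2$ in the squared distance; minimality of [g] then gives the claim
     up to [t * (B / 2)]. *)
  pose B := (M + b) ^+ 2 * fine (mu Q).
  have B0 : 0 <= B by rewrite mulr_ge0 ?sqr_ge0 // fine_ge0.
  have key t : 0 < t -> t <= 1 -> fine (I f) <= fine (I g) + t * (B / 2).
    move=> t0 t1.
    (* A point of the segment from [g] to [f], cut off at [v] to stay in [Kset]; the cut only brings
       it closer to [v]. *)
    pose gt x := Num.min ((1 - t) * g x + t * f x) (v x).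
    have t10 : 0 <= 1 - t by lra.
    have cv0 x : 0 <= (1 - t) * g x + t * f x by rewrite addr_ge0 // mulr_ge0 // ltW.
    have Kgt : Kset gt.
      have [X1' n1'] := levi_scale lX (1 - t) Xg; have [X2' n2'] := levi_scale lX t Xf.
      have [X3 n3] := levi_add lX X1' X2'.
      have mgt : measurable_fun setT gt by rewrite /gt; meas.
      have gt0 x : 0 <= gt x <= v x by rewrite /gt le_min cv0 v0 ge_min lexx orbT.
      have [|_ n4] := levi_ideal lX X3 mgt.
        apply: nearW => x; rewrite !ger0_norm //; first by rewrite /gt ge_min lexx.
        by have /andP[] := gt0 x.
      apply: KsetI => //; apply: le_trans n4 _; apply: le_trans n3 _.
      rewrite ger0_norm // in n1'; rewrite gtr0_norm // in n2'; nra.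
    have := gmin _ Kgt.
    have mgt : measurable_fun setT gt by rewrite /gt; meas.
    have h1 : (D gt + (2 * t)%:E * I f <= D g + (2 * t)%:E * I g + (t ^+ 2 * B)%:E)%E.
      rewrite /D /I -!rintZ; [|by meas|by move=> x; rewrite mulr_ge0|by rewrite mulr_ge0 // ltW|
        by meas|by move=> x; rewrite mulr_ge0|by rewrite mulr_ge0 // ltW].
      have t20 : 0 <= 2 * t by rewrite mulr_ge0 // ltW.
      have -> : (t ^+ 2 * B)%:E = \rint[mu]_x (t ^+ 2 * (M + b) ^+ 2 * \1_Q x).
        rewrite rintZ; [|by meas|by []|by apply: mulr_ge0; exact: sqr_ge0].
        by rewrite rint_indic // -[X in (_ * X)%E](fineK muQ) -EFinM /B mulrA.
      have h2t x y : 0 <= y -> 0 <= 2 * t * ((v x - g x) * y) by move=> y0; apply: mulr_ge0 => //; exact: mulr_ge0.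
      have hB x : 0 <= t ^+ 2 * (M + b) ^+ 2 * \1_Q x.
        by apply: mulr_ge0 => //; apply: mulr_ge0; exact: sqr_ge0.
      rewrite -!rintD; try by meas.
      all: try by move=> x; do ?[apply: addr_ge0|exact: sqr_ge0|exact: h2t|exact: hB].
      apply: le_rint; [by meas|by meas|by move=> x; apply: addr_ge0; [exact: sqr_ge0|exact: h2t]|move=> x].
      have gtb : (v x - gt x) ^+ 2 <= (v x - ((1 - t) * g x + t * f x)) ^+ 2.
        rewrite /gt; have [h|h] := leP ((1 - t) * g x + t * f x) (v x); first by [].
        by rewrite subrr expr0n /= sqr_ge0.
      have fg : (f x - g x) ^+ 2 <= (M + b) ^+ 2 * \1_Q x.
        rewrite indicE; have [/set_mem Qx|/negP Qx] := boolP (x \in Q).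
          rewrite mulr1 -real_normK ?num_real //; apply: lerXn2r; rewrite ?nnegrE ?addr_ge0 //.
          have /andP[? ?] := fM' x; have /andP[? ?] := gb x.
          by rewrite ler_norml; apply/andP; split; lra.
        have Qx' : ~ Q x by move=> h; apply: Qx; rewrite inE.
        have := fM x; rewrite indicE memNset // mulr0 => /andP[? ?].
        have := gv x; rewrite v_out // => /andP[? ?].
        have -> : f x = 0 by lra. 
        have -> : g x = 0 by lra.
        by rewrite subrr expr0n mulr0.
      have := ler_wpM2l (sqr_ge0 t) fg; move: gtb.
      move: ((v x - gt x) ^+ 2) => z; nra.
    rewrite -(fineK (Dfin Kgt)) -(fineK (Dfin Kg)) lee_fin => h2; move: h1.
    rewrite -(fineK (Dfin Kgt)) -(fineK (Dfin Kg)) -(fineK (Ibounded _ _ mf fM' M0)) -(fineK (Ibounded _ _ mg gb b0)).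
    rewrite -!EFinM -!EFinD lee_fin => h1.
    rewrite /= -(ler_pM2l (mulr_gt0 (ltr0Sn R 1) t0)); nra.
  rewrite -(fineK (Ibounded _ _ mf fM' M0)) -(fineK (Ibounded _ _ mg gb b0)) lee_fin.
  apply/ler_addgt0Pr => ep ep0.
  pose t := Num.min 1 (ep / (B + 1)).
  have t0 : 0 < t by rewrite lt_min ltr01 /= divr_gt0 //; lra.
  have t1 : t <= 1 by rewrite ge_min lexx.
  have te : t * (B + 1) <= ep by rewrite -ler_pdivlMr ?ge_min ?lexx ?orbT //; lra.
  apply: le_trans (key t t0 t1) _; rewrite lerD2l; nra.
move=> f Xf f0 nf; have mf := levi_measurable lX Xf.
(* A general [f] is reached through bounded functions on [Q], where the residual is supported. *)
pose fk (k : nat) x := Num.min (f x) k%:R * \1_Q x.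
have mfk k : measurable_fun setT (fk k) by rewrite /fk; meas.
have fk0 k x : 0 <= fk k x by rewrite mulr_ge0 // le_min f0 ler0n.
have hfk k : (\rint[mu]_x ((v x - g x) * fk k x) <= I g)%E.
  have [|Xk nk] := levi_ideal lX Xf (mfk k).
    apply: nearW => x; rewrite !ger0_norm //.
    apply: (@le_trans _ _ (Num.min (f x) k%:R)); last by rewrite ge_min lexx.
    by rewrite ler_piMr ?le_min ?f0 ?ler0n // indicE; case: (_ \in _).
  apply: (bounded _ k%:R) => //; last exact: le_trans nk nf.
  by move=> x; rewrite fk0 /= ler_wpM2r // ge_min lexx orbT.
have := Ibounded _ _ mg gb b0; rewrite -/(I g) => Ifin.
apply: (@rint_fatou _ _ _ mu (fun k x => (v x - g x) * fk k x)) => //.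
- by move=> k; have := mfk k => ?; meas.
- by meas.
- by move=> k x; rewrite mulr_ge0.
- apply: nearW => x; apply: cvg_near_cst; near=> k.
  rewrite /fk indicE; have [/set_mem Qx|/negP Qx] := boolP (x \in Q).
    rewrite mulr1 min_l //; apply: ltW; apply: lt_le_trans (archi_boundP (f0 x)) _.
    by rewrite ler_nat; near: k; exists (Num.bound (f x)).
  by rewrite hout ?mul0r // => h; apply: Qx; rewrite inE.
- by move=> x; rewrite mulr_ge0.
Unshelve. all: by end_near. Qed.

End projection.

(** Put $h=v-g$ with [g] from [projection_supports]. Over the ball of radius [K] the supremum of
    $\int hf$ is $c=\int hg$, so $h$ has associate norm at most $c/K$ and the hypothesis gives $\int
    vh\le c$. Hence $\int h^2\le0$, and [v] coincides a.e. with [g], which lies in the ball. *)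
Lemma lorentz_luxemburg_bounded X v (j : nat) (b K : R) : ball_banach X -> 0 <= b -> 0 < K ->
  measurable_fun setT v -> (forall x, 0 <= v x <= b * \1_(centered_cube R n j) x) ->
  (forall h, measurable_fun setT h -> (forall x, 0 <= h x) -> (associate_norm X h <= 1)%E ->
    (\rint[mu]_x (v x * h x) <= K%:E)%E) ->
  fnorm X v <= K.
Proof.
move=> bX b0 K0 mv vb vh; have lX := ball_banach_levi bX.
have [g [Xg gv ng] gsup] := projection_supports lX b0 K0 mv vb.
have mg := levi_measurable lX Xg.
have v0 x : 0 <= v x by have /andP[] := vb x.
have g0 x : 0 <= g x by have /andP[] := gv x.
have h0 x : 0 <= v x - g x by have /andP[] := gv x; rewrite subr_ge0.
have mQ : measurable (centered_cube R n j) by exact: measurable_cube.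
pose c := fine (\rint[mu]_x ((v x - g x) * g x)).
have cfin : (\rint[mu]_x ((v x - g x) * g x)) \is a fin_num.
  rewrite ge0_fin_numE; last by apply: rint_ge0 => x; rewrite mulr_ge0.
  apply: (@le_lt_trans _ _ (\rint[mu]_x (b ^+ 2 * \1_(centered_cube R n j) x))).
    apply: le_rint; [by meas|by meas|by move=> x; rewrite mulr_ge0|move=> x].
    have /andP[_ h1] := gv x; have /andP[_ h2] := vb x; have := h0 x; have := g0 x.
    move: h2; rewrite indicE; case: (_ \in _); rewrite ?mulr1 ?mulr0 ?expr2 /=; nra.
  rewrite rintZ ?sqr_ge0 // rint_indic // /centered_cube lebesgue_cube ?mulr_gt0 // -EFinM ltry.
  by [].
have c0 : 0 <= c by apply: fine_ge0; apply: rint_ge0 => x; rewrite mulr_ge0.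
have vhc e : 0 < e -> (\rint[mu]_x (v x * (v x - g x)) <= (c + K * e)%:E)%E.
  (* The slack [e] keeps [s] positive when [c] is 0. *)
  move=> e0; pose s := c / K + e.
  have s0 : 0 < s by rewrite ltr_wpDl // divr_ge0 // ltW.
  have sV0 : 0 < s^-1 by rewrite invr_gt0.
  have := vh (fun x => s^-1 * (v x - g x)).
  have -> : (fun x => v x * (s^-1 * (v x - g x))) = (fun x => s^-1 * (v x * (v x - g x))).
    by apply/funext => x; rewrite mulrCA.
  rewrite rintZ; [|by meas|by move=> x; rewrite mulr_ge0|exact: ltW].
  move=> H; have : (s^-1%:E * \rint[mu]_x (v x * (v x - g x)) <= K%:E)%E.
    apply: H; [by meas|by move=> x; rewrite mulr_ge0 // ltW|].
    apply: le_associate_norm => f Xf nf; have mf := levi_measurable lX Xf.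
    have [XKf nKf] := levi_scale lX K Xf; rewrite gtr0_norm // in nKf.
    have mKf := levi_measurable lX XKf.
    have [||Xf' nf'] := levi_ideal lX XKf (g := fun x => K * `|f x|); first by meas.
      by apply: nearW => x; rewrite !normrM normr_id.
    have := gsup _ Xf' (fun x => mulr_ge0 (ltW K0) (normr_ge0 _)) _.
    have nK : fnorm X (fun x => K * `|f x|) <= K.
      by apply: le_trans nf' _; apply: le_trans nKf _; rewrite ler_piMr // ltW.
    move=> /(_ nK); rewrite -[X in (_ <= X)%E -> _](fineK cfin) -/c => h1.
    have -> : (fun x => `|f x * (s^-1 * (v x - g x))|) =
        (fun x => (s * K)^-1 * ((v x - g x) * (K * `|f x|))).
      apply/funext => x; rewrite !normrM (gtr0_norm sV0) (ger0_norm (h0 x)); field.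
      by rewrite !gt_eqF.
    rewrite rintZ; [|by meas|by move=> x; rewrite !mulr_ge0 // ltW|by rewrite invr_ge0 mulr_ge0 // ltW].
    rewrite lee_pdivrMl ?mulr_gt0 // -EFinM mulr1; apply: le_trans h1 _; rewrite lee_fin.
    by rewrite /s mulrDl divfK ?gt_eqF // lerDl mulr_ge0 // ltW.
  rewrite lee_pdivrMl // -EFinM => /le_trans; apply; rewrite lee_fin /s mulrDl divfK ?gt_eqF //.
  by rewrite mulrC.
have hsq : \rint[mu]_x ((v x - g x) ^+ 2) = 0%E.
  apply/eqP; rewrite eq_le; apply/andP; split; last by apply: rint_ge0 => x; exact: sqr_ge0.
  have E : (\rint[mu]_x ((v x - g x) ^+ 2) + c%:E = \rint[mu]_x (v x * (v x - g x)))%E.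
    rewrite /c fineK // -rintD; [|by meas|by meas|by move=> x; exact: sqr_ge0|by move=> x; rewrite mulr_ge0].
    by congr (rint mu _); apply/funext => x; ring.
  have hle e : 0 < e -> (\rint[mu]_x ((v x - g x) ^+ 2) <= (K * e)%:E)%E.
    move=> /vhc; rewrite -E addeC EFinD; rewrite leeD2lE //.
  apply/lee_addgt0Pr => e e0; rewrite add0e.
  apply: le_trans (hle (e / K) _) _; first by rewrite divr_gt0.
  by rewrite mulrC divfK // gt_eqF.
have vg : {ae mu, forall x, v x = g x}.
  have := @rint_eq0 _ _ _ mu _ _ (fun x => sqr_ge0 (v x - g x)) hsq.
  have m2 : measurable_fun setT (fun x => (v x - g x) ^+ 2) by meas.
  by move=> /(_ m2); apply: filterS => x /eqP; rewrite sqrf_eq0 subr_eq0 => /eqP.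
apply: le_trans ng; apply: (levi_ideal lX Xg mv _).2.
by apply: filterS vg => x ->.
Qed.

Lemma lorentz_luxemburg X v (K : R) : ball_banach X -> 0 < K ->
  measurable_fun setT v -> (forall x, 0 <= v x) ->
  (forall h, measurable_fun setT h -> (forall x, 0 <= h x) -> (associate_norm X h <= 1)%E ->
    (\rint[mu]_x (v x * h x) <= K%:E)%E) ->
  X v /\ fnorm X v <= K.
Proof.
move=> bX K0 mv v0 vh; have lX := ball_banach_levi bX.
pose u (k : nat) x := Num.min (v x) k%:R * \1_(centered_cube R n k) x.
have mQ k : measurable (centered_cube R n k) by exact: measurable_cube.
have mu_ k : measurable_fun setT (u k) by have := mQ k => ?; rewrite /u; meas.
have min0 k x : 0 <= Num.min (v x) k%:R by rewrite le_min v0 ler0n.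
have u0 k x : 0 <= u k x by rewrite mulr_ge0.
have uv k x : u k x <= v x.
  apply: (@le_trans _ _ (Num.min (v x) k%:R)); last by rewrite ge_min lexx.
  by rewrite ler_piMr // indicE; case: (_ \in _).
have uk k x : 0 <= u k x <= k%:R * \1_(centered_cube R n k) x.
  by rewrite u0 /= ler_wpM2r // ge_min lexx orbT.
have Xu k : X (u k).
  have XQ : X (\1_(centered_cube R n k)) by apply: (levi_cube lX); rewrite mulr_gt0.
  apply: (levi_ideal lX (levi_scale lX k%:R XQ).1 (mu_ k) _).1; apply: nearW => x.
  by have /andP[? h] := uk k x; rewrite ger0_norm // (le_trans h) // ler_norm.
apply: (levi_fatou lX Xu u0 mv v0) => [|k].
  apply: nearW => x; have [k0 k0P] := centered_cube_cover x.
  apply: cvg_near_cst; near=> k.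
  rewrite /u indicE mem_set; last by apply: k0P; near: k; exists k0.
  rewrite mulr1 min_l //; apply: ltW; apply: lt_le_trans (archi_boundP (v0 x)) _.
  by rewrite ler_nat; near: k; exists (Num.bound (v x)).
apply: (lorentz_luxemburg_bounded bX (ler0n R k) K0 (mu_ k) (uk k)) => h mh h0 h1.
apply: le_trans (vh h mh h0 h1); have := mu_ k => ?.
apply: le_rint; [by meas|by meas|by move=> x; rewrite mulr_ge0|move=> x].
by rewrite ler_wpM2r.
Unshelve. all: by end_near. Qed.

End lorentz_luxemburg.

(** * Boundedness on X and X' implies the vector-valued inequality *)

Section weighted_extrapolation.
Variables (R : realType) (n : nat).
Implicit Types (X Z : fspace R n) (f g h v : Rn R n -> R).
Local Notation mu := (lebesgue_Rn R n).

Lemma maximal_bound_mono Z (C C' : R) : levi_space Z -> C <= C' ->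
  maximal_bound Z C -> maximal_bound Z C'.
Proof.
move=> lZ CC' ZC f Zf; apply: le_trans (ZC f Zf) _; rewrite lee_fin.
by rewrite ler_wpM2r //; exact: (levi_norm_ge0 lZ).
Qed.

(** Every term is bounded by the largest one; the index set will be the set of grids, so the loss
    depends on the dimension and [q] only. *)
Lemma powR_sum_le (I : finType) (y : I -> R) (q : R) : 0 < q -> (forall i, 0 <= y i) ->
  (\sum_i y i) `^ q <= #|I|%:R `^ q * \sum_i y i `^ q.
Proof.
move=> q0 y0; have s0 : 0 <= \sum_i y i `^ q by apply: sumr_ge0 => i _; exact: powR_ge0.
have [E|E] := eqVneq (enum I) [::].
  rewrite [X in X `^ _]big1; last by move=> i _; have := mem_enum I i; rewrite E.
  by rewrite powR0 ?gt_eqF // mulr_ge0 // powR_ge0.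
have [i _ imax] := seq_max_real y E.
apply: (@le_trans _ _ ((#|I|%:R * y i) `^ q)).
  apply: ge0_ler_powR; rewrite ?nnegrE ?sumr_ge0 ?mulr_ge0 ?(ltW q0) //.
  rewrite mulr_natl -sumr_const; apply: ler_sum => j _; apply: imax.
  by rewrite mem_enum.
rewrite powRM // ler_wpM2l ?powR_ge0 // (bigD1 i) //= lerDl.
by apply: sumr_ge0 => j _; exact: powR_ge0.
Qed.

Lemma powR_anti (x y r : R) : 0 < x -> x <= y -> 0 <= r -> y `^ (- r) <= x `^ (- r).
Proof.
move=> x0 xy r0; rewrite !powRN lef_pV2 ?posrE ?powR_gt0 //; last exact: lt_le_trans xy.
by apply: ge0_ler_powR; rewrite ?nnegrE // ltW // (lt_le_trans x0).
Qed.

(** Negative powers are taken at every point, so an a.e. positive function is corrected on the null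
    set where it is not positive. *)
Lemma positive_representative f : measurable_fun setT f -> {ae mu, forall x, 0 < f x} ->
  exists g, [/\ measurable_fun setT g, forall x, 0 < g x & {ae mu, forall x, f x = g x}].
Proof.
move=> mf fpos.
have mE : measurable [set x | f x <= 0].
  rewrite (_ : [set x | _] = setT `&` f @^-1` `]-oo, 0]%classic).
    exact: mf.
  by rewrite setTI; apply/seteqP; split=> x /=; rewrite in_itv.
exists (fun x => Num.max (f x) 0 + \1_[set x | f x <= 0] x); split.
- by meas.
- move=> x; rewrite indicE; have [f0|f0] := leP (f x) 0.
    by rewrite mem_set // add0r.
  by rewrite memNset ?addr0 // => /=; rewrite leNgt f0.
- apply: filterS fpos => x f0; rewrite max_l ?(ltW f0) // indicE memNset ?addr0 //=.
  by rewrite leNgt f0.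
Qed.

(* The easy half of the factorization of A_q weights. *)
Lemma factored_weight (q a1 a2 : R) (G H : Rn R n -> R) c l : 1 < q -> 0 < l ->
  0 < a1 -> 0 < a2 -> measurable_fun setT G -> measurable_fun setT H ->
  (forall x, 0 < G x) -> (forall x, 0 < H x) ->
  {ae mu, forall x, (maximal G x <= (a1 * G x)%:E)%E} ->
  {ae mu, forall x, (maximal H x <= (a2 * H x)%:E)%E} ->
  (\rint[mu]_x (G x * \1_(cube c l) x) < +oo)%E ->
  (\rint[mu]_x (H x * \1_(cube c l) x) < +oo)%E ->
  let w x := H x * G x `^ (- (q - 1)) in
  let I f := \rint[mu]_x (f x * \1_(cube c l) x) in
  [/\ (I w < +oo)%E, (I (fun x => (w x `^ (- (q - 1)^-1))%R) < +oo)%E &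
    fine (I w) * fine (I (fun x => w x `^ (- (q - 1)^-1))) `^ (q - 1) <=
      (a1 `^ (q - 1) * a2) * fine (mu (cube c l)) `^ q].
Proof.
move=> q1 l0 a10 a20 mG mH G0 H0 MG MH Gfin Hfin w I.
have q10 : 0 < q - 1 by lra.
pose r := (q - 1)^-1; have r0 : 0 < r by rewrite invr_gt0.
have rq : r * (q - 1) = 1 by rewrite mulVf // gt_eqF.
have mQ := measurable_cube c l; set Q := cube c l in mQ Gfin Hfin I *.
have muQ : mu Q = (l ^+ n)%:E by exact: lebesgue_cube.
pose D := l ^+ n; have D0 : 0 < D by rewrite exprn_gt0.
have G_ge0 x : 0 <= G x by exact: ltW.
have H_ge0 x : 0 <= H x by exact: ltW.
have avg f : measurable_fun setT f -> (forall x, 0 < f x) -> (I f < +oo)%E ->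
    exists2 t, 0 < t & I f = (t * D)%:E.
  move=> mf f0 ffin; have : (0 < I f)%E.
    by apply: rint_gt0 => //; [move=> x; exact: ltW|rewrite muQ lte_fin].
  case: (I f) ffin => [s| |] // _; rewrite lte_fin => s0.
  by exists (s / D); [rewrite divr_gt0|rewrite divfK // gt_eqF].
(* The $A_1$ condition read backwards: on [Q] the function is a.e. at least its average over its
   constant, so its negative powers are bounded there. *)
have avgle f t a : (forall x, 0 < f x) -> 0 < a -> I f = (t * D)%:E ->
    {ae mu, forall x, (maximal f x <= (a * f x)%:E)%E} -> {ae mu, forall x, Q x -> t / a <= f x}.
  move=> f0 a0 If; apply: filterS => x fx Qx; rewrite ler_pdivrMr // mulrC -lee_fin.
  apply: le_trans fx; apply: le_trans (maximal_ge f l0 Qx).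
  rewrite /cube_average (_ : (fun x => _) = (fun x => f x * \1_Q x)); last first.
    by apply/funext => y; rewrite gtr0_norm.
  by rewrite -/(I f) If -EFinM mulrC mulfK // gt_eqF.
have [g g0 Ig] := avg G mG G0 Gfin.
have [h h0 Ih] := avg H mH H0 Hfin.
have Gg := avgle G g a1 G0 a10 Ig MG.
have Hh := avgle H h a2 H0 a20 Ih MH.
have ga0 : 0 < g / a1 by rewrite divr_gt0.
have ha0 : 0 < h / a2 by rewrite divr_gt0.
have mw : measurable_fun setT w by rewrite /w; meas.
have w0 x : 0 < w x by rewrite mulr_gt0 // powR_gt0.
have sE x : w x `^ (- r) = H x `^ (- r) * G x.
  rewrite /w powRM ?powR_ge0 // -powRrM mulrNN; congr (_ * _).
  by rewrite mulrC rq powRr1.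
have Iw : (I w <= ((g / a1) `^ (- (q - 1)) * (h * D))%:E)%E.
  rewrite EFinM -Ih /I -rintZ; [|by meas|by move=> x; rewrite mulr_ge0|exact: powR_ge0].
  apply: ae_le_rint; [by meas|by meas|by move=> x; rewrite mulr_ge0 // ltW|
    by move=> x; rewrite mulr_ge0 ?powR_ge0 // mulr_ge0|].
  apply: filterS Gg => x Gx; rewrite indicE.
  have [/set_mem Qx|_] := boolP (x \in Q); last by rewrite !mulr0.
  rewrite !mulr1 /w mulrC ler_wpM2r //; apply: powR_anti => //; [exact: Gx|exact: ltW].
have Is : (I (fun x => (w x `^ (- r))%R) <= ((h / a2) `^ (- r) * (g * D))%:E)%E.
  rewrite EFinM -Ig /I -rintZ; [|by meas|by move=> x; rewrite mulr_ge0|exact: powR_ge0].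
  apply: ae_le_rint; [by meas|by meas|by move=> x; rewrite mulr_ge0 ?powR_ge0|
    by move=> x; rewrite mulr_ge0 ?powR_ge0 // mulr_ge0|].
  apply: filterS Hh => x Hx; rewrite indicE.
  have [/set_mem Qx|_] := boolP (x \in Q); last by rewrite !mulr0.
  rewrite !mulr1 sE ler_wpM2r //; apply: powR_anti => //; [exact: Hx|exact: ltW].
have Iw0 : (0 <= I w)%E by apply: rint_ge0 => x; rewrite mulr_ge0 // ltW.
have Is0 : (0 <= I (fun x => (w x `^ (- r))%R))%E by apply: rint_ge0 => x; rewrite mulr_ge0 ?powR_ge0.
have Iwfin := le_lt_trans Iw (ltry _); have Isfin := le_lt_trans Is (ltry _).
split => //; rewrite muQ /= -/D -/r.
have W1 : fine (I w) <= (g / a1) `^ (- (q - 1)) * (h * D) by rewrite -lee_fin fineK // ge0_fin_numE.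
have S1 : fine (I (fun x => w x `^ (- r))) <= (h / a2) `^ (- r) * (g * D) by rewrite -lee_fin fineK // ge0_fin_numE.
have S2 : fine (I (fun x => w x `^ (- r))) `^ (q - 1) <= ((h / a2) `^ (- r) * (g * D)) `^ (q - 1).
  by apply: ge0_ler_powR; rewrite ?nnegrE ?fine_ge0 ?mulr_ge0 ?powR_ge0 // ltW.
apply: (le_trans (ler_pM _ _ W1 S2)); rewrite ?fine_ge0 ?powR_ge0 //.
rewrite powRM ?powR_ge0 ?mulr_ge0 ?(ltW g0) ?(ltW D0) // -powRrM mulNr rq.
rewrite powRN powR_inv1 ?divr_ge0 ?(ltW h0) ?(ltW a20) //.
have Dq : D `^ q = D * D `^ (q - 1) by rewrite mulr_powRB1 ?(ltW D0) //; lra.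
rewrite Dq (powRM _ (ltW g0) (ltW D0)).
have -> : a1 `^ (q - 1) = g `^ (q - 1) * ((g / a1) `^ (q - 1))^-1.
  rewrite powRM ?invr_ge0 ?(ltW g0) ?(ltW a10) // -[a1^-1]powR_inv1 ?(ltW a10) // -powRrM mulN1r powRN.
  rewrite invfM invrK mulrA mulfV ?mul1r // gt_eqF // powR_gt0 //.
rewrite le_eqVlt; apply/orP; left; apply/eqP; field.
by rewrite !gt_eqF // powR_gt0.
Qed.

End weighted_extrapolation.

(** * Truncated maximal functions and A_1 majorants *)

Section extrapolation.
Variables (R : realType) (n : nat).
Hypothesis n_gt0 : (0 < n)%N.
Implicit Types (X Z : fspace R n) (f g h v : Rn R n -> R).
Local Notation mu := (lebesgue_Rn R n).

(** Involves finitely many cubes, so [dyadic_families] applies to it; it increases to [maximal f]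
    with [L]. *)
Definition truncated_maximal f (L : nat) (x : Rn R n) : \bar R :=
  (\big[maxe/0]_(k < L) ((\1_(qcube R n k) x)%:E *
    cube_average f (rational_cube R n k).1 (rational_cube R n k).2))%E.

Lemma truncated_maximal_ge0 f L x : (0 <= truncated_maximal f L x)%E.
Proof. exact: bigmax_ge_id. Qed.

Lemma truncated_maximal_mono f L x :
  (truncated_maximal f L x <= truncated_maximal f L.+1 x)%E.
Proof.
apply/bigmax_leP; split; first exact: truncated_maximal_ge0.
by move=> k _; rewrite /truncated_maximal (bigmax_sup (widen_ord (leqnSn L) k)).
Qed.

Lemma measurable_truncated_maximal f L : measurable_fun setT (truncated_maximal f L).
Proof.
rewrite /truncated_maximal; elim: (index_enum _) => [|k s IH].
  by rewrite (_ : (fun x => _) = cst 0%E) //; apply/funext => x; rewrite big_nil.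
set F := (fun x => _).
rewrite (_ : F = fun x => maxe ((\1_(qcube R n k) x)%:E *
    cube_average f (rational_cube R n k).1 (rational_cube R n k).2)%E
   (\big[maxe/0%E]_(k <- s) ((\1_(qcube R n k) x)%:E *
    cube_average f (rational_cube R n k).1 (rational_cube R n k).2)%E)).
  apply: measurable_maxe => //; apply: emeasurable_funM => //.
  by have := measurable_cube (rational_cube R n k).1 (rational_cube R n k).2 => ?; meas.
by apply/funext => x; rewrite /F big_cons.
Qed.

Lemma maximal_truncated f x : measurable_fun setT f ->
  maximal f x = ereal_sup (range (truncated_maximal f ^~ x)).
Proof.
move=> mf; apply/eqP; rewrite eq_le; apply/andP; split.
  rewrite maximal_qcube //; apply: ge_ereal_sup => _ [k _ <-].
  apply: le_trans (ereal_sup_ubound _); last by exists k.+1.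
  by rewrite /truncated_maximal (bigmax_sup ord_max).
apply: ge_ereal_sup => _ [L _ <-]; apply/bigmax_leP; split; first exact: maximal_ge0.
move=> k _; rewrite maximal_qcube //; apply: ereal_sup_ubound; by exists (k : nat).
Qed.

Lemma truncated_maximal_cvg f x : measurable_fun setT f ->
  truncated_maximal f L x @[L --> \oo] --> maximal f x.
Proof.
move=> mf; rewrite maximal_truncated //; apply: ereal_nondecreasing_cvgn.
by apply/nondecreasing_seqP => k; exact: truncated_maximal_mono.
Qed.

Lemma lq_sum_truncated N q (f : 'I_N -> Rn R n -> R) x : 0 < q ->
  (forall j, measurable_fun setT (f j)) ->
  lq_sum q (fun j => maximal (f j)) x =
  ereal_sup (range (fun L => lq_sum q (fun j => truncated_maximal (f j) L) x)).
Proof.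
move=> q0 mf; set S := ereal_sup _.
have SL L : (lq_sum q (fun j => truncated_maximal (f j) L) x <= S)%E.
  by apply: ereal_sup_ubound; exists L.
have S0 : (0 <= S)%E by apply: le_trans (SL 0%N); exact: lq_sum_ge0.
have tM j L : (truncated_maximal (f j) L x <= maximal (f j) x)%E.
  have nd : {homo (fun L => truncated_maximal (f j) L x) : m k / (m <= k)%N >-> (m <= k)%E}.
    by apply/nondecreasing_seqP => k; exact: truncated_maximal_mono.
  have c := @truncated_maximal_cvg (f j) x (mf j).
  rewrite -(cvg_lim _ c) // (cvg_lim _ (ereal_nondecreasing_cvgn nd)) //.
  by apply: ereal_sup_ubound; exists L.
apply/eqP; rewrite eq_le; apply/andP; split; last first.
  apply: ge_ereal_sup => _ [L _ <-]; apply: le_lq_sum => // j; exact: truncated_maximal_ge0.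
rewrite -(poweR_cancel S0 q0); apply: ge0_le_poweR; last by rewrite invr_ge0 ltW.
  by apply: sume_ge0 => j _; exact: poweR_ge0.
have c j : (truncated_maximal (f j) L x `^ q)%E @[L --> \oo] --> (maximal (f j) x `^ q)%E.
  have nd : {homo (fun L => truncated_maximal (f j) L x `^ q)%E : m k / (m <= k)%N >-> (m <= k)%E}.
    apply/nondecreasing_seqP => k; apply: ge0_le_poweR; [exact: truncated_maximal_ge0|exact: truncated_maximal_mono|exact: ltW].
  rewrite (_ : (maximal (f j) x `^ q)%E = ereal_sup (range (fun L => truncated_maximal (f j) L x `^ q)%E)).
    exact: ereal_nondecreasing_cvgn.
  set S' := ereal_sup _.
  have S'L L : (truncated_maximal (f j) L x `^ q <= S')%E by apply: ereal_sup_ubound; exists L.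
  have S'0 : (0 <= S')%E by apply: le_trans (S'L 0%N); exact: poweR_ge0.
  apply/eqP; rewrite eq_le; apply/andP; split; last first.
    by apply: ge_ereal_sup => _ [L _ <-]; apply: ge0_le_poweR; [exact: truncated_maximal_ge0|exact: tM|exact: ltW].
  rewrite -(poweR_cancelV S'0 q0); apply: ge0_le_poweR; [exact: maximal_ge0| |exact: ltW].
  have cj := @truncated_maximal_cvg (f j) x (mf j); rewrite -(cvg_lim _ cj) //.
  apply: lime_le; first by apply/cvg_ex; eexists; exact: cj.
  apply: nearW => L; rewrite -(poweR_cancel (truncated_maximal_ge0 (f j) L x) q0).
  by apply: ge0_le_poweR => //; [exact: poweR_ge0|rewrite invr_ge0 ltW].
have cs : (\sum_(j < N) truncated_maximal (f j) L x `^ q)%E @[L --> \oo] -->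
    (\sum_(j < N) maximal (f j) x `^ q)%E.
  by apply: cvg_nnesum => [j _|j _]; [apply: nearW => L; exact: poweR_ge0|exact: c].
rewrite -(cvg_lim _ cs) //; apply: lime_le; first by apply/cvg_ex; eexists; exact: cs.
apply: nearW => L.
rewrite -(@poweR_cancelV R (\sum_(j < N) truncated_maximal (f j) L x `^ q)%E q) //; last first.
  by apply: sume_ge0 => j _; exact: poweR_ge0.
by apply: ge0_le_poweR; [exact: poweR_ge0|exact: SL|exact: ltW].
Qed.

(** Each rational cube is replaced by a dyadic one of at most [6 ^+ n] times its volume, and the
    maximum over the grids is majorized by the sum. *)
Lemma truncated_maximal_dyadic f L : measurable_fun setT f ->
  forall S : {ffun 'I_n -> bool} -> seq (set (Rn R n)),
  (forall k, (k < L)%N -> exists al c l, [/\ 0 < l, cube c l \in S al,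
      qcube R n k `<=` cube c l & l ^+ n <= 6 ^+ n * (rational_cube R n k).2 ^+ n]) ->
  forall m : {ffun 'I_n -> bool} -> Rn R n -> R, (forall al x, 0 <= m al x) ->
  (forall al c l x, 0 < l -> cube c l \in S al -> cube c l x ->
    (cube_average f c l <= (m al x)%:E)%E) ->
  forall x, (truncated_maximal f L x <= (6 ^+ n * \sum_al m al x)%:E)%E.
Proof.
move=> mf S SP m m0 mS x; apply/bigmax_leP; split.
  by rewrite lee_fin mulr_ge0 ?exprn_ge0 // sumr_ge0.
move=> k _; rewrite indicE; have [/set_mem xk|_] := boolP (x \in qcube R n k); last first.
  by rewrite mul0e lee_fin mulr_ge0 ?exprn_ge0 // sumr_ge0.
rewrite mul1e; have [al [c [l [l0 cS kc lk]]]] := SP k (ltn_ord k).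
apply: le_trans (cube_average_expand mf (qcube_side R n k) l0 kc lk _) _; first exact: exprn_ge0.
rewrite EFinM; apply: lee_wpmul2l; first by rewrite lee_fin exprn_ge0.
apply: le_trans (mS al c l x l0 cS (kc _ xk)) _.
by rewrite lee_fin (bigD1 al) //= lerDl sumr_ge0.
Qed.

(** As [G] has mass in some cube, its maximal function is positive everywhere: a large centered cube
    contains both that cube and the point. *)
Lemma A1_positive (a : R) (G f : Rn R n -> R) (c : Rn R n) (l : R) : measurable_fun setT G -> (forall x, 0 <= G x) ->
  {ae mu, forall x, (maximal G x <= (a * G x)%:E)%E} -> 0 < a ->
  measurable_fun setT f -> (forall x, 0 <= f x) -> (forall x, cube c l x -> 0 < f x) -> 0 < l ->
  {ae mu, forall x, f x <= G x} -> {ae mu, forall x, 0 < G x}.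
Proof.
move=> mG G0 MG a0 mf f0 fpos l0 fG; apply: filterS MG => x Mx.
have mc := measurable_cube c l.
have [k1 ck1] := cube_sub_centered c l; have [k2 xk2] := centered_cube_cover x.
pose k := maxn k1 k2.
have xk : centered_cube R n k x by apply: xk2; exact: leq_maxr.
have ck : cube c l `<=` centered_cube R n k.
  by apply: subset_trans ck1 _; apply: centered_cube_mono; exact: leq_maxl.
have mk : measurable (centered_cube R n k) by exact: measurable_cube.
have k20 : 0 < 2 * k.+1%:R :> R by rewrite mulr_gt0.
have : (0 < \rint[mu]_y (f y * \1_(cube c l) y))%E.
  by apply: rint_gt0 => //; rewrite lebesgue_cube // lte_fin exprn_gt0.
have h : (\rint[mu]_y (f y * \1_(cube c l) y) <= \rint[mu]_y (`|G y| * \1_(centered_cube R n k) y))%E.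
  apply: ae_le_rint; [by meas|by meas|by move=> y; rewrite mulr_ge0|by move=> y; rewrite mulr_ge0|].
  apply: filterS fG => y fGy; rewrite !indicE.
  have [/set_mem yc|_] := boolP (y \in cube c l); last by rewrite mulr0 mulr_ge0.
  by rewrite (mem_set (ck _ yc)) !mulr1 (le_trans fGy) // ler_norm.
move=> /lt_le_trans /(_ h) h2.
have : (0 < maximal G x)%E.
  apply: lt_le_trans (maximal_ge G k20 xk); apply: mule_gt0 => //.
by move=> /lt_le_trans /(_ Mx); rewrite lte_fin pmulr_rgt0.
Qed.

(** Adding to [f] a small multiple of the indicator of a unit cube makes the majorant positive, as
    its negative powers require; [e] is the cost in norm. *)
Lemma A1_weight Z (A : R) (f : Rn R n -> R) (e : R) : levi_space Z -> 0 < A -> maximal_bound Z A ->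
  Z f -> (forall x, 0 <= f x) -> 0 < e ->
  exists G, [/\ Z G, forall x, 0 < G x, {ae mu, forall x, f x <= G x},
    {ae mu, forall x, (maximal G x <= (2 * A * G x)%:E)%E} & fnorm Z G <= 2 * (fnorm Z f + e)].
Proof.
move=> lZ A0 MA Zf f0 e0; have [mZ iZ] := (levi_measurable lZ, levi_ideal lZ).
pose o : Rn R n := [tuple 0 : measurableTypeR R | i < n].
have Z1 := levi_cube lZ o ltr01; have n1 := levi_norm_ge0 lZ Z1.
set s := fnorm Z (\1_(cube o 1)) in n1.
pose d := e / (s + 1); have d0 : 0 < d by rewrite divr_gt0 //; lra.
have [Z2 n2] := levi_scale lZ d Z1; have [Z3 n3] := levi_add lZ Zf Z2.
pose f1 x := f x + d * \1_(cube o 1) x.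
have f10 x : 0 <= f1 x by rewrite addr_ge0 // mulr_ge0 // ltW.
have nf1 : fnorm Z f1 <= fnorm Z f + e.
  apply: le_trans n3 _; rewrite lerD2l; apply: le_trans n2 _; rewrite gtr0_norm // -/s.
  by rewrite /d mulrAC ler_pdivrMr ?ler_pM2l //; lra.
have [G [ZG G0 fG MG nG]] := rubio_de_francia lZ A0 MA Z3 f10.
have mG := mZ _ ZG; have mf1 := mZ _ Z3.
have Gpos : {ae mu, forall x, 0 < G x}.
  apply: (A1_positive mG G0 MG _ mf1 f10 (c := o) (l := 1)) => //; first by rewrite mulr_gt0.
  by move=> x xo; rewrite indicE mem_set // mulr1 ltr_wpDl.
have [G' [mG' G'0 GG']] := positive_representative mG Gpos.
have [|ZG' nG'] := iZ G G' ZG mG'; first by apply: filterS GG' => x ->.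
exists G'; split => //.
- apply: filterS2 fG GG' => x h <-; apply: le_trans h.
  by rewrite lerDl mulr_ge0 // ltW.
- have -> : maximal G' = maximal G by apply: ae_eq_maximal => //; apply: filterS GG' => x ->.
  by apply: filterS2 MG GG' => x h <-.
- by apply: le_trans nG' _; apply: le_trans nG _; rewrite ler_pM2l.
Qed.

Lemma fs_of_maximal X (q : R) : ball_banach X -> 1 < q ->
  maximal_bounded X -> maximal_bounded (associate X) ->
  exists C : R, 0 < C /\ fs_finite_rhs X q C.
Proof.
move=> bX q1 [A1' MA1'] [A2' MA2'].
have lX := ball_banach_levi bX; have lA := associate_levi bX.
have [mX iX] := (levi_measurable lX, levi_ideal lX).
(* The given bounds may fail to be positive, which the algorithm requires. *)
pose A1 := Num.max A1' 1; pose A2 := Num.max A2' 1.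
have A10 : 0 < A1 by rewrite lt_max ltr01 orbT.
have A20 : 0 < A2 by rewrite lt_max ltr01 orbT.
have MA1 : maximal_bound X A1 by apply: maximal_bound_mono MA1' => //; rewrite le_max lexx.
have MA2 : maximal_bound (associate X) A2 by apply: maximal_bound_mono MA2' => //; rewrite le_max lexx.
have q0 : 0 < q by lra.
have q10 : 0 < q - 1 by lra.
pose a1 := 2 * A1; pose a2 := 2 * A2.
have a10 : 0 < a1 by rewrite mulr_gt0.
have a20 : 0 < a2 by rewrite mulr_gt0.
pose K := a1 `^ (q - 1) * a2; have K0 : 0 < K by rewrite mulr_gt0 // powR_gt0.
have [Cm Cm0 muck] := laminar_muckenhoupt mu q1 K0.
pose T := {ffun 'I_n -> bool}.
(* The loss from passing to dyadic cubes and from summing over the grids inside a [q]-th power. *)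
pose c1 : R := (6 ^+ n) `^ q * #|T|%:R `^ q.
have c10 : 0 <= c1 by rewrite mulr_ge0 // powR_ge0.
pose c2 := c1 * #|T|%:R * Cm.
have c20 : 0 <= c2 by rewrite !mulr_ge0 // ltW.
(* The norm of [G] is at most twice that of [F], up to the slack, and the norm of [H] is at most 4,
   whence 8. *)
pose Cb := 8 * (c2 + 1); have Cb0 : 0 < Cb by rewrite mulr_gt0 // ltr_wpDl.
exists Cb; split => // N f N0 mf rhs; rewrite /fs_inequality.
have [F0 XF0 F0E] := enorm_fin rhs; have mF0 := mX _ XF0.
pose F x := `|F0 x|.
have mF : measurable_fun setT F by rewrite /F; meas.
have FE : {ae mu, forall x, lq_sum q (fun j => abs_e (f j)) x = (F x)%:E}.
  apply: filterS F0E => x e; rewrite e /F ger0_norm // -lee_fin -e; exact: lq_sum_ge0.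
have [|XF nF] := iX F0 F XF0 mF; first by apply: nearW => x; rewrite normr_id.
rewrite (enorm_rep iX mX XF FE) -EFinM.
have Fq : {ae mu, forall x, \sum_(j < N) `|f j x| `^ q = F x `^ q}.
  apply: filterS FE => x e; apply: EFin_inj; rewrite -poweR_EFin -e /lq_sum poweR_cancelV //; last first.
    by apply: sume_ge0 => j _; exact: poweR_ge0.
  by rewrite -sumEFin; apply: eq_bigr => j _; rewrite /abs_e poweR_EFin.
have F_ge0 x : 0 <= F x by exact: normr_ge0.
have Xf j : X (f j).
  apply: (iX _ _ XF (mf j) _).1; apply: filterS Fq => x e.
  rewrite [leRHS]ger0_norm //.
  have h : `|f j x| `^ q <= F x `^ q.
    by rewrite -e (bigD1 j) //= lerDl sumr_ge0 // => i _; exact: powR_ge0.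
  rewrite -(powRr1 (normr_ge0 (f j x))) -(powRr1 (F_ge0 x)) -(mulfV (lt0r_neq0 q0)) !powRrM.
  by apply: ge0_ler_powR; rewrite ?nnegrE ?powR_ge0 ?invr_ge0 // ltW.
have fQ j c l : 0 < l -> (\rint[mu]_x (`|f j x| * \1_(cube c l) x) < +oo)%E.
  move=> l0; have [C C0 CP] := levi_local lX c l0.
  by apply: le_lt_trans (CP _ (Xf j)) (ltry _).
rewrite (_ : lq_sum q (fun j => maximal (f j)) = fun x =>
    ereal_sup (range (fun L => lq_sum q (fun j => truncated_maximal (f j) L) x))); last first.
  by apply/funext => x; exact: lq_sum_truncated.
apply: levi_enorm => //.
- by move=> L; apply: measurable_lq_sum => j; exact: measurable_truncated_maximal.
- by move=> L x; exact: lq_sum_ge0.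
- move=> L x; apply: le_lq_sum => // j; [exact: truncated_maximal_ge0|exact: truncated_maximal_mono].
move=> L.
have [S [lS cS SP]] := @dyadic_families R n L.
have mS al Q : Q \in S al -> measurable Q by move=> /cS [c [l [_ ->]]]; exact: measurable_cube.
have tfin j x : truncated_maximal (f j) L x \is a fin_num.
  rewrite ge0_fin_numE ?truncated_maximal_ge0 //; apply: bigmax_lt => // k _.
  apply: lte_mul_pinfty; rewrite ?lee_fin //.
  apply: lte_mul_pinfty; rewrite ?lee_fin ?invr_ge0 ?exprn_ge0 ?(ltW (qcube_side R n k)) //.
  by apply: fQ; exact: qcube_side.
pose M j x := fine (truncated_maximal (f j) L x).
have ME j x : truncated_maximal (f j) L x = (M j x)%:E by rewrite fineK.
have M0 j x : 0 <= M j x by rewrite fine_ge0 // truncated_maximal_ge0.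
have mM j : measurable_fun setT (M j).
  by apply: measurableT_comp; [exact: fine_measurable|exact: measurable_truncated_maximal].
pose V x := (\sum_(j < N) M j x `^ q) `^ q^-1.
have sumM0 x : 0 <= \sum_(j < N) M j x `^ q by apply: sumr_ge0 => j _; exact: powR_ge0.
have VE x : lq_sum q (fun j => truncated_maximal (f j) L) x = (V x)%:E.
  rewrite /lq_sum (eq_bigr (fun j => (M j x `^ q)%:E)) => [|j _]; last by rewrite ME poweR_EFin.
  by rewrite sumEFin poweR_EFin.
have mV : measurable_fun setT V.
  apply: (measurableT_comp (@measurable_powR R q^-1)); apply: measurable_sum => j.
  by have := mM j => ?; meas.
have V0 x : 0 <= V x by exact: powR_ge0.
have Vq x : V x `^ q = \sum_(j < N) M j x `^ q.
  by rewrite /V -powRrM mulVf ?powRr1 // gt_eqF.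
suff [XV nV] : X V /\ fnorm X V <= Cb * fnorm X F.
  by rewrite (enorm_rep iX mX XV) ?lee_fin //; exact: nearW.
(* The slack [e] pays for the perturbation made in [A1_weight]. *)
suff H e : 0 < e -> X V /\ fnorm X V <= Cb * (fnorm X F + e).
  split; first exact: (H 1 ltr01).1.
  apply/ler_addgt0Pr => e e0; apply: le_trans (H (e / Cb) _).2 _; first by rewrite divr_gt0.
  by rewrite mulrDr lerD2l mulrC divfK // gt_eqF.
move=> e0; have nF0 := levi_norm_ge0 lX XF.
apply: (lorentz_luxemburg bX _ mV V0); first by rewrite mulr_gt0 // ltr_wpDl.
move=> h mh h0 h1.
have Ah : associate X h by split => //; apply: le_lt_trans h1 (ltry _).
have nh : fnorm (associate X) h <= 1.
  by rewrite /= -lee_fin fineK // ge0_fin_numE ?associate_norm_ge0 //; exact: le_lt_trans h1 (ltry _).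
have [G [XG G0 FG MG nG]] := A1_weight lX A10 MA1 XF F_ge0 e0.
have [H [AH H0 hH MH nH]] := A1_weight lA A20 MA2 Ah h0 ltr01.
have mG := mX _ XG; have mH := levi_measurable lA AH.
have G_ge0 x : 0 <= G x by exact: ltW.
have H_ge0 x : 0 <= H x by exact: ltW.
have Gfin c l : 0 < l -> (\rint[mu]_x (G x * \1_(cube c l) x) < +oo)%E.
  move=> l0; have [C C0 CP] := levi_local lX c l0; apply: le_lt_trans (ltry (C * fnorm X G)).
  apply: le_trans (CP _ XG); rewrite le_eqVlt; apply/orP; left; apply/eqP.
  by congr (rint mu _); apply/funext => x; rewrite gtr0_norm.
have Hfin c l : 0 < l -> (\rint[mu]_x (H x * \1_(cube c l) x) < +oo)%E.
  move=> l0; have [C C0 CP] := levi_local lA c l0.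
  apply: le_lt_trans (ltry (C * fnorm (associate X) H)).
  apply: le_trans (CP _ AH); rewrite le_eqVlt; apply/orP; left; apply/eqP.
  by congr (rint mu _); apply/funext => x; rewrite gtr0_norm.
pose w x := H x * G x `^ (- (q - 1)).
have w0 x : 0 < w x by rewrite mulr_gt0 // powR_gt0.
have w_ge0 x : 0 <= w x by exact: ltW.
have mw : measurable_fun setT w by rewrite /w; meas.
have wQ c l (l0 : 0 < l) := factored_weight q1 l0 a10 a20 mG mH G0 H0 MG MH (Gfin c l l0) (Hfin c l l0).
have ex (p : 'I_N * T) : exists m : Rn R n -> R, [/\ measurable_fun setT m, forall x, 0 <= m x,
    forall Q x, Q \in S p.2 -> Q x -> (\rint[mu]_x (`|f p.1 x| * \1_Q x) <= (m x)%:E * mu Q)%E &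
    (\rint[mu]_x (m x `^ q * w x) <= Cm%:E * \rint[mu]_x (`|f p.1 x| `^ q * w x))%E].
  have mfp := mf p.1.
  apply: muck => //.
  - exact: mS.
  - by move=> Q /cS [c [l [l0 ->]]]; rewrite lebesgue_cube // lte_fin exprn_gt0 // ltry.
  - by meas.
  - by move=> Q /cS [c [l [l0 ->]]]; exact: fQ.
  - by move=> Q /cS [c [l [l0 ->]]]; have [] := wQ c l l0.
  - by move=> Q /cS [c [l [l0 ->]]]; have [] := wQ c l l0.
  - by move=> Q /cS [c [l [l0 ->]]]; have [] := wQ c l l0.
have /choice[m mP] := ex.
have mm p : measurable_fun setT (m p) by have [] := mP p.
have m0 p x : 0 <= m p x by have [_ +] := mP p.
have Mm j x : M j x <= 6 ^+ n * \sum_(al : T) m (j, al) x.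
  rewrite -lee_fin -ME; apply: (@truncated_maximal_dyadic (f j) L (mf j) S SP (fun al => m (j, al))) => //.
  move=> al c l y l0 cSal cy; have [_ _ mS' _] := mP (j, al).
  have := mS' _ _ cSal cy; rewrite lebesgue_cube // /cube_average => mS''.
  by rewrite lee_pdivrMl ?exprn_gt0 // muleC.
have Vqle x : V x `^ q <= c1 * \sum_(j < N) \sum_(al : T) m (j, al) x `^ q.
  rewrite Vq mulr_sumr; apply: ler_sum => j _; rewrite /c1 -mulrA.
  apply: (@le_trans _ _ ((6 ^+ n * \sum_(al : T) m (j, al) x) `^ q)).
    by apply: ge0_ler_powR; rewrite ?nnegrE ?mulr_ge0 ?exprn_ge0 ?sumr_ge0 ?(ltW q0).
  rewrite powRM ?exprn_ge0 ?sumr_ge0 // ler_wpM2l ?powR_ge0 //.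
  exact: powR_sum_le.
pose IGH := \rint[mu]_x (H x * G x).
have IGH_le : (IGH <= (8 * (fnorm X F + e))%:E)%E.
  have [_ Hass] := AH; have := associate_pairing bX XG mH Hass.
  have -> : (fun x => `|G x * H x|) = (fun x => H x * G x).
    by apply/funext => x; rewrite mulrC gtr0_norm // mulr_gt0.
  move/le_trans; apply.
  have -> : associate_norm X H = (fnorm (associate X) H)%:E.
    by rewrite /= fineK // ge0_fin_numE // associate_norm_ge0.
  rewrite -EFinM lee_fin; apply: (@le_trans _ _ (2 * (fnorm X F + e) * 4)); last by rewrite mulrAC -natrM.
  apply: ler_pM => //; [exact: levi_norm_ge0|exact: levi_norm_ge0|].
  apply: le_trans nH _; move: nh; set t := fnorm _ h; clearbody t; clear => t1; lra.
(* The weighted bound is applied to each [f j] on each grid. Summed up, the right-hand side is a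
   multiple of $\int F^qw$, and $F^qG^{1-q}\le G$ leaves $\int GH$. *)
have IVq : (\rint[mu]_x (V x `^ q * w x) <= c2%:E * IGH)%E.
  apply: (@le_trans _ _ (\rint[mu]_x (c1 * \sum_(p : 'I_N * T) m p x `^ q * w x))).
    apply: le_rint.
    - by meas.
    - apply: measurable_funM => //; apply: measurable_sum => p.
      by have := mm p => ?; meas.
    - by move=> x; rewrite mulr_ge0 // powR_ge0.
    - move=> x; rewrite -mulr_suml mulrA ler_wpM2r //; apply: le_trans (Vqle x) _.
      by rewrite ler_wpM2l // pair_bigA /= le_eqVlt; apply/orP; left; apply/eqP; apply: eq_bigr => -[].
  have mterm p : measurable_fun setT (fun x => m p x `^ q * w x) by have := mm p => ?; meas.
  have term0 p x : 0 <= m p x `^ q * w x by rewrite mulr_ge0 // powR_ge0.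
  rewrite rintZ //; [|by apply: measurable_sum|by move=> x; apply: sumr_ge0].
  rewrite rint_sum // (_ : c2%:E = c1%:E * (#|T|%:R * Cm)%:E)%E; last by rewrite /c2 -mulrA.
  rewrite -muleA; apply: lee_wpmul2l; first by rewrite lee_fin.
  apply: (@le_trans _ _ (\sum_(p : 'I_N * T) Cm%:E * \rint[mu]_x (`|f p.1 x| `^ q * w x))%E).
    by apply: lee_sum => p _; have [] := mP p.
  have If0 j : (0 <= \rint[mu]_x (`|f j x| `^ q * w x))%E.
    by apply: rint_ge0 => x; rewrite mulr_ge0 // powR_ge0.
  rewrite -ge0_sume_distrr // mulrC EFinM -muleA; apply: lee_wpmul2l; first by rewrite lee_fin ltW.
  rewrite -(pair_bigA _ (fun j (al : T) => \rint[mu]_x (`|f j x| `^ q * w x))) /=.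
  rewrite (eq_bigr (fun j => #|T|%:R%:E * \rint[mu]_x (`|f j x| `^ q * w x)))%E; last first.
    by move=> j _; rewrite sumr_const mule_natl.
  rewrite -ge0_sume_distrr //; apply: lee_wpmul2l; first by rewrite lee_fin.
  rewrite -rint_sum //; last first.
  - by move=> j x; rewrite mulr_ge0 // powR_ge0.
  - by move=> j; have := mf j => ?; meas.
  apply: ae_le_rint.
  - by apply: measurable_sum => j; have := mf j => ?; meas.
  - by meas.
  - by move=> x; apply: sumr_ge0 => j _; rewrite mulr_ge0 // powR_ge0.
  - by move=> x; rewrite mulr_ge0.
  apply: filterS2 Fq FG => x Fqx FGx; rewrite -mulr_suml Fqx /w mulrCA ler_wpM2l //.
  apply: (@le_trans _ _ (G x `^ q * G x `^ (- (q - 1)))).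
    by rewrite ler_wpM2r ?powR_ge0 // ge0_ler_powR ?nnegrE // ltW.
  by rewrite -powRD ?(lt0r_neq0 (G0 x)) ?implybT // opprB addrCA subrr addr0 powRr1.
apply: (@le_trans _ _ (\rint[mu]_x (V x `^ q * w x + H x * G x))).
  apply: ae_le_rint.
  - by meas.
  - by meas.
  - by move=> x; rewrite mulr_ge0.
  - by move=> x; rewrite addr_ge0 // mulr_ge0 // powR_ge0.
  apply: filterS hH => x hHx; apply: (@le_trans _ _ (H x * V x)).
    by rewrite mulrC ler_wpM2r.
  (* Young's inequality with constant 1: if [G x < V x], then $V=V^qV^{1-q}\le V^qG^{1-q}$. *)
  have [VG|GV] := leP (V x) (G x).
    by rewrite ler_wpDl ?ler_wpM2l // mulr_ge0 // powR_ge0.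
  have Vx : 0 < V x by exact: lt_trans GV.
  rewrite ler_wpDr ?mulr_ge0 // /w mulrCA ler_wpM2l //.
  apply: (@le_trans _ _ (V x `^ q * V x `^ (- (q - 1)))).
    by rewrite -powRD ?(lt0r_neq0 Vx) ?implybT // opprB addrCA subrr addr0 powRr1.
  by rewrite ler_wpM2l ?powR_ge0 //; apply: powR_anti => //; exact: ltW.
rewrite rintD; [|by meas|by meas|by move=> x; rewrite mulr_ge0 // powR_ge0|by move=> x; rewrite mulr_ge0].
apply: (@le_trans _ _ ((c2 + 1)%:E * IGH)%E).
  rewrite EFinD ge0_muleDl ?lee_fin // mul1e; apply: leeD => //.
rewrite /Cb -mulrA mulrCA EFinM; apply: lee_wpmul2l => //.
by rewrite lee_fin addr_ge0.
Qed.

End extrapolation.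

(** * The vector-valued inequality implies boundedness on X and X' *)

Section sparse_families.
Variables (R : realType) (n : nat).
Implicit Types (X Z : fspace R n) (f g h : Rn R n -> R).
Implicit Types (S : seq (set (Rn R n))) (E : set (Rn R n) -> set (Rn R n)).
Implicit Types (c : set (Rn R n) -> R).
Local Notation mu := (lebesgue_Rn R n).

(** The inclusion of $\ell^p$ in $\ell^r$: in $b_i^r=b_i^p(b_i^p)^{r/p-1}$ the last factor is
    bounded by the power of the whole sum, kept fixed as [B] during the induction. *)
Lemma sum_powR_anti (I : Type) (s : seq I) (b : I -> R) (p r : R) :
  (forall i, 0 <= b i) -> 0 < p -> p <= r ->
  \sum_(i <- s) b i `^ r <= (\sum_(i <- s) b i `^ p) `^ (r / p).
Proof.
move=> b0 p0 pr.
have T0 (t : seq I) : 0 <= \sum_(i <- t) b i `^ p by apply: sumr_ge0 => i _; exact: powR_ge0.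
suff H (t : seq I) (B : R) : \sum_(i <- t) b i `^ p <= B ->
    \sum_(i <- t) b i `^ r <= (\sum_(i <- t) b i `^ p) * B `^ (r / p - 1).
  apply: le_trans (H s _ (lexx _)) _.
  have [->|T1] := eqVneq (\sum_(i <- s) b i `^ p) 0; first by rewrite mul0r powR_ge0.
  by rewrite -[X in X * _]powRr1 // -powRD ?T1 ?implybT // addrC subrK.
have rp : 0 <= r / p - 1 by rewrite subr_ge0 ler_pdivlMr // mul1r.
elim: t => [|i t IH] tB; first by rewrite !big_nil mul0r.
move: tB; rewrite !big_cons => tB; rewrite mulrDl lerD //; last first.
  by apply: IH; apply: le_trans tB; rewrite lerDr powR_ge0.
have iB : b i `^ p <= B by apply: le_trans tB; rewrite lerDl.
have -> : b i `^ r = b i `^ p * (b i `^ p) `^ (r / p - 1).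
  have [->|bi] := eqVneq (b i) 0; first by rewrite (powR0 (lt0r_neq0 p0)) mul0r powR0 // lt0r_neq0 // (lt_le_trans p0).
  rewrite -powRrM -powRD ?bi ?implybT // mulrBr mulr1 addrCA subrr addr0.
  by rewrite mulrC divfK // gt_eqF.
rewrite ler_wpM2l ?powR_ge0 // ge0_ler_powR ?nnegrE ?powR_ge0 //.
exact: le_trans (powR_ge0 _ _) iB.
Qed.

Lemma levi_sum_mem Z (I : eqType) (s : seq I) (b : I -> R) (f : I -> Rn R n -> R) :
  levi_space Z -> (forall i, i \in s -> Z (f i)) ->
  Z (fun x => \sum_(i <- s) b i * f i x).
Proof.
move=> lZ; elim: s => [|i s IH] Zf.
  rewrite (_ : (fun x => _) = cst 0); last by apply/funext => x; rewrite big_nil.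
  by have [] := levi_zero lZ.
rewrite (_ : (fun x => _) = (fun x => b i * f i x + \sum_(i <- s) b i * f i x)); last first.
  by apply/funext => x; rewrite big_cons.
apply: (levi_add lZ _ _).1; first by apply: (levi_scale lZ _ _).1; apply: Zf; rewrite mem_head.
by apply: IH => j js; apply: Zf; rewrite inE js orbT.
Qed.

(** The factor 2 matches the doubling of averages in [principal_family]. [E P] is constrained only
    in part outside [S], where it is never evaluated. *)
Record sparse_family S E : Prop := {
  sparse_uniq : uniq S ;
  sparse_laminar : laminar S ;
  sparse_cube : forall P, P \in S -> exists (z : Rn R n) (l : R), 0 < l /\ P = cube z l ;
  sparse_measurable : forall P, P \in S -> measurable (E P) ;
  sparse_sub : forall P, E P `<=` P ;
  sparse_mass : forall P, P \in S -> (mu P <= 2%:E * mu (E P))%E ;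
  sparse_disjoint : forall P Q x, P \in S -> Q \in S -> E P x -> E Q x -> P = Q }.

Definition dominating_sum S c (x : Rn R n) := \sum_(P <- S) c P * \1_P x.
Definition disjoint_sum S E c (x : Rn R n) := \sum_(P <- S) c P * \1_(E P) x.
(** The function tau of the overview, [dominating_sum] being sigma. *)
Definition power_sum S c (m : nat) (x : Rn R n) :=
  (\sum_(P <- S) (c P * \1_P x) ^+ m) `^ (m%:R)^-1.

Lemma sparse_cube_measurable S E P : sparse_family S E -> P \in S -> measurable P.
Proof. by move=> sSE /(sparse_cube sSE)[c [l [_ ->]]]; exact: measurable_cube. Qed.

Lemma measurable_sum_mem S c E : (forall P, P \in S -> measurable (E P)) ->
  measurable_fun setT (fun x : Rn R n => \sum_(P <- S) c P * \1_(E P) x).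
Proof.
move=> mE; rewrite (_ : (fun x => _) =
   (fun x => \sum_(P <- S) c P * \1_(if P \in S then E P else set0) x)).
  apply: measurable_sum => P; apply: measurable_funM => //; apply: measurable_indic.
  by case: ifPn => [/mE|_].
by apply/funext => x; apply: eq_big_seq => P ->.
Qed.

Lemma dominating_sum_mem X S E c : levi_space X -> sparse_family S E ->
  X (dominating_sum S c).
Proof.
move=> lX sSE; apply: (levi_sum_mem c lX) => P PS.
by have [d [l [l0 ->]]] := sparse_cube sSE PS; exact: levi_cube.
Qed.

Lemma disjoint_sum_le S E c x : sparse_family S E -> (forall P, 0 <= c P) ->
  disjoint_sum S E c x <= dominating_sum S c x.
Proof.
move=> sSE c0; apply: ler_sum => P _; rewrite ler_wpM2l // !indicE ler_nat.
by have [/set_mem/(sparse_sub sSE)/mem_set ->|] := boolP (x \in E P).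
Qed.

Lemma disjoint_sum_mem X S E c : levi_space X -> sparse_family S E ->
  (forall P, 0 <= c P) -> X (disjoint_sum S E c).
Proof.
move=> lX sSE c0; apply: (levi_ideal lX (dominating_sum_mem c lX sSE) _ _).1.
  exact: (measurable_sum_mem c (sparse_measurable sSE)).
apply: nearW => x; have d0 : 0 <= disjoint_sum S E c x by apply: sumr_ge0 => P _; rewrite mulr_ge0.
have h := disjoint_sum_le x sSE c0.
by rewrite !ger0_norm // (le_trans d0).
Qed.

Lemma disjoint_sumE S E c P x : sparse_family S E -> P \in S -> E P x ->
  disjoint_sum S E c x = c P.
Proof.
move=> sSE PS Px; rewrite /disjoint_sum (bigD1_seq P) ?(sparse_uniq sSE) //=.
rewrite indicE mem_set // mulr1 big_seq_cond big1 ?addr0 // => Q /andP[QS QP].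
rewrite indicE memNset ?mulr0 // => Qx.
by move: QP; rewrite (sparse_disjoint sSE QS PS Qx Px) eqxx.
Qed.

Lemma disjoint_sum_bound S E c x (B : R) : sparse_family S E -> 0 <= B ->
  (forall P, P \in S -> E P x -> c P <= B) -> disjoint_sum S E c x <= B.
Proof.
move=> sSE B0 cB; have [[P PS Px]|no] := pselect (exists2 P, P \in S & E P x).
  by rewrite (disjoint_sumE c sSE PS Px) cB.
rewrite /disjoint_sum big_seq big1 // => P PS.
by rewrite indicE memNset ?mulr0 // => Px; apply: no; exists P.
Qed.

(** [chain_power_sum] for the cubes through [x], which form a chain. Each of their [c P] is at most
    tau(c) at [x], and the sums above [P] within the chain are at most the full sums [s P]. *)
Lemma dominating_sum_pow S E c (m : nat) x : sparse_family S E -> (forall P, 0 <= c P) ->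
  (0 < m)%N ->
  dominating_sum S c x ^+ m.+1 <= m.+1%:R * power_sum S c m x *
   power_sum S (fun P => \sum_(Q <- S | `[< P `<=` Q >]) c Q) m x ^+ m.
Proof.
move=> sSE c0 m0; set s := fun P => _.
have s0 P : 0 <= s P by exact: sumr_ge0.
pose S' := [seq P <- S | x \in P].
have -> : dominating_sum S c x = \sum_(P <- S') c P.
  rewrite /dominating_sum big_filter [RHS]big_mkcond /=; apply: eq_bigr => P _.
  by rewrite indicE; case: (x \in P); rewrite ?mulr1 ?mulr0.
have ch : {in S' &, forall P Q, P `<=` Q \/ Q `<=` P}.
  move=> P Q; rewrite !mem_filter => /andP[/set_mem xP PS] /andP[/set_mem xQ QS].
  have [?|?|PQ] := sparse_laminar sSE PS QS; [by left|by right|].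
  by exfalso; have : (P `&` Q) x by []; rewrite PQ.
apply: le_trans (chain_power_sum m _ c0 ch) _; first by rewrite filter_uniq // (sparse_uniq sSE).
have m0' : m%:R != 0 :> R by rewrite pnatr_eq0 -lt0n.
have pow_ge0 (d : set (Rn R n) -> R) : (forall P, 0 <= d P) ->
    0 <= \sum_(P <- S) (d P * \1_P x) ^+ m.
  by move=> d0; apply: sumr_ge0 => P _; rewrite exprn_ge0 // mulr_ge0.
have powE (d : set (Rn R n) -> R) : (forall P, 0 <= d P) ->
    power_sum S d m x ^+ m = \sum_(P <- S) (d P * \1_P x) ^+ m.
  by move=> d0; rewrite -powR_mulrn ?powR_ge0 // -powRrM mulVf // powRr1 // pow_ge0.
rewrite -mulrA ler_wpM2l // powE // mulr_sumr /S' big_filter [leLHS]big_mkcond /=.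
rewrite big_seq [leRHS]big_seq; apply: ler_sum => P PS.
rewrite indicE; have [xP|_] := boolP (x \in P); last first.
  by rewrite mulr_ge0 ?powR_ge0 // exprn_ge0 // mulr0.
rewrite mulr1 mulrC; apply: ler_pM; rewrite ?exprn_ge0 ?sumr_ge0 //.
  rewrite -(@ler_pXn2r _ m) ?nnegrE ?powR_ge0 // powE //.
  rewrite (bigD1_seq P) ?(sparse_uniq sSE) //= indicE xP mulr1 lerDl.
  by apply: sumr_ge0 => Q _; rewrite exprn_ge0 // mulr_ge0.
apply: lerXn2r; rewrite ?nnegrE ?sumr_ge0 // big_filter_cond /s.
rewrite big_mkcond [leRHS]big_mkcond /=; apply: ler_sum => Q _.
by case: (x \in Q) => //=; case: ifP.
Qed.

(** Either [s] is at most [e * u], or [u] is below [s / e] and the hypothesis can be divided by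
    [s ^+ m]. *)
Lemma young_absorption (m : nat) (s t u e : R) : 0 <= s -> 0 <= t -> 0 < e -> 0 <= u ->
  s ^+ m.+1 <= m.+1%:R * t * u ^+ m -> s <= e * u + m.+1%:R * e ^- m * t.
Proof.
move=> s0 t0 e0 u0 h.
have K0 : 0 <= m.+1%:R * e ^- m * t by rewrite !mulr_ge0 // invr_ge0 exprn_ge0 // ltW.
have [su|us] := leP s (e * u); first by rewrite ler_wpDr.
have spos : 0 < s by apply: le_lt_trans us; rewrite mulr_ge0 // ltW.
rewrite ler_wpDl ?mulr_ge0 ?(ltW e0) //.
have um : u ^+ m <= s ^+ m * e ^- m.
  rewrite ler_pdivlMr ?exprn_gt0 // -exprMn lerXn2r ?nnegrE ?mulr_ge0 ?(ltW e0) //.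
  by rewrite mulrC ltW.
rewrite -(@ler_pM2r _ (s ^+ m)) ?exprn_gt0 // -exprS; apply: le_trans h _.
rewrite [leRHS](_ : _ = m.+1%:R * t * (s ^+ m * e ^- m)); last by ring.
by rewrite ler_wpM2l // mulr_ge0.
Qed.

End sparse_families.

(** * Comparison of overlapping and disjoint sums in X *)

Section necessity.
Variables (R : realType) (n : nat) (X : fspace R n) (q C : R).
Hypotheses (bX : ball_banach X) (q1 : 1 < q) (C0 : 0 < C).
Hypothesis fsX : fs_finite_rhs X q C.
Implicit Types (f g h : Rn R n -> R).
Implicit Types (S : seq (set (Rn R n))) (E : set (Rn R n) -> set (Rn R n)).
Implicit Types (c : set (Rn R n) -> R).
Local Notation mu := (lebesgue_Rn R n).

Let lX : levi_space X := ball_banach_levi bX.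
Let mX := levi_measurable lX.
Let iX := levi_ideal lX.
Let q0 : 0 < q. Proof. by rewrite (lt_trans ltr01). Qed.

Lemma maximal_bound_of_fs : maximal_bound X C.
Proof.
move=> f Xf; have mf := mX Xf.
have one (F : Rn R n -> \bar R) : (forall x, 0 <= F x)%E -> @lq_sum R n 1 q (fun=> F) = F.
  by move=> F0; apply/funext => x; rewrite /lq_sum big_ord1 poweR_cancel.
have [Xa na] : X (fun x => `|f x|) /\ fnorm X (fun x => `|f x|) <= fnorm X f.
  by apply: (iX Xf); [by meas|apply: nearW => x; rewrite normr_id].
have E : enorm X (abs_e f) = (fnorm X (fun x => `|f x|))%:E.
  by apply: enorm_rep => //; exact: nearW.
have := @fsX 1 (fun=> f) isT (fun=> mf).
rewrite /fs_inequality /= (one _ (maximal_ge0 f)) (one (abs_e f)); last by move=> x; rewrite /abs_e.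
rewrite E ltry => /(_ isT) /le_trans; apply.
by rewrite -EFinM lee_fin ler_wpM2l // ltW.
Qed.

(** The average over [P] itself suffices, as [E P] fills at least half of it. *)
Lemma maximal_sparse_ge S E c P x : sparse_family S E -> (forall P, 0 <= c P) ->
  P \in S -> P x -> ((c P / 2)%:E <= maximal (fun y => (c P * \1_(E P) y)%R) x)%E.
Proof.
move=> sSE c0 PS; have [z [l [l0 Pzl]]] := sparse_cube sSE PS.
have mEP := sparse_measurable sSE PS.
have ln0 : 0 < l ^+ n by rewrite exprn_gt0.
move=> Px; apply: le_trans (maximal_ge _ l0 (_ : cube z l x)); last by rewrite -Pzl.
rewrite /cube_average lee_pdivlMl // -Pzl.
have -> : (fun y => `|c P * \1_(E P) y| * \1_P y) = (fun y => c P * \1_(E P) y).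
  apply/funext => y; rewrite ger0_norm ?mulr_ge0 // !indicE.
  have [/set_mem/(sparse_sub sSE)/mem_set ->|] := boolP (y \in E P); first by rewrite !mulr1.
  by rewrite mulr0 mul0r.
rewrite rintZ // rint_indic //.
have mEfin : mu (E P) \is a fin_num.
  rewrite ge0_fin_numE //; apply: (@le_lt_trans _ _ (mu P)).
    by apply: le_measure; rewrite ?inE //; [exact: sparse_cube_measurable sSE PS|exact: (sparse_sub sSE)].
  by rewrite Pzl lebesgue_cube // ltry.
have := sparse_mass sSE PS; rewrite {1}Pzl lebesgue_cube // -(fineK mEfin) -!EFinM !lee_fin => h.
by rewrite mulrCA ler_wpM2l // ler_pdivrMr // mulrC.
Qed.

(** The hypothesis is applied to the functions [c P * \1_(E P)], whose maximal functions are at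
    least [c P / 2] on [P]; hence the factor 2. Monotonicity of $\ell^p$ norms replaces the exponent
    [q] by [m] on the left and by 1 on the right. *)
Lemma power_sum_bound S E c (m : nat) : sparse_family S E -> (forall P, 0 <= c P) ->
  (0 < m)%N -> q <= m%:R ->
  X (power_sum S c m) /\ fnorm X (power_sum S c m) <= 2 * C * fnorm X (disjoint_sum S E c).
Proof.
move=> sSE c0 m0 qm; have Xd := disjoint_sum_mem lX sSE c0.
have nd := levi_norm_ge0 lX Xd.
have m0' : 0 < m%:R :> R by rewrite ltr0n.
have d0 x : 0 <= disjoint_sum S E c x by apply: sumr_ge0 => P _; rewrite mulr_ge0.
have p0 x : 0 <= power_sum S c m x by exact: powR_ge0.
have mp : measurable_fun setT (power_sum S c m).
  apply: (measurableT_comp (@measurable_powR R (m%:R)^-1)).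
  rewrite (_ : (fun x => _) = (fun x => \sum_(P <- S) c P ^+ m * \1_P x)).
    by apply: measurable_sum_mem => P PS; exact: sparse_cube_measurable sSE PS.
  apply/funext => x; apply: eq_bigr => P _; rewrite exprMn indicE.
  by case: (x \in P); rewrite ?expr1n ?expr0n //= gtn_eqF.
(* The hypothesis speaks of nonempty families only. *)
have [S0|S0] := posnP (size S).
  have [Z0 nZ] := levi_zero lX.
  have -> : power_sum S c m = cst 0.
    apply/funext => x; rewrite /power_sum (size0nil S0) big_nil powR0 //.
    by rewrite invr_eq0 gt_eqF.
  by rewrite nZ !mulr_ge0 // ltW.
pose Pi (j : 'I_(size S)) := nth set0 S j.
have PiS j : Pi j \in S by rewrite mem_nth.
have ordE (V : nmodType) (F : set (Rn R n) -> V) : \sum_(P <- S) F P = \sum_(j < size S) F (Pi j).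
  by rewrite (big_nth set0) big_mkord.
pose f j := fun y => c (Pi j) * \1_(E (Pi j)) y.
have f0 j y : 0 <= f j y by rewrite mulr_ge0.
have mf j : measurable_fun setT (f j).
  by have := sparse_measurable sSE (PiS j) => ?; rewrite /f; meas.
have rhs : (enorm X (lq_sum q (fun j => abs_e (f j))) <= (fnorm X (disjoint_sum S E c))%:E)%E.
  rewrite -(enorm_rep iX mX Xd (F := fun x => (disjoint_sum S E c x)%:E)); last exact: nearW.
  apply: le_enorm => //.
  - by apply: measurable_lq_sum => j; rewrite /abs_e; have := mf j => ?; meas.
  - by move=> x; exact: lq_sum_ge0.
  apply: nearW => x; rewrite /lq_sum (eq_bigr (fun j => (f j x `^ q)%:E)); last first.
    by move=> j _; rewrite /abs_e ger0_norm // poweR_EFin.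
  rewrite sumEFin poweR_EFin lee_fin /disjoint_sum ordE.
  have s0 : 0 <= \sum_j f j x by apply: sumr_ge0.
  have := @sum_powR_anti R _ (index_enum 'I_(size S)) (fun j => f j x) 1 q (fun j => f0 j x) ltr01 (ltW q1).
  have -> : \sum_j f j x `^ 1 = \sum_j f j x by apply: eq_bigr => j _; rewrite powRr1.
  rewrite divr1 => h; rewrite -[leRHS](powRr1 s0) -(mulfV (lt0r_neq0 q0)) powRrM.
  by apply: ge0_ler_powR; rewrite ?nnegrE ?powR_ge0 ?invr_ge0 ?(ltW q0) // sumr_ge0 // => j _; exact: powR_ge0.
have := fsX S0 mf (le_lt_trans rhs (ltry _)); rewrite /fs_inequality => lhs.
have : (enorm X (lq_sum q (fun j => maximal (f j))) <= (C * fnorm X (disjoint_sum S E c))%:E)%E.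
  by apply: le_trans lhs _; rewrite EFinM; apply: lee_wpmul2l => //; rewrite lee_fin ltW.
move=> /(enorm_le iX mX) [g [Xg ng] gE].
have [X2 n2] := levi_scale lX 2 Xg.
have pg : {ae mu, forall x, `|power_sum S c m x| <= `|2 * g x|}.
  apply: filterS gE => x gx; rewrite (ger0_norm (p0 x)) normrM gtr0_norm //.
  have g0 : 0 <= g x by rewrite -lee_fin -gx; exact: lq_sum_ge0.
  rewrite (ger0_norm g0).
  pose b j := c (Pi j) * \1_(Pi j) x.
  have b0 j : 0 <= b j by rewrite mulr_ge0.
  have bm j : ((b j / 2)%:E <= maximal (f j) x)%E.
    rewrite /b indicE; have [/set_mem xP|_] := boolP (x \in Pi j).
      by rewrite mulr1; exact: (maximal_sparse_ge sSE c0 (PiS j) xP).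
    by rewrite mulr0 mul0r; exact: maximal_ge0.
  have h : ((\sum_j (b j / 2) `^ q) `^ q^-1 <= g x).
    rewrite -lee_fin -gx -poweR_EFin -sumEFin /lq_sum.
    rewrite (eq_bigr (fun j => (b j / 2)%:E `^ q)%E); last by move=> j _; rewrite poweR_EFin.
    apply: (@le_lq_sum _ _ _ q (fun j _ => (b j / 2)%:E) (fun j => maximal (f j)) x) => // j.
    by rewrite lee_fin divr_ge0.
  rewrite -ler_pdivrMl // mulrC; apply: le_trans h.
  have -> : power_sum S c m x / 2 = (\sum_j (b j / 2) `^ m%:R) `^ (m%:R)^-1.
    rewrite /power_sum ordE (eq_bigr (fun j => b j `^ m%:R)); last by move=> j _; rewrite powR_mulrn.
    rewrite [in RHS](eq_bigr (fun j => 2^-1 `^ m%:R * b j `^ m%:R)); last first.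
      by move=> j _; rewrite mulrC powRM.
    rewrite -mulr_sumr powRM ?powR_ge0 ?sumr_ge0 // => [|j _]; last exact: powR_ge0.
    by rewrite -powRrM mulfV ?gt_eqF // powRr1 // mulrC.
  have b20 j : 0 <= b j / 2 by rewrite divr_ge0.
  have := sum_powR_anti (index_enum 'I_(size S)) b20 q0 qm.
  set A := \sum_(_ <- _) _; set B := \sum_(_ <- _) _ => AB.
  have A0 : 0 <= A by apply: sumr_ge0 => j _; exact: powR_ge0.
  have B0 : 0 <= B by apply: sumr_ge0 => j _; exact: powR_ge0.
  rewrite (_ : B `^ q^-1 = (B `^ (m%:R / q)) `^ (m%:R)^-1); last first.
    by rewrite -powRrM mulrAC mulfV ?mul1r // gt_eqF.
  by apply: ge0_ler_powR; rewrite ?nnegrE ?powR_ge0 ?invr_ge0 // ltW.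
have [Xp np] := iX X2 mp pg; split => //.
apply: le_trans np _; apply: le_trans n2 _; rewrite gtr0_norm // -mulrA.
by rewrite ler_pM2l.
Qed.

Lemma dominating_sum_bound : exists2 K : R, 0 < K & forall S E c, sparse_family S E ->
  (forall P, 0 <= c P) ->
  fnorm X (dominating_sum S c) <= K * fnorm X (disjoint_sum S E c).
Proof.
have absorb (u v w : R) : 0 <= v -> u <= u / 2 + w -> u <= 2 * w + v by lra.
(* The chain inequality needs an integer exponent, [power_sum_bound] one that is at least [q]. *)
pose m := (Num.bound q).+1.
have qm : q <= m%:R.
  by apply: le_trans (ltW (archi_boundP (ltW q0))) _; rewrite ler_nat.
(* Makes the coefficient [e * (2 * C)] of the absorbed norm equal to 1/2. *)
pose e := (4 * C)^-1; have e0 : 0 < e by rewrite invr_gt0 mulr_gt0.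
pose L : R := m.+1%:R * e ^- m.
have L0 : 0 <= L by rewrite mulr_ge0 // invr_ge0 exprn_ge0 // ltW.
exists (4 * C * L + 1) => [|S E c sSE c0]; first by rewrite ltr_wpDl //; apply: mulr_ge0 => //; rewrite mulr_ge0 // ltW.
pose s P := \sum_(Q <- S | `[< P `<=` Q >]) c Q.
have s0 P : 0 <= s P by exact: sumr_ge0.
have Xd := disjoint_sum_mem lX sSE c0; have nd := levi_norm_ge0 lX Xd.
have XD := dominating_sum_mem c lX sSE.
have Xds := disjoint_sum_mem lX sSE s0.
have [Xpc npc] := power_sum_bound sSE c0 (isT : (0 < m)%N) qm.
have [Xps nps] := power_sum_bound sSE s0 (isT : (0 < m)%N) qm.
have D0 x : 0 <= dominating_sum S c x by apply: sumr_ge0 => P _; rewrite mulr_ge0.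
have ds0 x : 0 <= disjoint_sum S E s x by apply: sumr_ge0 => P _; rewrite mulr_ge0.
(* On [E P] the sum reduces to [s P], and the cubes counted in [s P] contain [P], hence the point.
   So the norm of tau(s) is controlled by that of sigma itself, which is finite and can be
   absorbed. *)
have sD : fnorm X (disjoint_sum S E s) <= fnorm X (dominating_sum S c).
  apply: (iX XD (mX Xds) _).2; apply: nearW => x; rewrite !ger0_norm //.
  apply: disjoint_sum_bound => // P PS Px.
  rewrite /s /dominating_sum big_mkcond; apply: ler_sum => Q _ /=.
  case: asboolP => [PQ|_]; last by rewrite mulr_ge0.
  by rewrite indicE mem_set ?mulr1 //; apply: PQ; exact: (sparse_sub sSE Px).
have [Xe ne] := levi_scale lX e Xps; have [XL nL] := levi_scale lX L Xpc.
have [XeL neL] := levi_add lX Xe XL.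
have : fnorm X (dominating_sum S c) <= fnorm X (fun x => e * power_sum S s m x + L * power_sum S c m x).
  apply: (iX XeL (mX XD) _).2; apply: nearW => x; rewrite ger0_norm //.
  apply: le_trans (ler_norm _).
  apply: young_absorption => //; try exact: powR_ge0.
  exact: (dominating_sum_pow x sSE c0 (isT : (0 < m)%N)).
move=> /le_trans /(_ neL) h.
rewrite gtr0_norm // in ne; rewrite ger0_norm // in nL.
have h1 : e * fnorm X (power_sum S s m) <= fnorm X (dominating_sum S c) / 2.
  apply: (@le_trans _ _ (e * (2 * C * fnorm X (dominating_sum S c)))).
    by rewrite ler_pM2l //; apply: le_trans nps _; rewrite ler_wpM2l // mulr_ge0 // ltW.
  rewrite le_eqVlt; apply/orP; left; apply/eqP; rewrite /e; field.
  by rewrite gt_eqF.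
have h2 : L * fnorm X (power_sum S c m) <= L * (2 * C * fnorm X (disjoint_sum S E c)).
  by rewrite ler_wpM2l.
set a := fnorm X (dominating_sum S c); set d := fnorm X (disjoint_sum S E c).
have : a <= a / 2 + L * (2 * C * d).
  by apply: le_trans h _; apply: lerD; [exact: le_trans ne h1|exact: le_trans nL h2].
have -> : (4 * C * L + 1) * d = 2 * (L * (2 * C * d)) + d by ring.
by move: (L * _) => w; exact: absorb.
Qed.

End necessity.

Lemma rint_sum_mem d (T : measurableType d) (R : realType) (mu : {measure set T -> \bar R})
    (I : eqType) (s : seq I) (f : I -> T -> R) :
  (forall i, i \in s -> measurable_fun setT (f i)) -> (forall i x, 0 <= f i x) ->
  rint mu (fun x => \sum_(i <- s) f i x) = (\sum_(i <- s) rint mu (f i))%E.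
Proof.
move=> mf f0; pose f' i := if i \in s then f i else cst 0.
have E x : \sum_(i <- s) f i x = \sum_(i <- s) f' i x by apply: eq_big_seq => i si; rewrite /f' si.
under eq_fun do rewrite E.
rewrite rint_sum; first by apply: eq_big_seq => i si; rewrite /f' si.
  by move=> i; rewrite /f'; case: ifPn => [/mf//|_]; exact: measurable_cst.
by move=> i x; rewrite /f'; case: ifP.
Qed.

Lemma rint_subset d (T : measurableType d) (R : realType) (mu : {measure set T -> \bar R})
    (f : T -> R) (P Q : set T) : measurable_fun setT f -> (forall x, 0 <= f x) ->
  measurable P -> measurable Q -> P `<=` Q ->
  (\rint[mu]_x (f x * \1_P x) <= \rint[mu]_x (f x * \1_Q x))%E.
Proof.
move=> mf f0 mP mQ PQ; apply: le_rint; [by meas|by meas|by move=> x; rewrite mulr_ge0|].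
move=> x; rewrite ler_wpM2l // !indicE ler_nat.
by have [/set_mem/PQ/mem_set ->|] := boolP (x \in P).
Qed.

(** * Sparse domination and the bound on the associate space *)

Section associate_bound.
Variables (R : realType) (n : nat).
Implicit Types (f g h : Rn R n -> R).
Implicit Types (S s : seq (set (Rn R n))) (E : set (Rn R n) -> set (Rn R n)).
Local Notation mu := (lebesgue_Rn R n).

(** [E P] is [P] minus the principal cubes strictly inside it. On those the averages of $|g|$ are at
    least [2 * a P], so by the weak type bound they cover at most half of [P]. *)
Lemma principal_sparse s g (a : set (Rn R n) -> R) : measurable_fun setT g ->
  (forall P, 0 <= a P) -> laminar s ->
  (forall P, P \in s -> exists z l, 0 < l /\ P = cube z l) ->
  (forall P, P \in s -> ((a P)%:E * mu P = \rint[mu]_x (`|g x| * \1_P x))%E) ->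
  exists S E, [/\ sparse_family S E, {subset S <= s} &
    forall Q x, Q \in s -> Q x -> a Q <= 2 * disjoint_sum S E a x].
Proof.
move=> mg a0 ls cs aE.
(* Cubes with zero average are dropped, so that the comparison of measures can be divided by
   [a P]. *)
have [S [uS Ss S2 Sd]] := principal_family [seq P <- s | 0 < a P] a0.
have {}Ss P : P \in S -> 0 < a P /\ P \in s by move=> /Ss; rewrite mem_filter => /andP[].
have sub : {subset S <= s} by move=> P /Ss[].
have lS : laminar S by exact: laminar_sub ls.
pose D P := [seq Q <- S | `[< Q `<=` P /\ Q <> P >]].
have DP P Q : Q \in D P -> [/\ Q \in S, Q `<=` P & Q <> P].
  by rewrite mem_filter => /andP[/asboolP[]].
pose E P := P `\` seq_union (D P).
have mS P : P \in S -> measurable P.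
  by move=> /sub /cs [z [l [_ ->]]]; exact: measurable_cube.
have mU P : measurable (seq_union (D P)).
  by apply: measurable_seq_union => Q /DP[/mS].
have UP P : seq_union (D P) `<=` P by move=> x /seq_unionP[Q /DP[_ QP _]]; exact: QP.
have mE P : P \in S -> measurable (E P) by move=> PS; apply: measurableD => //; exact: mS.
have inE_ P Q x : P \in S -> Q \in S -> P `<=` Q -> P x -> E Q x -> P = Q.
  move=> PS QS PQ Px [_ xU]; apply: contrapT => PnQ; apply: xU.
  by apply/seq_unionP; exists P => //; rewrite mem_filter PS andbT; apply/asboolP.
have sSE : sparse_family S E.
  split => //; [by move=> P /sub /cs|by move=> P x []| |]; last first.
    move=> P Q x PS QS xP xQ; have [Px Qx] : P x /\ Q x by case: xP; case: xQ.
    have [PQ|QP|PQ] := lS P Q PS QS; [exact: (inE_ P Q x)|by rewrite (inE_ Q P x)|].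
    by exfalso; have : (P `&` Q) x by []; rewrite PQ.
  move=> P PS; have [aP Psin] := Ss P PS; have [z [l [l0 Pzl]]] := cs P Psin.
  have Pfin : mu P = (l ^+ n)%:E by rewrite Pzl lebesgue_cube.
  have wk : ((2 * a P)%:E * mu (seq_union (D P)) <= (a P)%:E * mu P)%E.
    apply: (@le_trans _ _ (\rint[mu]_x (`|g x| * \1_(seq_union (D P)) x))).
      apply: laminar_weak_type.
      - by apply: laminar_sub lS => Q /DP[].
      - by move=> Q /DP[/mS].
      - by meas.
      - by move=> x.
      - by rewrite mulr_ge0.
      - move=> Q /DP[QS QP QnP]; rewrite -aE; last exact: sub.
        by apply: lee_wpmul2r => //; rewrite lee_fin; exact: S2.
    rewrite aE //; apply: rint_subset => //; [by meas|exact: mS].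
  have Ufin : (mu (seq_union (D P)) <= mu P)%E.
    by apply: le_measure; rewrite ?inE //; exact: mS.
  have Efin : (mu (E P) <= mu P)%E.
    by apply: le_measure; rewrite ?inE //; [exact: mE|exact: mS|exact: subDsetl].
  have split_ : (mu P <= mu (seq_union (D P)) + mu (E P))%E.
    apply: le_trans (measureU2 _ (mU P) (mE P PS)); apply: le_measure; rewrite ?inE //.
    - exact: mS.
    - by apply: measurableU => //; exact: mE.
    - by move=> x Px; have [xU|xU] := pselect (seq_union (D P) x); [left|right].
  move: wk Ufin Efin split_; rewrite Pfin.
  have U0 := measure_ge0 mu (seq_union (D P)); have E0 := measure_ge0 mu (E P).
  case: (mu (seq_union (D P))) U0 => [u| |] //= U0.
  case: (mu (E P)) E0 => [e| |] //= E0.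
  rewrite -!EFinM -EFinD !lee_fin => wk _ _.
  have : 2 * u <= l ^+ n by rewrite -(ler_pM2l aP) mulrA [a P * 2]mulrC.
  by move: (l ^+ n) => p; clear; lra.
exists S, E; split => // Q x Qs Qx.
have d0 : 0 <= disjoint_sum S E a x by apply: sumr_ge0 => P _; rewrite mulr_ge0.
have [aQ|aQ] := leP (a Q) 0; first by apply: le_trans aQ _; rewrite mulr_ge0.
have [|P [PS QP aQP]] := Sd Q; first by rewrite mem_filter aQ.
(* The smallest principal cube inside [P] that contains [x]: its part [E P0] contains [x], and [a]
   does not decrease on the way down from [P]. *)
have [|P0] := @minimal_set _ [seq P' <- S | `[< P' x /\ P' `<=` P >]].
  have : P \in [seq P' <- S | `[< P' x /\ P' `<=` P >]].
    by rewrite mem_filter PS andbT; apply/asboolP; split => //; exact: QP.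
  by case: [seq _ <- _ | _].
rewrite mem_filter => /andP[/asboolP[P0x P0P] P0S] P0min.
have xE : E P0 x.
  split => // /seq_unionP[P' /DP[P'S P'P0 P'nP0] P'x]; apply: P'nP0; apply: P0min => //.
  rewrite mem_filter P'S andbT; apply/asboolP; split => //; exact: subset_trans P0P.
rewrite (disjoint_sumE a sSE P0S xE); apply: le_trans aQP _; rewrite ler_pM2l //.
have [->//|P0nP] := pselect (P0 = P).
by apply: le_trans (S2 _ _ PS P0S P0P P0nP); rewrite mulr_natl mulr2n lerDl.
Qed.

Variables (X : fspace R n) (q C : R).
Hypotheses (bX : ball_banach X) (q1 : 1 < q) (C0 : 0 < C).
Hypothesis fsX : fs_finite_rhs X q C.

Let lX : levi_space X := ball_banach_levi bX.
Let mX := levi_measurable lX.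
Let iX := levi_ideal lX.

(** Averaging is moved from [g] to [f]: $\int|f|\sum a_P1_{E_P}=\int|g|\sum b_P1_P$, where [b P] is
    the integral of $|f|$ over [E P] divided by the measure of [P]. The last sum has norm at most
    [K] times that of $\sum b_P1_{E_P}$, which lies below the maximal function of [f]; hence the
    constant [K * C]. *)
Lemma sparse_pairing : exists2 B : R, 0 <= B & forall S E f g (a : set (Rn R n) -> R),
  sparse_family S E -> X f -> fnorm X f <= 1 -> measurable_fun setT g ->
  (associate_norm X g < +oo)%E -> (forall P, 0 <= a P) ->
  (forall P, P \in S -> ((a P)%:E * mu P = \rint[mu]_x (`|g x| * \1_P x))%E) ->
  (\rint[mu]_x (`|f x| * disjoint_sum S E a x) <= B%:E * associate_norm X g)%E.
Proof.
have [K K0 KP] := dominating_sum_bound bX q1 C0 fsX.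
exists (K * C); first by rewrite mulr_ge0 // ltW.
move=> S E f g a sSE Xf f1 mg gfin a0 aE; have mf := mX Xf.
have mS P : P \in S -> measurable P by exact: sparse_cube_measurable sSE.
have mE P : P \in S -> measurable (E P) by move/(sparse_measurable sSE).
pose F P := fine (\rint[mu]_x (`|f x| * \1_(E P) x)).
have F0 P : 0 <= F P by apply: fine_ge0; apply: rint_ge0 => x; rewrite mulr_ge0.
have FP P : P \in S -> (\rint[mu]_x (`|f x| * \1_(E P) x) <= \rint[mu]_x (`|f x| * \1_P x))%E.
  move=> PS; apply: rint_subset => //; [by meas|exact: mE|exact: mS|exact: (sparse_sub sSE)].
have FE P : P \in S -> (F P)%:E = \rint[mu]_x (`|f x| * \1_(E P) x).
  move=> PS; rewrite fineK // ge0_fin_numE; last by apply: rint_ge0 => x; rewrite mulr_ge0.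
  apply: le_lt_trans (FP P PS) _; have [z [l [l0 ->]]] := sparse_cube sSE PS.
  by have [B _ HB] := levi_local lX z l0; apply: le_lt_trans (HB _ Xf) (ltry _).
pose b P := F P / fine (mu P).
have b0 P : 0 <= b P by rewrite divr_ge0 // fine_ge0.
have muP P : P \in S -> exists2 p, 0 < p & mu P = p%:E.
  move=> /(sparse_cube sSE)[z [l [l0 ->]]]; exists (l ^+ n); first by rewrite exprn_gt0.
  by rewrite lebesgue_cube.
have -> : (\rint[mu]_x (`|f x| * disjoint_sum S E a x) =
    \rint[mu]_x (`|dominating_sum S b x * g x|))%E.
  transitivity (\sum_(P <- S) (a P * F P)%:E)%E.
    transitivity (\rint[mu]_x (\sum_(P <- S) a P * (`|f x| * \1_(E P) x))).
      congr (rint mu _); apply/funext => x; rewrite mulr_sumr; apply: eq_bigr => P _.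
      by rewrite mulrCA.
    rewrite rint_sum_mem.
    - apply: eq_big_seq => P PS; rewrite EFinM FE //; have := mE P PS => ?.
      by rewrite rintZ; [|by meas|by move=> x; rewrite mulr_ge0|exact: a0].
    - by move=> P /mE ?; meas.
    - by move=> P x; rewrite mulr_ge0 // mulr_ge0.
  transitivity (\rint[mu]_x (\sum_(P <- S) b P * (`|g x| * \1_P x))); last first.
    congr (rint mu _); apply/funext => x; rewrite normrM ger0_norm; last first.
      by apply: sumr_ge0 => P _; rewrite mulr_ge0.
    rewrite /dominating_sum mulr_suml; apply: eq_bigr => P _.
    by rewrite mulrA mulrAC.
  rewrite rint_sum_mem.
  - apply: eq_big_seq => P PS; have := mS P PS => ?.
    rewrite rintZ; [|by meas|by move=> x; rewrite mulr_ge0|exact: b0].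
    rewrite -aE // /b; have [p p0 ->] := muP P PS; rewrite -!EFinM /=; congr _%:E.
    by rewrite mulrCA divfK // gt_eqF.
  - by move=> P /mS ?; meas.
  - by move=> P x; rewrite mulr_ge0 // mulr_ge0.
apply: le_trans (associate_pairing bX (dominating_sum_mem b lX sSE) mg gfin) _.
apply: lee_wpmul2r; first exact: associate_norm_ge0.
rewrite lee_fin; apply: le_trans (KP S E b sSE b0) _; rewrite ler_pM2l //.
have [h [Xh nh] hE] := enorm_le iX mX (maximal_bound_of_fs bX q1 C0 fsX Xf).
apply: (@le_trans _ _ (fnorm X h)); last first.
  by apply: le_trans nh _; rewrite -[leRHS]mulr1 ler_pM2l.
have Xd := disjoint_sum_mem lX sSE b0.
apply: (iX Xh (mX Xd) _).2; apply: filterS hE => x hx.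
have h0 : 0 <= h x by rewrite -lee_fin -hx; exact: maximal_ge0.
rewrite ger0_norm ?(ger0_norm h0); last by apply: sumr_ge0 => P _; rewrite mulr_ge0.
apply: disjoint_sum_bound => // P PS Px; rewrite -lee_fin -hx.
have [z [l [l0 Pzl]]] := sparse_cube sSE PS.
apply: le_trans (maximal_ge f l0 (_ : cube z l x)); last by rewrite -Pzl; exact: (sparse_sub sSE).
rewrite /cube_average -Pzl /b EFinM muleC Pzl lebesgue_cube //= -Pzl FE //.
by apply: lee_wpmul2l; [rewrite lee_fin invr_ge0 exprn_ge0 // ltW|exact: FP].
Qed.

Lemma maximal_bounded_associate_of_fs : (0 < n)%N -> maximal_bounded (associate X).
Proof.
move=> n_gt0; have lA := associate_levi bX.
have [B B0 BP] := sparse_pairing.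
pose T := {ffun 'I_n -> bool}.
(* [6 ^+ n] comes from the dyadic cubes, 2 from the principal cubes, and each grid contributes one
   [B]. *)
pose B' := 6 ^+ n * (2 * (#|T|%:R * B)).
exists B' => g [mg gfin]; have g0 := associate_norm_ge0 bX g.
have gE : associate_norm X g = (fnorm (associate X) g)%:E by rewrite /= fineK // ge0_fin_numE.
have -> : maximal g = fun x => ereal_sup (range (truncated_maximal g ^~ x)).
  by apply/funext => x; exact: (maximal_truncated n_gt0).
apply: levi_enorm => //.
- by move=> L; exact: measurable_truncated_maximal.
- by move=> L x; exact: truncated_maximal_ge0.
- by move=> L x; exact: truncated_maximal_mono.
move=> L; have gQ c l : 0 < l -> (\rint[mu]_x (`|g x| * \1_(cube c l) x) < +oo)%E.
  move=> l0; have [D D0 DP] := levi_local lA c l0.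
  by apply: le_lt_trans (DP g _) (ltry _).
have [s [ls cs sP]] := @dyadic_families R n L.
pose a P := fine (\rint[mu]_x (`|g x| * \1_P x)) / fine (mu P).
have a0 P : 0 <= a P.
  by rewrite divr_ge0 // fine_ge0 //; apply: rint_ge0 => x; rewrite mulr_ge0.
have aE P : (exists z l, 0 < l /\ P = cube z l) ->
    ((a P)%:E * mu P = \rint[mu]_x (`|g x| * \1_P x))%E.
  move=> [z [l [l0 ->]]]; rewrite /a lebesgue_cube //= -EFinM divfK; last by rewrite gt_eqF // exprn_gt0.
  by rewrite fineK // ge0_fin_numE ?gQ //; apply: rint_ge0 => x; rewrite mulr_ge0.
have ex al := principal_sparse mg a0 (ls al) (cs al) (fun P Ps => aE P (cs al P Ps)).
have /choice[S /choice[E SE]] : forall al, exists S, exists E, [/\ sparse_family S E,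
    {subset S <= s al} & forall Q x, Q \in s al -> Q x -> a Q <= 2 * disjoint_sum S E a x] := ex.
have sSE al : sparse_family (S al) (E al) by have [] := SE al.
pose m al x := 2 * disjoint_sum (S al) (E al) a x.
have d0 al x : 0 <= disjoint_sum (S al) (E al) a x by apply: sumr_ge0 => P _; rewrite mulr_ge0.
have m0 al x : 0 <= m al x by rewrite mulr_ge0.
have Mm x : (truncated_maximal g L x <= (6 ^+ n * \sum_(al : T) m al x)%:E)%E.
  apply: (@truncated_maximal_dyadic R n g L mg s sP m m0) => al c l y l0 cs_ cy.
  have [_ _ /(_ _ _ cs_ cy) h] := SE al.
  rewrite /cube_average -aE; last by exists c, l.
  by rewrite lebesgue_cube // -!EFinM lee_fin mulrCA mulVf ?mulr1 // gt_eqF // exprn_gt0.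
pose tg x := fine (truncated_maximal g L x).
have tgE x : truncated_maximal g L x = (tg x)%:E.
  rewrite fineK // ge0_fin_numE ?truncated_maximal_ge0 //.
  exact: le_lt_trans (Mm x) (ltry _).
have tg0 x : 0 <= tg x by rewrite fine_ge0 // truncated_maximal_ge0.
have mtg : measurable_fun setT tg.
  by apply: measurableT_comp; [exact: fine_measurable|exact: measurable_truncated_maximal].
have md al : measurable_fun setT (disjoint_sum (S al) (E al) a).
  exact: (measurable_sum_mem a (sparse_measurable (sSE al))).
have tgB : (associate_norm X tg <= (B' * fnorm (associate X) g)%:E)%E.
  apply: le_associate_norm => f Xf f1; have mf := mX Xf.
  apply: (@le_trans _ _ (\rint[mu]_x (6 ^+ n * \sum_(al : T) 2 * (`|f x| * disjoint_sum (S al) (E al) a x)))).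
    apply: le_rint.
    - by meas.
    - by apply: measurable_funM => //; apply: measurable_sum => al; have := md al => ?; meas.
    - by move=> x.
    - move=> x; rewrite normrM (ger0_norm (tg0 x)).
      apply: (@le_trans _ _ (`|f x| * (6 ^+ n * \sum_(al : T) m al x))).
        by rewrite ler_wpM2l // -lee_fin -tgE.
      rewrite mulrCA mulr_sumr le_eqVlt; apply/orP; left; apply/eqP; congr (_ * _).
      by apply: eq_bigr => al _; rewrite /m mulrCA.
  have t0 al x : 0 <= 2 * (`|f x| * disjoint_sum (S al) (E al) a x) by rewrite !mulr_ge0.
  have mt al : measurable_fun setT (fun x => 2 * (`|f x| * disjoint_sum (S al) (E al) a x)).
    by have := md al => ?; meas.
  rewrite rintZ; [|by apply: measurable_sum|by move=> x; exact: sumr_ge0|exact: exprn_ge0].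
  rewrite rint_sum // /B' -mulrA EFinM; apply: lee_wpmul2l; first by rewrite lee_fin exprn_ge0.
  apply: (@le_trans _ _ (\sum_(al : T) (2 * (B * fnorm (associate X) g))%:E)%E).
    apply: lee_sum => al _; rewrite rintZ; [| |by move=> x; rewrite mulr_ge0|by []]; last first.
      by have := md al => ?; meas.
    rewrite EFinM; apply: lee_wpmul2l => //; rewrite EFinM -gE; apply: BP => //.
    by move=> P PS; apply: aE; exact: (sparse_cube (sSE al)).
  rewrite sumEFin sumr_const lee_fin -[leLHS]mulr_natl le_eqVlt; apply/orP; left; apply/eqP.
  by rewrite mulrCA !mulrA.
have Atg : associate X tg by split => //; exact: le_lt_trans tgB (ltry _).
rewrite (enorm_rep (levi_ideal lA) (levi_measurable lA) Atg); last first.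
  by apply: nearW => x; exact: tgE.
by move: tgB; rewrite /= fineK // ge0_fin_numE ?associate_norm_ge0 //; case: Atg.
Qed.

End associate_bound.

Theorem theorem1p1 (R : realType) (n : nat) (n_gt0 : (0 < n)%N) :
  (* (i) *)
  (forall X : fspace R n, ball_banach X ->
    let a := maximal_bounded X /\ maximal_bounded (associate X) in
    let b := exists q : R, 1 < q /\ exists C : R, 0 < C /\
               fs_finite_rhs X q C in
    let c := forall q : R, 1 < q -> exists C : R, 0 < C /\
               fs_finite_rhs X q C in
    (a <-> b) /\ (b <-> c)) /\
  (* (ii) *)
  ((forall X : fspace R n, ball_banach X ->
      forall q : R, 0 < q -> (exists C : R, fs_all X q C) -> 1 < q) /\
   (forall Y : fspace R n, ball_quasi_banach Y ->
      forall q : R, 0 < q -> q <= 1 -> ~ exists C : R, fs_finite_rhs Y q C)) /\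
  (* (iii) *)
  (forall X : fspace R n, ball_banach X ->
    forall q C : R, 1 < q -> 0 < C ->
      (fs_finite_rhs X q C -> fs_sequence X q C) /\
      (fs_sequence X q C -> fs_all X q C)) /\
  (* (iv) *)
  ((forall X : fspace R n, ball_banach X ->
      forall C : R, 0 < C ->
        (maximal_bound X C <-> max_inequality X C) /\
        (max_inequality X C <-> sup_inequality X C)) /\
   (exists X : fspace R n, ball_banach X /\
      (exists C : R, 0 < C /\
         maximal_bound X C /\ max_inequality X C /\ sup_inequality X C) /\
      ~ maximal_bounded (associate X))).
Proof.
split; [|split; [|split; [|split]]].
- move=> X bX a b c.
  have ac : a -> c by move=> [aX aA] q q1; exact: fs_of_maximal.
  have cb : c -> b by move=> Hc; exists 2; split; [exact: (ltr1n _ 2)|apply: Hc; exact: (ltr1n _ 2)].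
  have ba : b -> a.
    move=> [q [q1 [C [C0 fsX]]]]; split; first by exists C; exact: maximal_bound_of_fs fsX.
    exact: (maximal_bounded_associate_of_fs bX q1 C0 fsX n_gt0).
  by split; split; [move=> /ac/cb|exact: ba|move=> /ba/ac|exact: cb].
- have small := @no_fs_small_exponent R n n_gt0.
  split=> [X [bX _] q q0 [C fsX]|]; last by move=> Y bY q q0 q1; exact: small.
  have [//|q1] := ltP 1 q; exfalso.
  have bqX : ball_quasi_banach X by exists 1.
  by apply: (small X q bqX q0 q1); exists C => N f N0 mf _; exact: fsX.
- move=> X bX q C q1 C0; split; first exact: fs_finite_sequence.
  by apply: fs_sequence_all => //; exact: lt_trans ltr01 q1.
- move=> X bX C C0; split; [exact: maximal_bound_max|exact: max_sup_inequality].
- have Mb := @Linf_maximal_bound R n n_gt0; have bL := @Linf_ball_banach R n.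
  have mx : max_inequality (Linf R n) 1 by apply/(maximal_bound_max 1 n_gt0 bL).
  exists (Linf R n); split=> //; split; last exact: Linf_associate_unbounded.
  by exists 1; split=> //; split=> //; split=> //; apply/(max_sup_inequality 1 n_gt0 bL).
Qed.
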